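(* Let $\mathscr{S}\subset\mathbb{T}^n$. The following are equivalent: (i) there exists a convex semialgebraic set $\mathbf{S}\subset\mathbb{K}^n$ with $\mathrm{val}(\mathbf{S})=\mathscr{S}$; (ii) $\mathscr{S}$ is tropically convex and every stratum of $\mathscr{S}$ is a closed semilinear set; (iii) $\mathscr{S}$ is tropically convex and every stratum of $\mathscr{S}$ (viewed as a subset of $\mathbb{R}^K$) is the image, under projection onto its first $|K|$ coordinates, of a real tropical Metzler spectrahedron in $\mathbb{T}^{|K|+n'}$ for some $n'\ge0$; (iv) there exist $n'\ge 0$ and a tropical Metzler spectrahedron $\mathcal{S}\subset\mathbb{T}^{n+n'}$ such that $\mathscr{S}$ is the image of $\mathcal{S}$ under the projection onto the first $n$ coordinates.
   Context: $\mathbb{K}$: field of generalized real Puiseux series (formal series $\sum_{i\ge1}c_{\lambda_i}t^{\lambda_i}$, $(\lambda_i)$ strictly decreasing real, finite or unbounded, $c_{\lambda_i}\in\mathbb{R}\setminus\{0\}$), a real closed field ordered by the sign of the leading coefficient; $\mathrm{val}$ is the leading exponent, $\mathrm{val}(0)=-\infty$, applied coordinatewise. Semialgebraic sets over $\mathbb{K}$: finite unions of sets defined by finitely many polynomial strict inequalities $\mathbf{P}>0$ and equations $\mathbf{P}=0$ with coefficients in $\mathbb{K}$. Tropical semifield: $\mathbb{T}=\mathbb{R}\cup\{-\infty\}$ with $a\oplus b=\max(a,b)$, $a\odot b=a+b$. A set $X\subset\mathbb{T}^n$ is tropically convex if for all $x,y\in X$ and $\lambda,\mu\in\mathbb{T}$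 with $\max(\lambda,\mu)=0$, the point $\max(\lambda+x,\mu+y)$ (coordinatewise) lies in $X$. The support of $y\in\mathbb{T}^n$ is $\{k: y_k\neq-\infty\}$; for nonempty $K\subset[n]$, the stratum of $Y\subset\mathbb{T}^n$ associated with $K$ is the set of $(y_k)_{k\in K}\in\mathbb{R}^K$ for $y\in Y$ with support exactly $K$. A set in $\mathbb{R}^d$ is basic semilinear if it is $\{x: \langle A_i,x\rangle>b_i\ (i\le p),\ \langle A_i,x\rangle=b_i\ (p<i\le q)\}$ with $A\in\mathbb{Q}^{q\times d}$, $b\in\mathbb{R}^q$; semilinear means a finite union of basic semilinear sets. Signed tropical numbers: $\mathbb{S}=(\{+1,-1\}\times\mathbb{R})\cup\{(0,-\infty)\}$; $(1,a)$ is positive, $(-1,a)$ negative, and the modulus $|(s,a)|=a$. A matrix over $\mathbb{S}$ is tropical Metzler if its off-diagonal entries are negative or equal to $(0,-\infty)$. Given symmetric tropical Metzler matrices $Q^{(0)},\dots,Q^{(N)}\in\mathbb{S}^{m\times m}$, put $x_0:=0$ and for $x\in\mathbb{T}^N$: $Q^+_{ii}(x)=\max\{|Q^{(k)}_{ii}|+x_k: 0\le k\le N,\ Q^{(k)}_{ii}\text{ positive}\}$, $Q^-_{ii}(x)$ the same with ''negative'', (max of empty set $=-\infty$), and $Q_{ij}(x)=\max_{0\le k\le N}(|Q^{(k)}_{ij}|+x_k)$ for $i\ne j$. The tropical Metzler spectrahedron $\mathcal{S}(Q^{(0)}|Q^{(1)},\dots,Q^{(N)})$ is the set of $x\in\mathbb{T}^N$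 with $Q^+_{ii}(x)\ge Q^-_{ii}(x)$ for all $i$ and $Q^+_{ii}(x)+Q^+_{jj}(x)\ge 2Q_{ij}(x)$ for all $i\neq j$. It is real if it is contained in $\mathbb{R}^N$. *)

(* Defs.v *)
From Stdlib Require Import Reals QArith Qreals ClassicalEpsilon List.
From mathcomp Require Import all_boot.

Set Implicit Arguments.
Unset Strict Implicit.

Local Open Scope R_scope.

(* A series sum_i c_{lambda_i} t^{lambda_i} is represented by its coefficient *)
(* function R -> R (coefficient of t^lambda).  Its support must be a          *)
(* strictly decreasing sequence which is finite or unbounded (below), i.e.    *)
(* for every bound M only finitely many exponents of the support are >= M.    *)
Definition Kser := R -> R.

Definition is_puiseux (f : Kser) : Prop :=
  forall M : R, exists l : list R, forall x, f x <> 0 -> M <= x -> List.In x l.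

(* finite sum of h over the finite set P (determined via a duplicate-free list
   enumerating P; its value is independent of the chosen list) *)
Definition fsum (P : R -> Prop) (h : R -> R) : R :=
  let l := epsilon (inhabits nil)
             (fun l : list R => List.NoDup l /\ forall x, List.In x l <-> P x) in
  List.fold_right (fun x acc => h x + acc) 0 l.

Definition kzero : Kser := fun _ => 0.
Definition kone : Kser := fun l => if Req_EM_T l 0 then 1 else 0.
Definition kadd (f g : Kser) : Kser := fun l => f l + g l.
Definition kopp (f : Kser) : Kser := fun l => - f l.
Definition kmul (f g : Kser) : Kser :=
  fun e => fsum (fun a => f a <> 0 /\ g (e - a) <> 0) (fun a => f a * g (e - a)).
Definition kpow (f : Kser) (k : nat) : Kser := Nat.iter k (kmul f) kone.

Definition kis0 (f : Kser) : Prop := forall l, f l = 0.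
Definition kpos (f : Kser) : Prop :=
  exists l, f l <> 0 /\ (forall m, f m <> 0 -> m <= l) /\ 0 < f l.
Definition knonneg (f : Kser) : Prop := kis0 f \/ kpos f.
Definition kle (f g : Kser) : Prop := knonneg (kadd g (kopp f)).

(* Tropical numbers T = R ∪ {-oo}, encoded as option R (None = -oo).        *)
Definition Trop := option R.

Definition tmax (a b : Trop) : Trop :=
  match a, b with
  | None, _ => b
  | _, None => a
  | Some x, Some y => Some (Rmax x y)
  end.
Definition tplus (a b : Trop) : Trop :=
  match a, b with
  | Some x, Some y => Some (x + y)
  | _, _ => None
  end.
Definition tle (a b : Trop) : Prop :=
  match a, b with
  | None, _ => True
  | Some _, None => False
  | Some x, Some y => x <= y
  end.

Definition kval (f : Kser) : Trop :=
  epsilon (inhabits None) (fun v : Trop =>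
    match v with
    | None => kis0 f
    | Some l => f l <> 0 /\ forall m, f m <> 0 -> m <= l
    end).

Definition kpoint (n : nat) (x : 'I_n -> Kser) : Prop := forall i, is_puiseux (x i).

Definition kpoly (n : nat) := list (Kser * ('I_n -> nat)).

Definition kpoly_coeffs (n : nat) (P : kpoly n) : Prop :=
  forall m, List.In m P -> is_puiseux (fst m).

Definition keval (n : nat) (P : kpoly n) (x : 'I_n -> Kser) : Kser :=
  List.fold_right
    (fun m acc =>
       kadd (kmul (fst m)
               (List.fold_right (fun i a => kmul (kpow (x i) (snd m i)) a)
                                kone (enum 'I_n))) acc)
    kzero P.

(* basic semialgebraic set: (strict inequalities P > 0, equations P = 0) *)
Definition basic_sa (n : nat) := (list (kpoly n) * list (kpoly n))%type.

Definition basic_sa_wf (n : nat) (B : basic_sa n) : Prop :=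
  (forall P, List.In P (fst B) -> kpoly_coeffs P) /\
  (forall P, List.In P (snd B) -> kpoly_coeffs P).

Definition in_basic_sa (n : nat) (B : basic_sa n) (x : 'I_n -> Kser) : Prop :=
  (forall P, List.In P (fst B) -> kpos (keval P x)) /\
  (forall P, List.In P (snd B) -> kis0 (keval P x)).

Definition semialgebraic (n : nat) (S : ('I_n -> Kser) -> Prop) : Prop :=
  (forall x, S x -> kpoint x) /\
  exists Bs : list (basic_sa n),
    (forall B, List.In B Bs -> basic_sa_wf B) /\
    forall x, kpoint x -> (S x <-> exists B, List.In B Bs /\ in_basic_sa B x).

Definition kconvex (n : nat) (S : ('I_n -> Kser) -> Prop) : Prop :=
  forall x y t, S x -> S y -> is_puiseux t -> kle kzero t -> kle t kone ->
    S (fun i => kadd (kmul t (x i)) (kmul (kadd kone (kopp t)) (y i))).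

Definition val_image (n : nat) (S : ('I_n -> Kser) -> Prop) (Sc : ('I_n -> Trop) -> Prop) :=
  forall y, Sc y <-> exists x, S x /\ forall i, y i = kval (x i).

Definition trop_convex (n : nat) (X : ('I_n -> Trop) -> Prop) : Prop :=
  forall x y (lam mu : Trop), X x -> X y -> tmax lam mu = Some 0 ->
    X (fun i => tmax (tplus lam (x i)) (tplus mu (y i))).

(* stratum of Y associated with K, as a subset of R^K identified with R^{|K|}
   via the increasing enumeration of K *)
Definition stratum (n : nat) (Y : ('I_n -> Trop) -> Prop) (K : {set 'I_n})
  : ('I_#|K| -> R) -> Prop :=
  fun z => exists y, Y y /\ (forall i, i \in K <-> y i <> None) /\
                     forall j : 'I_#|K|, y (enum_val j) = Some (z j).
Arguments stratum {n} Y K z.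

Definition rdot (d : nat) (a : 'I_d -> Q) (x : 'I_d -> R) : R :=
  List.fold_right (fun i acc => Q2R (a i) * x i + acc) 0 (enum 'I_d).

(* basic semilinear set: (strict rows <A_i,x> > b_i, equality rows <A_i,x> = b_i) *)
Definition basic_sl (d : nat) := (list (('I_d -> Q) * R) * list (('I_d -> Q) * R))%type.

Definition in_basic_sl (d : nat) (B : basic_sl d) (x : 'I_d -> R) : Prop :=
  (forall r, List.In r (fst B) -> rdot (fst r) x > snd r) /\
  (forall r, List.In r (snd B) -> rdot (fst r) x = snd r).

Definition semilinear (d : nat) (S : ('I_d -> R) -> Prop) : Prop :=
  exists Bs : list (basic_sl d),
    forall x, S x <-> exists B, List.In B Bs /\ in_basic_sl B x.

Definition rclosed (d : nat) (S : ('I_d -> R) -> Prop) : Prop :=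
  forall x, ~ S x -> exists eps, eps > 0 /\
    forall y, (forall i, Rabs (y i - x i) < eps) -> ~ S y.

Inductive stnum : Type :=
| SPos : R -> stnum      (* (+1, a) *)
| SNeg : R -> stnum      (* (-1, a) *)
| SZero : stnum.         (* (0, -oo) *)

Definition smod (a : stnum) : Trop :=
  match a with SPos x => Some x | SNeg x => Some x | SZero => None end.
Definition is_spos (a : stnum) : bool := if a is SPos _ then true else false.
Definition is_sneg (a : stnum) : bool := if a is SNeg _ then true else false.

Definition smatrix (m : nat) := 'I_m -> 'I_m -> stnum.

Definition trop_metzler (m : nat) (Q : smatrix m) : Prop :=
  forall i j, i <> j -> is_sneg (Q i j) \/ Q i j = SZero.
Definition ssym (m : nat) (Q : smatrix m) : Prop := forall i j, Q i j = Q j i.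

Definition xext (N : nat) (x : 'I_N -> Trop) (k : 'I_N.+1) : Trop :=
  match unlift ord0 k with Some j => x j | None => Some 0 end.

Definition tbigmax (N : nat) (p : 'I_N.+1 -> bool) (F : 'I_N.+1 -> Trop) : Trop :=
  List.fold_right (fun k acc => if p k then tmax (F k) acc else acc) None (enum 'I_N.+1).

Definition Qplus_ii (N m : nat) (Qs : 'I_N.+1 -> smatrix m) (x : 'I_N -> Trop) (i : 'I_m) :=
  tbigmax (fun k => is_spos (Qs k i i)) (fun k => tplus (smod (Qs k i i)) (xext x k)).
Definition Qminus_ii (N m : nat) (Qs : 'I_N.+1 -> smatrix m) (x : 'I_N -> Trop) (i : 'I_m) :=
  tbigmax (fun k => is_sneg (Qs k i i)) (fun k => tplus (smod (Qs k i i)) (xext x k)).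
Definition Q_ij (N m : nat) (Qs : 'I_N.+1 -> smatrix m) (x : 'I_N -> Trop) (i j : 'I_m) :=
  tbigmax (fun _ => true) (fun k => tplus (smod (Qs k i j)) (xext x k)).

Definition metzler_spec (N m : nat) (Qs : 'I_N.+1 -> smatrix m) (x : 'I_N -> Trop) : Prop :=
  (forall i, tle (Qminus_ii Qs x i) (Qplus_ii Qs x i)) /\
  (forall i j, i <> j ->
     tle (tplus (Q_ij Qs x i j) (Q_ij Qs x i j))
         (tplus (Qplus_ii Qs x i) (Qplus_ii Qs x j))).

Definition metzler_family (N m : nat) (Qs : 'I_N.+1 -> smatrix m) : Prop :=
  forall k, ssym (Qs k) /\ trop_metzler (Qs k).

(* Main.v *)
From HB Require Import structures.
From Pilot Require Import Defs.
From Stdlib Require Import Reals QArith Qreals ClassicalEpsilon List.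
From Stdlib Require Import ZArith.
From mathcomp Require Import all_boot all_order all_algebra.
From mathcomp Require Import boolp Rstruct.
From mathcomp Require Import polyrcf ordered_qelim.
From mathcomp Require qe_rcf.
From mathcomp Require Import mpoly.
From mathcomp Require Import ring lra zify.
Import Pilot.Defs.

(* The valuation of a semialgebraic set. For a point [y] of [R^K], consider the points [(x, rho)]
   such that [S] meets the box [{x' : x / rho <= |x'| <= rho x}]. By quantifier elimination over
   the real closed field of Puiseux series this is a quantifier-free condition. At
   [x = t^(y + delta)], [rho = t^eta] with [delta << eta] generic and infinitely small, the sign of
   a polynomial is the sign of its dominating monomial, so that the condition is semilinear in
   [y]. For a fixed [y] it amounts to the same condition at a large real constant [rho], and it
   says that [y] is the valuation of a point of [S]. That no constant [rho] works is therefore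
   detected by some [rho = t^eta] with [eta > 0], which rules out a whole neighbourhood of [y]:
   the strata are closed.

   Conversely, closed semilinear strata are finite unions of polyhedra [P]. A point [x] lies in
   their tropical convex hull iff, for every finite coordinate [k] (including a homogenizing
   coordinate), some [P] contains a point [p <= x] with [p_k = x_k]. Fourier-Motzkin elimination of
   [p] turns this into inequalities between [x_k] and rational averages of coordinates of [x], and
   averages are trees of constraints [2 w <= u + v], which are 2x2 Metzler constraints. Finally,
   a tropical Metzler spectrahedron lifts to the convex semialgebraic set defined by
   [L_ij^2 <= C L_i L_j] on the nonnegative orthant.

   The field of series is real closed by Hensel's lemma: a monic polynomial with a sign change,
   normalized to be depressed and of valuation 0, has a residue polynomial that either has no real
   root (no sign change) or has a proper coprime factorization, which lifts. *)

Set Implicit Arguments.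
Unset Strict Implicit.
Unset Printing Implicit Defensive.

Import Order.TTheory GRing.Theory Num.Theory.
Bind Scope ring_scope with R.
Local Open Scope ring_scope.

(** * The ring of series *)

(** Three points shape the passage from strata to spectrahedra. The pieces of all strata enter one
    hull, although they live in different supports. A constraint must therefore become void, not
    false, at [-oo], and averages are stated under the guard that the averaged variable is finite.
    Next, [cond_iii] asks for spectrahedra without [-oo]. The class [rep] of projections thus
    carries an extra clause: above a finite point the auxiliary variables can be chosen finite.
    Forcing every variable to be finite then loses no finite point. The way back from [cond_iii] is
    not polyhedral: the spectrahedron is lifted to series and the strata of the lift are analysed.
    Finally, the homogenizing coordinate gives every row coefficient sum 0. This makes the polyhedra
    invariant under adding constants, so that a point of each can be pushed below any finite point,
    and it turns the eliminated rows into averages. The lift only involves 2x2 conditions: each cone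
    [a^2 <= C b c] in the nonnegative orthant is convex on its own, and no semidefinite matrix has
    to be considered. *)

Lemma InE (T : eqType) (x : T) (s : seq T) : List.In x s <-> x \in s.
Proof.
elim: s => [|a s IH] //=; rewrite inE IH; split.
  by case=> [->|->]; rewrite ?eqxx ?orbT.
by case/orP => [/eqP ->|]; [left|right].
Qed.

Lemma NoDupE (T : eqType) (s : seq T) : List.NoDup s <-> uniq s.
Proof.
elim: s => [|a s IH]; first by split=> // _; constructor.
rewrite /= List.NoDup_cons_iff IH InE; split=> [[/negP -> ->]|/andP[/negP]] //.
Qed.

Lemma is_puiseuxP f : is_puiseux f <->
  forall M : R, exists s : seq R, forall x, f x != 0 -> M <= x -> x \in s.
Proof.
split=> H M; have [s Hs] := H M; exists s => x.
  by move=> /eqP h /RleP h'; apply/InE; apply: Hs.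
by move=> /eqP h /RleP h'; apply/InE; apply: Hs.
Qed.

(** An upper bound on the valuation that also covers the zero series, so that estimates need no case
    distinction. *)
Definition vle (f : Kser) (r : R) := forall x, f x != 0 -> x <= r.

Lemma puiseux_ub f : is_puiseux f -> exists B, vle f B.
Proof.
move=> /is_puiseuxP/(_ 0)[s Hs]; exists (\big[Num.max/0]_(x <- s) x) => x fx.
have [x0|x0] := lerP 0 x; last by apply: le_trans (ltW x0) _; exact: bigmax_ge_id.
exact: (le_bigmax_seq 0 x predT id (Hs x fx x0)).
Qed.

(** If [g] vanishes above [B], only exponents [a >= e - B] of [f] contribute to the coefficient of
    [t^e], and these are finitely many. *)
Lemma kmul_cover f g e : is_puiseux f -> is_puiseux g ->
  exists s : seq R, uniq s /\ forall a, f a != 0 -> g (e - a) != 0 -> a \in s.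
Proof.
move=> /is_puiseuxP Pf /puiseux_ub[B HB].
have [s Hs] := Pf (e - B); exists (undup s); split; first exact: undup_uniq.
move=> a fa ga; rewrite mem_undup; apply: Hs => //.
by have := HB _ ga; lra.
Qed.

(** Replaces the list chosen by [epsilon] in [fsum] by any duplicate-free list containing the
    contributing exponents, so that several products can be summed over a common list. *)
Lemma kmulE f g e (s : seq R) : uniq s ->
  (forall a, f a != 0 -> g (e - a) != 0 -> a \in s) ->
  kmul f g e = \sum_(a <- s) f a * g (e - a).
Proof.
move=> us Hs; rewrite /kmul /fsum; set l := epsilon _ _.
have [ul hl] : List.NoDup l /\ forall x, List.In x l <-> (f x <> 0 /\ g (Rminus e x) <> 0).
  apply: (epsilon_spec (inhabits nil)
    (fun l : list R => List.NoDup l /\ forall x, List.In x l <-> (f x <> 0 /\ g (Rminus e x) <> 0))).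
  exists [seq a <- s | (f a != 0) && (g (e - a) != 0)]; split.
    by apply/NoDupE; rewrite filter_uniq.
  move=> x; rewrite InE mem_filter; split=> [/andP[/andP[/eqP ? /eqP ?] _] //|[/eqP fx /eqP gx]].
  by rewrite fx gx Hs.
transitivity (\sum_(a <- l) f a * g (e - a)).
  by elim: (l) => [|a t IH]; rewrite ?big_nil ?big_cons //= IH.
rewrite [RHS](bigID (fun a => (f a != 0) && (g (e - a) != 0))) /=.
rewrite [X in _ = _ + X]big1 ?addr0 => [|a]; last first.
  by rewrite negb_and !negbK => /orP[]/eqP ->; rewrite ?mul0r ?mulr0.
rewrite -[RHS]big_filter; apply: perm_big; apply: uniq_perm; rewrite ?filter_uniq //.
  exact/NoDupE.
move=> x; rewrite mem_filter; apply/idP/idP.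
  by move/InE/hl => [/eqP fx /eqP gx]; rewrite fx gx Hs.
by move=> /andP[/andP[/eqP fx /eqP gx] _]; apply/InE/hl.
Qed.

Lemma kmul_neq0 f g e : kmul f g e != 0 -> is_puiseux f -> is_puiseux g ->
  exists a, f a != 0 /\ g (e - a) != 0.
Proof.
move=> H Pf Pg; have [s [us Hs]] := kmul_cover e Pf Pg.
move: H; rewrite (kmulE us Hs); apply: contraNP => H.
rewrite big1 // => a _; apply/eqP; rewrite mulf_eq0.
by apply: contra_notT H; rewrite negb_or => /andP[? ?]; exists a.
Qed.

Lemma puiseux_add f g : is_puiseux f -> is_puiseux g -> is_puiseux (kadd f g).
Proof.
move=> /is_puiseuxP Pf /is_puiseuxP Pg; apply/is_puiseuxP => M.
have [s Hs] := Pf M; have [t Ht] := Pg M; exists (s ++ t) => x H Mx.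
rewrite mem_cat; have [fx|fx] := eqVneq (f x) 0; last by rewrite Hs.
rewrite Ht ?orbT //; apply: contra H => /eqP gx; apply/eqP.
by rewrite /kadd fx gx /= RplusE addr0.
Qed.

Lemma puiseux_opp f : is_puiseux f -> is_puiseux (kopp f).
Proof.
move=> /is_puiseuxP Pf; apply/is_puiseuxP => M.
have [s Hs] := Pf M; exists s => x; rewrite /kopp RoppE oppr_eq0; exact: Hs.
Qed.

Lemma puiseux_0 : is_puiseux kzero.
Proof. by apply/is_puiseuxP => M; exists [::] => x; rewrite /kzero eqxx. Qed.

Lemma puiseux_mul f g : is_puiseux f -> is_puiseux g -> is_puiseux (kmul f g).
Proof.
move=> Pf Pg; have [Bf hf] := puiseux_ub Pf; have [Bg hg] := puiseux_ub Pg.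
apply/is_puiseuxP => M.
have /is_puiseuxP/(_ (M - Bg))[s Hs] := Pf.
have /is_puiseuxP/(_ (M - Bf))[t Ht] := Pg.
exists [seq a + b | a <- s, b <- t] => x /kmul_neq0 /(_ Pf Pg)[a [fa gb]] Mx.
have -> : x = a + (x - a) by ring.
have := hf _ fa; have := hg _ gb => h1 h2.
by apply: allpairs_f; [apply: Hs|apply: Ht] => //; lra.
Qed.

Definition kmon (c e : R) : Kser := fun x => if x == e then c else 0.

Lemma puiseux_mon c e : is_puiseux (kmon c e).
Proof.
apply/is_puiseuxP => M; exists [:: e] => x; rewrite /kmon inE.
by have [|] := eqVneq x e => // _; rewrite eqxx.
Qed.

Lemma kone_mon : kone = kmon 1 0.
Proof.
by apply: funext => x; rewrite /kone /kmon; case: RIneq.Req_EM_T => [/= ->|/= /eqP/negPf ->] //; rewrite eqxx.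
Qed.

Record puiseux := Puiseux { pser :> R -> R; pserP : is_puiseux pser }.

HB.instance Definition _ := gen_eqMixin puiseux.
HB.instance Definition _ := gen_choiceMixin puiseux.

Lemma puiseux_ext (x y : puiseux) : (forall e, x e = y e) -> x = y.
Proof.
case: x y => f Pf [g Pg] /= /funext E; case: _ / E in Pg *.
by congr Puiseux; apply: Prop_irrelevance.
Qed.

Definition padd x y := Puiseux (puiseux_add (pserP x) (pserP y)).
Definition popp x := Puiseux (puiseux_opp (pserP x)).
Definition pzero := Puiseux puiseux_0.
Definition pmul x y := Puiseux (puiseux_mul (pserP x) (pserP y)).
Definition mono c e := Puiseux (puiseux_mon c e).

Fact paddA : associative padd.
Proof. by move=> x y z; apply: puiseux_ext => e; rewrite /= /kadd !RplusE addrA. Qed.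
Fact paddC : commutative padd.
Proof. by move=> x y; apply: puiseux_ext => e; rewrite /= /kadd !RplusE addrC. Qed.
Fact padd0 : left_id pzero padd.
Proof. by move=> x; apply: puiseux_ext => e; rewrite /= /kadd !RplusE add0r. Qed.
Fact paddN : left_inverse pzero popp padd.
Proof. by move=> x; apply: puiseux_ext => e; rewrite /= /kadd /kopp !RplusE RoppE addNr. Qed.

HB.instance Definition _ := GRing.isZmodule.Build puiseux paddA paddC padd0 paddN.

Lemma pmulE (x y : puiseux) e (s : seq R) : uniq s ->
  (forall a, x a != 0 -> y (e - a) != 0 -> a \in s) ->
  pmul x y e = \sum_(a <- s) x a * y (e - a).
Proof. exact: kmulE. Qed.

Fact pmulC : commutative pmul.
Proof.
move=> x y; apply: puiseux_ext => e.
have [s [us Hs]] := kmul_cover e (pserP x) (pserP y).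
rewrite (pmulE us Hs) (@pmulE _ _ _ [seq e - a | a <- s]).
- rewrite big_map; apply: eq_bigr => a _; rewrite mulrC; congr (_ * x _).
  by rewrite opprB addrC subrK.
- by rewrite map_inj_uniq // => a b /(can_inj (subKr e)).
- move=> a ya xa; apply/mapP; exists (e - a); last by rewrite opprB addrC subrK.
  by apply: Hs; rewrite ?opprB // addrC subrK.
Qed.

Fact pmulDl : left_distributive pmul padd.
Proof.
move=> x y z; apply: puiseux_ext => e.
have [s [us Hs]] := kmul_cover e (pserP x) (pserP z).
have [t [ut Ht]] := kmul_cover e (pserP y) (pserP z).
pose u := undup (s ++ t).
have uu : uniq u by apply: undup_uniq.
have Hxy a : x a != 0 -> z (e - a) != 0 -> a \in u.
  by move=> h h'; rewrite mem_undup mem_cat Hs.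
have Hyx a : y a != 0 -> z (e - a) != 0 -> a \in u.
  by move=> h h'; rewrite mem_undup mem_cat Ht ?orbT.
transitivity (pmul x z e + pmul y z e) => //.
rewrite (@pmulE x z e u uu Hxy) (@pmulE y z e u uu Hyx) -big_split /=.
rewrite -[kmul _ _]/(pser (pmul (padd x y) z)) (@pmulE (padd x y) z e u) //.
  by apply: eq_bigr => a _; rewrite -mulrDl.
move=> a; have [xa|xa] := eqVneq (x a) 0; last by move=> _; apply: Hxy.
move=> yx; apply: Hyx; apply: contra yx => /eqP ya.
by rewrite /= /kadd xa ya RplusE addr0.
Qed.

Fact pmul1 : left_id (mono 1 0) pmul.
Proof.
move=> x; apply: puiseux_ext => e.
rewrite (@pmulE _ _ _ [:: 0]) //.
  by rewrite big_seq1 /= /kmon eqxx mul1r subr0.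
by move=> a; rewrite /= /kmon inE; have [|] := eqVneq a 0 => // _; rewrite eqxx.
Qed.

(** Both sides become the double sum of [x a * y (c - a) * z (e - c)] over the same two finite
    lists, one for [a] and one for [c = a + b]; exchanging the sums concludes. *)
Fact pmulA : associative pmul.
Proof.
move=> x y z; apply: puiseux_ext => e.
have [Bx hx] := puiseux_ub (pserP x); have [By hy] := puiseux_ub (pserP y).
have [Bz hz] := puiseux_ub (pserP z).
have /is_puiseuxP/(_ (e - By - Bz))[s0 Hs0] := pserP x.
have /is_puiseuxP/(_ (e - Bx - Bz))[t0 Ht0] := pserP y.
pose s := undup s0.
have us : uniq s by apply: undup_uniq.
pose u := undup [seq a + b | a <- s0, b <- t0].
have uu : uniq u by apply: undup_uniq.
have Hs a b : x a != 0 -> y b != 0 -> z (e - a - b) != 0 -> (a \in s) && (a + b \in u).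
  move=> xa yb zc; have := hx _ xa; have := hy _ yb; have := hz _ zc => h1 h2 h3.
  have as0 : a \in s0 by apply: Hs0 => //; lra.
  rewrite !mem_undup as0 /=; apply: allpairs_f => //.
  by apply: Ht0 => //; lra.
rewrite (@pmulE x (pmul y z) e s) //; last first.
  move=> a xa /kmul_neq0 /(_ (pserP _) (pserP _))[b [yb zc]].
  by have /andP[] := Hs a b xa yb zc.
rewrite (@pmulE (pmul x y) z e u) //; last first.
  move=> c /kmul_neq0 /(_ (pserP _) (pserP _))[a [xa yb]] zc.
  by have := Hs a (c - a) xa yb; rewrite -addrA -opprD [a + _]addrC subrK => /(_ zc) /andP[].

transitivity (\sum_(a <- s) \sum_(c <- u) x a * y (c - a) * z (e - c)).
  apply: eq_bigr => a _; have [xa|xa] := eqVneq (x a) 0.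
    by rewrite xa mul0r big1 // => c _; rewrite !mul0r.
  rewrite (@pmulE y z _ [seq c - a | c <- u]).
  - rewrite big_map mulr_sumr; apply: eq_bigr => c _; rewrite mulrA; congr (_ * z _).
    by rewrite opprB addrA subrK.
  - by rewrite map_inj_uniq // => c d /(can_inj (subrK a)).
  - move=> b yb zc; apply/mapP; exists (a + b); last by rewrite addrC addKr.
    by have /andP[] := Hs a b xa yb zc.
rewrite exchange_big; apply: eq_bigr => c _ /=; rewrite -mulr_suml.
have [zc|zc] := eqVneq (z (e - c)) 0; first by rewrite zc !mulr0.
congr (_ * _); rewrite -[kmul x y]/(pser (pmul x y)) (@pmulE _ _ _ s) // => a xa yb.
by have := Hs a (c - a) xa yb; rewrite -addrA -opprD [a + _]addrC subrK => /(_ zc) /andP[].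
Qed.

Fact pone_neq0 : mono 1 0 != pzero.
Proof.
apply/eqP => /(congr1 (fun x : puiseux => x 0)) /eqP; rewrite /= /kmon eqxx /kzero.
by rewrite oner_eq0.
Qed.

HB.instance Definition _ :=
  GRing.Zmodule_isComNzRing.Build puiseux pmulA pmulC pmul1 pmulDl pone_neq0.

Lemma pserD (x y : puiseux) : pser (x + y) = kadd x y. Proof. by []. Qed.
Lemma pserM (x y : puiseux) : pser (x * y) = kmul x y. Proof. by []. Qed.
Lemma pser0 : pser 0 = kzero. Proof. by []. Qed.
Lemma pser1 : pser 1 = kone. Proof. by rewrite kone_mon. Qed.
Lemma pserX (x : puiseux) k : pser (x ^+ k) = kpow x k.
Proof. by elim: k => [|k IH]; rewrite ?pser1 // exprS pserM IH. Qed.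

Lemma pcoefD (x y : puiseux) e : (x + y) e = x e + y e. Proof. by []. Qed.
Lemma pcoefN (x : puiseux) e : (- x) e = - x e. Proof. by []. Qed.
Lemma pcoefB (x y : puiseux) e : (x - y) e = x e - y e. Proof. by []. Qed.
Lemma pcoef0 e : (0 : puiseux) e = 0. Proof. by []. Qed.
Lemma pcoef_mono c a e : mono c a e = if e == a then c else 0. Proof. by []. Qed.

Lemma pcoefM (x y : puiseux) e (s : seq R) : uniq s ->
  (forall a, x a != 0 -> y (e - a) != 0 -> a \in s) ->
  (x * y) e = \sum_(a <- s) x a * y (e - a).
Proof. exact: kmulE. Qed.

Lemma pcoef_sum I (r : seq I) (P : pred I) (F : I -> puiseux) e :
  (\sum_(i <- r | P i) F i) e = \sum_(i <- r | P i) F i e.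
Proof. by apply: (big_morph (fun x : puiseux => x e)). Qed.

(** * Valuation, order and field structure *)

Lemma vle_trans f r s : vle f r -> r <= s -> vle f s.
Proof. by move=> H rs x /H h; exact: le_trans rs. Qed.

Lemma vle0 r : vle (0 : puiseux) r.
Proof. by move=> x; rewrite pcoef0 eqxx. Qed.

Lemma vleD (x y : puiseux) r : vle x r -> vle y r -> vle (x + y) r.
Proof.
move=> hx hy e; have [/eqP xe|/hx //] := boolP (x e == 0); rewrite pcoefD xe add0r; exact: hy.
Qed.

Lemma vleN (x : puiseux) r : vle x r -> vle (- x) r.
Proof. by move=> hx e; rewrite pcoefN oppr_eq0; exact: hx. Qed.

Lemma vleB (x y : puiseux) r : vle x r -> vle y r -> vle (x - y) r.
Proof. by move=> hx hy; apply: vleD => //; apply: vleN. Qed.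

Lemma vleM (x y : puiseux) r s : vle x r -> vle y s -> vle (x * y) (r + s).
Proof.
move=> hx hy e /kmul_neq0 /(_ (pserP _) (pserP _))[a [/hx h /hy h']].
by rewrite -[e](subrK a) addrC lerD.
Qed.

Lemma vle_sum I (r : seq I) (P : pred I) (F : I -> puiseux) v :
  (forall i, P i -> vle (F i) v) -> vle (\sum_(i <- r | P i) F i) v.
Proof. by move=> H; elim/big_rec: _ => [|i x Pi IH]; [exact: vle0|apply: vleD => //; exact: H]. Qed.

Lemma vle_mono c e : vle (mono c e) e.
Proof. by move=> x; rewrite pcoef_mono; have [->|_] := eqVneq x e; rewrite ?eqxx. Qed.

Lemma mono1 : mono 1 0 = 1. Proof. by []. Qed.

Lemma vle1 : vle (1 : puiseux) 0.
Proof. exact: vle_mono. Qed.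

Lemma vleX (x : puiseux) r n : vle x r -> vle (x ^+ n) (n%:R * r).
Proof.
move=> H; elim: n => [|n IH]; first by rewrite mul0r; exact: vle1.
by rewrite exprS -natr1 mulrDl mul1r addrC; apply: vleM.
Qed.

Lemma nat_above (r : R) : exists n : nat, r < n%:R.
Proof. by exists (Num.bound `|r|); exact: le_lt_trans (ler_norm r) (archi_boundP (normr_ge0 r)). Qed.

Lemma vle_eq0 (x : puiseux) eps : 0 < eps -> (forall n : nat, vle x (- (n%:R * eps))) -> x = 0.
Proof.
move=> e0 H; apply: puiseux_ext => e; rewrite pcoef0; apply/eqP/negP => /negP xe.
have [n Hn] := nat_above (- e / eps).
by have := H n e xe; rewrite ltr_pdivrMr // in Hn; lra.
Qed.

Definition isval (x : puiseux) (l : R) := x l != 0 /\ vle x l.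

Lemma isval_exists (x : puiseux) : x != 0 -> exists l, isval x l.
Proof.
move=> x0.
have [e xe] : exists e, x e != 0.
  apply: contraPP x0 => H; apply/negP; rewrite negbK; apply/eqP/puiseux_ext => e.
  by rewrite pcoef0; apply/eqP/negP => /negP xe; apply: H; exists e.
have /is_puiseuxP/(_ e)[s Hs] := pserP x.
pose s' := [seq a <- s | x a != 0].
pose m := \big[Num.max/e]_(a <- s') a.
have em : e <= m by exact: bigmax_ge_id.
exists m; split; last first.
  move=> a xa; have [ea|ae] := lerP e a; last by apply: ltW; exact: lt_le_trans em.
  apply: (le_bigmax_seq e a predT id) => //.
  by rewrite mem_filter xa Hs.
rewrite /m big_seq; elim/big_ind: _ => //; first by move=> a b; case: (leP a b).
by move=> a; rewrite mem_filter => /andP[].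
Qed.

Lemma isval_neq0 x l : isval x l -> x != 0.
Proof. by case=> xl _; apply: contra xl => /eqP ->. Qed.

Lemma isval_uniq x l m : isval x l -> isval x m -> l = m.
Proof. by move=> [xl hl] [xm hm]; apply/eqP; rewrite eq_le hl // hm. Qed.

Lemma pcoefM_lead (x y : puiseux) l m : vle x l -> vle y m -> (x * y) (l + m) = x l * y m.
Proof.
move=> hx hy; rewrite (@pcoefM _ _ _ [:: l]) //; first by rewrite big_seq1 addrC addKr.
by move=> a /hx h /hy h'; rewrite inE eq_le; apply/andP; split; lra.
Qed.

Lemma isvalM x y l m : isval x l -> isval y m -> isval (x * y) (l + m).
Proof.
move=> [xl hx] [ym hy]; split; last exact: vleM.
by rewrite (pcoefM_lead hx hy) mulf_neq0.
Qed.

Lemma isval_mono c e : c != 0 -> isval (mono c e) e.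
Proof. by move=> c0; split; [rewrite pcoef_mono eqxx|exact: vle_mono]. Qed.

Lemma isvalN x l : isval x l -> isval (- x) l.
Proof. by move=> [xl hx]; split; [rewrite pcoefN oppr_eq0|exact: vleN]. Qed.

(** The support is discrete from above, so that after removal of the constant term the next exponent
    is strictly negative. This gap is the rate of convergence of the geometric series and of
    Hensel's iteration. *)
Lemma vle_gap (x : puiseux) : vle x 0 -> exists2 eps, 0 < eps & vle (x - mono (x 0) 0) (- eps).
Proof.
move=> hx; set z := x - _.
have [->|z0] := eqVneq z 0; first by exists 1 => //; exact: vle0.
have [l [zl hz]] := isval_exists z0.
have l0 : l <= 0 by have : vle z 0 by [apply: vleB => //; exact: vle_mono]; apply.
exists (- l); last by rewrite opprK.
rewrite oppr_gt0 lt_neqAle l0 andbT; apply: contra zl => /eqP ->.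
by rewrite /z pcoefB pcoef_mono eqxx subrr.
Qed.

Lemma mono_mul a b e f : mono a e * mono b f = mono (a * b) (e + f).
Proof.
apply: puiseux_ext => x; rewrite (@pcoefM _ _ _ [:: e]) //; last first.
  by move=> y; rewrite pcoef_mono inE; have [->|] := eqVneq y e; rewrite ?eqxx.
rewrite big_seq1 !pcoef_mono eqxx subr_eq [f + e]addrC; case: ifP => //; by rewrite mulr0.
Qed.

(** The coefficient of [t^e] is constant in [n] as soon as [- (n * eps) < e]; the limit reads it at
    such a rank [N e]. Above [M] the limit agrees with the single series [u (N M)], hence its
    support is again finite there. *)
Lemma puiseux_lim (u : nat -> puiseux) eps : 0 < eps ->
  (forall n, vle (u n.+1 - u n) (- (n%:R * eps))) ->
  exists x : puiseux, forall n, vle (x - u n) (- (n%:R * eps)).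
Proof.
move=> e0 Hu.
have stab n m e : - (n%:R * eps) < e -> (n <= m)%N -> u m e = u n e.
  move=> He /subnK <-; elim: (m - n)%N => [|k IH] //.
  rewrite addSn -IH; apply/eqP; rewrite -subr_eq0 -pcoefB; apply/negP => /negP /Hu.
  have : (n%:R : R) * eps <= (k + n)%:R * eps by rewrite ler_pM2r // ler_nat leq_addl.
  by lra.
have [|N HN] := @choice R nat (fun e n => - (n%:R * eps) < e).
  move=> e.
  have [n Hn] := nat_above (- e / eps); exists n.
  by rewrite ltr_pdivrMr // in Hn; lra.
pose f : Kser := fun e => u (N e) e.
have Hf n e : - (n%:R * eps) < e -> f e = u n e.
  by move=> He; rewrite /f -(stab _ (maxn n (N e)) e (HN e)) ?leq_maxr // (stab n) // leq_maxl.
have Pf : is_puiseux f.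
  apply/is_puiseuxP => M; have /is_puiseuxP/(_ M)[s Hs] := pserP (u (N M)).
  by exists s => e fe Me; apply: Hs => //; rewrite -Hf //; exact: lt_le_trans Me.
exists (Puiseux Pf) => n e; apply: contraNT; rewrite -ltNge => He.
by rewrite pcoefB /= (Hf n) // subrr.
Qed.

(** Dividing by the leading monomial gives [y = 1 - g] with [g] of negative valuation, and the
    geometric series in [g] converges to the inverse of [y]. *)
Lemma puiseux_unit x : exists y : puiseux, (x != 0 -> y * x = 1) /\ (x = 0 -> y = 0).
Proof.
have [->|x0] := eqVneq x 0; first by exists 0.
have [l [xl hx]] := isval_exists x0.
pose y := mono (x l)^-1 (- l) * x.
have hy : vle y 0 by rewrite -(addNr l); apply: vleM => //; exact: vle_mono.
have y0 : y 0 = 1.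
  by rewrite -(addNr l) pcoefM_lead //; [rewrite pcoef_mono eqxx mulVf|exact: vle_mono].
have [eps e0] := vle_gap hy; rewrite y0 mono1 => hg.
pose g := 1 - y.
have {}hg : vle g (- eps) by rewrite /g -opprB; apply: vleN.
have hX n : vle (g ^+ n) (- (n%:R * eps)) by rewrite -mulrN; apply: vleX.
pose u n := \sum_(i < n) g ^+ i.
have [v Hv] : exists v : puiseux, forall n, vle (v - u n) (- (n%:R * eps)).
  by apply: puiseux_lim => // n; rewrite /u big_ord_recr addrC addKr.
exists (v * mono (x l)^-1 (- l)); split=> [_|/eqP]; last by rewrite (negPf x0).
rewrite -mulrA -/y.
apply/eqP; rewrite -subr_eq0; apply/eqP/(vle_eq0 e0) => n.
have -> : v * y - 1 = (v - u n) * y - g ^+ n.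
  have -> : g ^+ n = 1 + (g - 1) * u n by rewrite -subrX1; ring.
  by rewrite /g; ring.
by apply: vleB => //; apply: vle_trans (vleM (Hv n) hy) _; rewrite addr0.
Qed.

Definition pinv (x : puiseux) := projT1 (cid (puiseux_unit x)).
Fact pmulVf x : x != 0 -> pinv x * x = 1.
Proof. by rewrite /pinv; case: cid => y /= []. Qed.
Fact pinv0 : pinv 0 = 0.
Proof. by rewrite /pinv; case: cid => y /= [_ ->]. Qed.

HB.instance Definition _ := GRing.ComNzRing_isField.Build puiseux pmulVf pinv0.

Definition ple (x y : puiseux) : bool := `[< knonneg (y - x) >].
Definition plt x y := (y != x) && ple x y.
Definition pnorm x := if ple 0 x then x else - x.

Lemma kposP (x : puiseux) : kpos x <-> exists2 l, isval x l & 0 < x l.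
Proof.
split=> [[l [/eqP xl [hx /RltP h0]]]|[l [/eqP xl hx] /RltP h0]].
  by exists l => //; split=> // m /eqP/hx/RleP.
by exists l; split=> //; split=> // m /eqP/hx/RleP.
Qed.

Lemma kis0P (x : puiseux) : kis0 x <-> x = 0.
Proof. by split=> [H|-> //]; apply: puiseux_ext => e; exact: H. Qed.

Lemma ple0P x : reflect (x = 0 \/ exists2 l, isval x l & 0 < x l) (ple 0 x).
Proof.
rewrite /ple subr0; apply: (iffP (asboolP (knonneg x))) => -[].
- by move/kis0P; left.
- by move/kposP; right.
- by move/kis0P; left.
- by move/kposP; right.
Qed.

Fact ple_add x y : ple 0 x -> ple 0 y -> ple 0 (x + y).
Proof.
move=> /ple0P[->|[l hl xl]]; first by rewrite add0r.
move=> /ple0P[->|[m hm ym]]; first by rewrite addr0; apply/ple0P; right; exists l.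
apply/ple0P; right; wlog lm : x y l m hl hm xl ym / l <= m.
  by move=> H; have [/H|/ltW/H] := lerP l m; [apply|rewrite addrC; apply].
have p : 0 < (x + y) m.
  rewrite pcoefD; have [->|xm] := eqVneq (x m) 0; first by rewrite add0r.
  by have ml := hl.2 _ xm; have E : l = m by [apply/eqP; rewrite eq_le lm]; rewrite -E addr_gt0 // E.
exists m => //; split; first by rewrite gt_eqF.
by apply: vleD; [apply: vle_trans lm; exact: hl.2|exact: hm.2].
Qed.

Fact ple_mul x y : ple 0 x -> ple 0 y -> ple 0 (x * y).
Proof.
move=> /ple0P[->|[l hl xl]]; first by rewrite mul0r => _; apply/ple0P; left.
move=> /ple0P[->|[m hm ym]]; first by rewrite mulr0; apply/ple0P; left.
apply/ple0P; right; exists (l + m); first exact: isvalM.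
by rewrite (pcoefM_lead hl.2 hm.2) mulr_gt0.
Qed.

Fact psub_ge0 x y : ple 0 (y - x) = ple x y.
Proof. by rewrite /ple subr0. Qed.

Fact ple_anti x : ple 0 x -> ple x 0 -> x = 0.
Proof.
rewrite -(psub_ge0 x) sub0r => /ple0P[->|[l hl xl]] // /ple0P[/eqP|[m hm]].
  by rewrite oppr_eq0 => /eqP.
by rewrite pcoefN (isval_uniq hm (isvalN hl)) oppr_gt0 => /(lt_trans xl); rewrite ltxx.
Qed.

Fact ple_total x : ple 0 x || ple x 0.
Proof.
have [->|x0] := eqVneq x 0; first by apply/orP; left; apply/ple0P; left.
have [l hl] := isval_exists x0; rewrite -(psub_ge0 x) sub0r.
have [x1|x1] := ltrP 0 (x l); apply/orP; [left|right]; apply/ple0P; right; exists l => //.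
  exact: isvalN.
by rewrite pcoefN oppr_gt0 lt_neqAle x1 hl.1.
Qed.

Fact pnormN x : pnorm (- x) = pnorm x.
Proof.
rewrite /pnorm -(psub_ge0 0) subr0.
have := ple_total x; have := @ple_anti x; rewrite -(psub_ge0 x) sub0r.
case: (ple 0 x); case: (ple 0 (- x)) => //= H _; last by rewrite opprK.
by rewrite H // oppr0.
Qed.

Fact pge0_norm x : ple 0 x -> pnorm x = x. Proof. by rewrite /pnorm => ->. Qed.
Fact plt_def x y : plt x y = (y != x) && ple x y. Proof. by []. Qed.

HB.instance Definition _ := Num.IntegralDomain_isLeReal.Build puiseux
  ple_add ple_mul ple_anti psub_ge0 ple_total pnormN pge0_norm plt_def.



Lemma gt0_isval (x : puiseux) l : isval x l -> (0 < x) = (0 < x l).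
Proof.
move=> hl; rewrite lt_def (isval_neq0 hl) /=; apply/idP/idP.
  move=> /ple0P[x0|[m hm]]; first by have := isval_neq0 hl; rewrite x0 eqxx.
  by rewrite (isval_uniq hl hm).
by move=> h; apply/ple0P; right; exists l.
Qed.

Lemma kpos_gt0 (x : puiseux) : kpos x <-> 0 < x.
Proof.
rewrite kposP; split=> [[l hl]|x0]; first by rewrite (gt0_isval hl).
by have [l hl] := isval_exists (lt0r_neq0 x0); exists l => //; rewrite -(gt0_isval hl).
Qed.

Lemma kle_le (x y : puiseux) : kle x y <-> x <= y.
Proof. by rewrite -[x <= y]/(ple x y) /ple; split=> /asboolP. Qed.

Lemma kval_Some (x : puiseux) l : kval x = Some l <-> isval x l.
Proof.
rewrite /kval; set P := fun v : Trop => _.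
have S m : P (Some m) <-> isval x m.
  rewrite /P /=; split=> [[/eqP h H]|[/eqP h H]]; split=> // a /eqP /H /RleP //.
have E : exists v, P v.
  have [x0|x0] := eqVneq x 0; first by exists None; apply/kis0P.
  by have [m hm] := isval_exists x0; exists (Some m); apply/S.
have := epsilon_spec (inhabits None) P E; rewrite -/P; case: (epsilon _ _) => [m|].
  by move/S => hm; split=> [[<-] //|hl]; rewrite (isval_uniq hm hl).
by move/kis0P => x0; split=> [//|[]]; rewrite x0 pcoef0 eqxx.
Qed.

Lemma kval_None (x : puiseux) : kval x = None <-> x = 0.
Proof.
split=> [E|->].
  apply/eqP/negP => /negP/isval_exists[l /kval_Some]; by rewrite E.
case E : (kval (0 : puiseux)) => [l|] //.
by move/kval_Some: E => [] ; rewrite pcoef0 eqxx.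
Qed.

(** * Hensel's lemma *)

Definition pcst (c : R) : puiseux := mono c 0.

Fact pcst_zmod : zmod_morphism pcst.
Proof.
move=> c d; apply: puiseux_ext => e; rewrite pcoefB !pcoef_mono.
by case: ifP; rewrite ?subr0.
Qed.
Fact pcst_monoid : monoid_morphism pcst.
Proof. by split=> // c d; rewrite /pcst mono_mul addr0. Qed.
HB.instance Definition _ := GRing.isZmodMorphism.Build R puiseux pcst pcst_zmod.
HB.instance Definition _ := GRing.isMonoidMorphism.Build R puiseux pcst pcst_monoid.

Local Notation ci := (map_poly pcst).

Definition pvle (p : {poly puiseux}) (r : R) := forall i, vle p`_i r.

Lemma pvle_trans p r s : pvle p r -> r <= s -> pvle p s.
Proof. by move=> H rs i; exact: vle_trans rs. Qed.

Lemma pvle0 r : pvle 0 r.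
Proof. by move=> i; rewrite coef0; exact: vle0. Qed.

Lemma pvleD p q r : pvle p r -> pvle q r -> pvle (p + q) r.
Proof. by move=> hp hq i; rewrite coefD; apply: vleD. Qed.

Lemma pvleB p q r : pvle p r -> pvle q r -> pvle (p - q) r.
Proof. by move=> hp hq i; rewrite coefB; apply: vleB. Qed.

Lemma pvleM p q r s : pvle p r -> pvle q s -> pvle (p * q) (r + s).
Proof. by move=> hp hq i; rewrite coefM; apply: vle_sum => j _; apply: vleM. Qed.

Lemma pvleZ (c : puiseux) p r s : vle c r -> pvle p s -> pvle (c *: p) (r + s).
Proof. by move=> hc hp i; rewrite coefZ; apply: vleM. Qed.

Lemma pvle_sum I (r : seq I) (P : pred I) (F : I -> {poly puiseux}) v :
  (forall i, P i -> pvle (F i) v) -> pvle (\sum_(i <- r | P i) F i) v.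
Proof. by move=> H; elim/big_rec: _ => [|i x Pi IH]; [exact: pvle0|apply: pvleD => //; exact: H]. Qed.

Lemma pvle_ci p : pvle (ci p) 0.
Proof. by move=> i; rewrite coef_map; exact: vle_mono. Qed.

Lemma pvle_eq0 p eps : 0 < eps -> (forall n : nat, pvle p (- (n%:R * eps))) -> p = 0.
Proof.
by move=> e0 H; apply/polyP => i; rewrite coef0; apply: (vle_eq0 e0) => n; exact: H.
Qed.

Lemma poly_lim (u : nat -> {poly puiseux}) k eps : 0 < eps ->
  (forall n, (size (u n) <= k)%N) ->
  (forall n, pvle (u n.+1 - u n) (- (n%:R * eps))) ->
  exists2 p : {poly puiseux}, (size p <= k)%N & forall n, pvle (p - u n) (- (n%:R * eps)).
Proof.
move=> e0 Hk Hu.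
have [|l Hl] := @choice nat puiseux
  (fun i x => forall n, vle (x - (u n)`_i) (- (n%:R * eps))).
  by move=> i; apply: puiseux_lim => // n; rewrite -coefB; exact: Hu.
exists (\poly_(i < k) l i); first exact: size_poly.
move=> n i; rewrite coefB coef_poly; case: ltnP => // ki.
by rewrite nth_default ?subr0 ?(leq_trans (Hk n)) //; exact: vle0.
Qed.

(** In a Bezout relation scaled to ['X^i], the cofactor of [p2] is reduced modulo [p1]; the size of
    the other cofactor [b] then follows from that of [b * p1]. *)
Lemma coprime_solve (p1 p2 : {poly R}) k m i : p1 \is monic -> p2 \is monic ->
  size p1 = k.+1 -> size p2 = m.+1 -> coprimep p1 p2 -> (i < k + m)%N ->
  exists a b : {poly R}, [/\ a * p2 + b * p1 = 'X^i, (size a <= k)%N & (size b <= m)%N].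
Proof.
move=> m1 m2 s1 s2 /Bezout_coprimepP[[u v] /=]; rewrite -[1]/(1%:P).
move=> /eqpf_eq[c c0 /= E] im.
pose v' := c^-1%:P * 'X^i * v; pose u' := c^-1%:P * 'X^i * u.
have E' : u' * p1 + v' * p2 = 'X^i.
  transitivity (c^-1%:P * 'X^i * (u * p1 + v * p2)); first by rewrite /u' /v'; ring.
  by rewrite E -mul_polyC mulr1 mulrAC -polyCM mulVf // mul1r.
exists (v' %% p1), (u' + v' %/ p1 * p2).
have p10 : p1 != 0 by exact: monic_neq0.
have Ea : v' %% p1 * p2 + (u' + v' %/ p1 * p2) * p1 = 'X^i.
  rewrite -E' {3}(divp_eq v' p1); ring.
have sa : (size (v' %% p1)%R <= k)%N by rewrite -ltnS -s1 ltn_modp.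
split=> //; set b := (u' + _) in Ea *; have [->|b0] := eqVneq b 0; first by rewrite size_poly0.
have Eb : b * p1 = 'X^i - v' %% p1 * p2 by rewrite -Ea addrC addKr.
have : (size (b * p1)%R <= k + m)%N.
  rewrite Eb; apply: (leq_trans (size_polyD _ _)); rewrite size_polyN geq_max size_polyXn im /=.
  by apply: (leq_trans (size_polyMleq _ _)); rewrite s2 addnS /= leq_add2r.
by rewrite size_Mmonic // s1 addnS /= addnC leq_add2l.
Qed.

Lemma monicB_size (A : nzRingType) (p q : {poly A}) n : p \is monic -> q \is monic ->
  size p = n.+1 -> size q = n.+1 -> (size (p - q)%R <= n)%N.
Proof.
move=> /monicP mp /monicP mq sp sq; apply/leq_sizeP => j.
rewrite leq_eqVlt => /orP[/eqP <-|nj]; rewrite coefB.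
  by move: mp mq; rewrite /lead_coef sp sq /= => -> ->; rewrite subrr.
by rewrite !nth_default ?subr0 ?sp ?sq.
Qed.

Section Hensel.
Variables (F : {poly puiseux}) (p1 p2 : {poly R}) (k m : nat) (eps : R).
Hypotheses (monF : F \is monic) (m1 : p1 \is monic) (m2 : p2 \is monic).
Hypotheses (sF : size F = (k + m).+1) (s1 : size p1 = k.+1) (s2 : size p2 = m.+1).
Hypotheses (cop : coprimep p1 p2) (e0 : 0 < eps).
Hypothesis HF : pvle (F - ci (p1 * p2)) (- eps).

(** The Bezout relations are solved over the reals for each power of ['X] and combined with the
    coefficients of [E]. The solutions thus inherit the valuation bound of [E] without loss. *)
Let coprime_solve_puiseux (E : {poly puiseux}) r : (size E <= k + m)%N -> pvle E r ->
  exists a b : {poly puiseux}, [/\ a * ci p2 + b * ci p1 = E, (size a <= k)%N, (size b <= m)%N,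
    pvle a r & pvle b r].
Proof.
move=> sE hE.
have [|f Hf] := @choice 'I_(k + m) ({poly R} * {poly R})%type
  (fun i ab => [/\ ab.1 * p2 + ab.2 * p1 = 'X^i, (size ab.1 <= k)%N & (size ab.2 <= m)%N]).
  move=> i; have [a [b H]] := coprime_solve m1 m2 s1 s2 cop (ltn_ord i).
  by exists (a, b).
exists (\sum_(i < k + m) E`_i *: ci (f i).1), (\sum_(i < k + m) E`_i *: ci (f i).2).
split.
- rewrite !mulr_suml -big_split /=.
  transitivity (\sum_(i < k + m) E`_i *: 'X^i).
    apply: eq_bigr => i _; have [E1 _ _] := Hf i.
    by rewrite -!scalerAl -scalerDr -!rmorphM -rmorphD /= E1 map_polyXn.
  rewrite -poly_def; apply/polyP => i; rewrite coef_poly; case: ltnP => // h.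
  by rewrite nth_default // (leq_trans sE).
- apply: leq_trans (size_sum _ _ _) _; apply/bigmax_leqP => i _; apply: leq_trans (size_scale_leq _ _) _.
  by rewrite size_map_poly; have [] := Hf i.
- apply: leq_trans (size_sum _ _ _) _; apply/bigmax_leqP => i _; apply: leq_trans (size_scale_leq _ _) _.
  by rewrite size_map_poly; have [] := Hf i.
- apply: pvle_sum => i _; rewrite -[r]addr0; apply: pvleZ => //; exact: pvle_ci.
- apply: pvle_sum => i _; rewrite -[r]addr0; apply: pvleZ => //; exact: pvle_ci.
Qed.

Let Inv (n : nat) (AB : {poly puiseux} * {poly puiseux}) :=
  [/\ (size (AB.1 - ci p1)%R <= k)%N, (size (AB.2 - ci p2)%R <= m)%N,
     pvle (AB.1 - ci p1) (- eps), pvle (AB.2 - ci p2) (- eps) &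
     (size (F - AB.1 * AB.2)%R <= k + m)%N /\ pvle (F - AB.1 * AB.2) (- (n.+1%:R * eps))].

(** The invariant is a premise inside the existential, so that [choice] yields a step function
    defined on all pairs. *)
Let step (n : nat) AB : exists AB', Inv n AB ->
  [/\ Inv n.+1 AB', pvle (AB'.1 - AB.1) (- (n%:R * eps)) & pvle (AB'.2 - AB.2) (- (n%:R * eps))].
Proof.
have [|H] := pselect (Inv n AB); last by exists AB.
case: AB => A B [/= sA sB hA hB [sE hE]].
have [a [b [E sa sb ha hb]]] := coprime_solve_puiseux sE hE.
exists (A + a, B + b) => _ /=.
have n0 : (0 : R) <= n%:R by rewrite ler0n.
have ne0 : 0 <= n%:R * eps by rewrite mulr_ge0 // ltW.
have ne1 : n.+1%:R * eps = n%:R * eps + eps by rewrite -natr1; ring.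
have ne2 : n.+2%:R * eps = n%:R * eps + eps + eps by rewrite -!natr1; ring.
have EA : A + a - ci p1 = (A - ci p1) + a by ring.
have EB : B + b - ci p2 = (B - ci p2) + b by ring.
(* The correction is computed with the fixed residue factors in place of [A] and [B]. The linear
   terms cancel up to the deviation of [A] and [B] from their residues, which gains one factor
   [t^(- eps)] per step. *)
have EF : F - (A + a) * (B + b) = - ((A - ci p1) * b + (B - ci p2) * a + a * b).
  rewrite -(subrK (A * B) F) -E; ring.
split.
- split=> /=.
  + by rewrite EA; apply: leq_trans (size_polyD _ _) _; rewrite geq_max sA.
  + by rewrite EB; apply: leq_trans (size_polyD _ _) _; rewrite geq_max sB.
  + by rewrite EA; apply: pvleD => //; apply: pvle_trans ha _; lra.
  + by rewrite EB; apply: pvleD => //; apply: pvle_trans hb _; lra.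
  + rewrite EF; split; last first.
      rewrite -[- (_ + _)]add0r; apply: pvleB; first exact: pvle0.
      apply: pvleD; first apply: pvleD.
      * by apply: pvle_trans (pvleM hA hb) _; lra.
      * by apply: pvle_trans (pvleM hB ha) _; lra.
      * by apply: pvle_trans (pvleM ha hb) _; lra.
    rewrite size_polyN.
    have sM (p q : {poly puiseux}) : (size p <= k -> size q <= m -> size (p * q)%R <= k + m)%N.
      move=> hp hq; apply: (leq_trans (size_polyMleq _ _)).
      by apply: (leq_trans (leq_pred _)); exact: leq_add.
    apply: leq_trans (size_polyD _ _) _; rewrite geq_max sM // andbT.
    apply: leq_trans (size_polyD _ _) _; rewrite geq_max sM //=.
    by rewrite mulrC sM.
- by rewrite addrC addKr; apply: pvle_trans ha _; rewrite ne1 lerN2 lerDl ltW.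
- by rewrite addrC addKr; apply: pvle_trans hb _; rewrite ne1 lerN2 lerDl ltW.
Qed.

Lemma hensel : exists A B : {poly puiseux}, [/\ F = A * B, size A = k.+1 & size B = m.+1].
Proof.
have [f Hf] := choice (fun nAB : nat * ({poly puiseux} * {poly puiseux}) => step nAB.1 nAB.2).
pose s := fix s n := if n is n'.+1 then f (n', s n') else (ci p1, ci p2).
have Hs n : Inv n (s n).
  elim: n => [|n IH]; last by have [] := Hf (n, s n) IH.
  rewrite /Inv /= !subrr size_poly0 -rmorphM; split=> //; try exact: pvle0.
  split=> //; last by rewrite mul1r.
  apply: monicB_size => //; first by rewrite monic_map // monicMr.
  by rewrite size_map_poly size_Mmonic ?monic_neq0 // s1 s2 addnS.
have Hs1 n : pvle ((s n.+1).1 - (s n).1) (- (n%:R * eps)) by have [] := Hf (n, s n) (Hs n).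
have Hs2 n : pvle ((s n.+1).2 - (s n).2) (- (n%:R * eps)) by have [] := Hf (n, s n) (Hs n).
(* The limit is taken after subtraction of the residue factor: the difference has size at most [k],
   and adding the residue factor back fixes the degree. *)
have [|n|a sa ha] := @poly_lim (fun n => (s n).1 - ci p1) k eps e0.
- by move=> n; have [] := Hs n.
- by rewrite (_ : _ - _ = (s n.+1).1 - (s n).1) //; ring.
have [|n|b sb hb] := @poly_lim (fun n => (s n).2 - ci p2) m eps e0.
- by move=> n; have [] := Hs n.
- by rewrite (_ : _ - _ = (s n.+1).2 - (s n).2) //; ring.
have hb0' : pvle b 0 by move: (hb 0%N); rewrite mulr0n mul0r oppr0 /= subrr subr0.
exists (ci p1 + a), (ci p2 + b); split.
- apply/eqP; rewrite -subr_eq0; apply/eqP/(pvle_eq0 e0) => n.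
  have [_ _ hA _ [_ hE]] := Hs n.
  set A := (s n).1 in hA hE ha *; set B := (s n).2 in hE hb *.
  have n0 : (0 : R) <= n%:R by rewrite ler0n.
  have ne0 : 0 <= n%:R * eps by rewrite mulr_ge0 // ltW.
  have ne1 : n.+1%:R * eps = n%:R * eps + eps by rewrite -natr1; ring.
  have {}ha : pvle (ci p1 + a - A) (- (n%:R * eps)).
    by move: (ha n); rewrite (_ : _ - _ = ci p1 + a - A) //; rewrite -/A; ring.
  have {}hb : pvle (ci p2 + b - B) (- (n%:R * eps)).
    by move: (hb n); rewrite (_ : _ - _ = ci p2 + b - B) //; rewrite -/B; ring.
  have -> : F - (ci p1 + a) * (ci p2 + b) = (F - A * B) - (ci p1 + a - A) * (ci p2 + b)
      - A * (ci p2 + b - B) by ring.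
  have hA0 : pvle A 0.
    rewrite -(subrK (ci p1) A); apply: pvleD; last exact: pvle_ci.
    by apply: pvle_trans hA _; rewrite oppr_le0 ltW.
  have hb0 : pvle (ci p2 + b) 0.
    apply: pvleD; first exact: pvle_ci.
    exact: hb0'.
  apply: pvleB; first apply: pvleB.
  + by apply: pvle_trans hE _; rewrite ne1 lerN2 lerDl ltW.
  + by apply: pvle_trans (pvleM ha hb0) _; lra.
  + by apply: pvle_trans (pvleM hA0 hb) _; lra.
- by rewrite size_polyDl size_map_poly s1.
- by rewrite size_polyDl size_map_poly s2.
Qed.
End Hensel.

(** * Polynomials with the intermediate value property *)

Arguments vleX {x r} n _ _.

Section PolySign.
Variable A : realFieldType.
Implicit Types p q : {poly A}.

(** With strict signs the property passes to products, since a sign change of [p * q] is one of [p]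
    or of [q]. This is what allows induction along factorizations. *)
Definition has_ivp p := forall a b, a < b -> p.[a] * p.[b] < 0 -> exists2 x, a < x < b & root p x.

Lemma ivp_mul p q : has_ivp p -> has_ivp q -> has_ivp (p * q).
Proof.
move=> Hp Hq a b ab; rewrite !hornerM mulrACA.
have [/(Hp _ _ ab)[x xab rx] _|pge] := ltrP (p.[a] * p.[b]) 0.
  by exists x => //; rewrite rootM rx.
have [/(Hq _ _ ab)[x xab rx] _|qge] := ltrP (q.[a] * q.[b]) 0.
  by exists x => //; rewrite rootM rx orbT.
by rewrite ltNge mulr_ge0.
Qed.

Lemma ivp_exp p n : has_ivp p -> has_ivp (p ^+ n).
Proof.
move=> Hp; elim: n => [|n IH]; last by rewrite exprS; apply: ivp_mul.
by move=> a b _; rewrite expr0 !hornerE ?mulr1 ltr10.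
Qed.

Lemma ivp_scale c p : c != 0 -> has_ivp p -> has_ivp (c *: p).
Proof.
move=> c0 Hp a b ab; rewrite !hornerZ mulrACA pmulr_rlt0; last first.
  by rewrite lt_def mulf_neq0 //= -expr2 sqr_ge0.
by move=> /(Hp _ _ ab)[x xab rx]; exists x => //; rewrite rootZ.
Qed.

Lemma ivp_XsubC c : has_ivp ('X - c%:P).
Proof.
move=> a b ab; rewrite !hornerXsubC => h; exists c; last by rewrite root_XsubC.
by have [?|?] := lerP c a; have [?|?] := lerP b c => //; exfalso; move: h; rewrite ltNge => /negP; apply; nra.
Qed.

Lemma ivp_comp_affine p r s : 0 < r -> has_ivp p -> has_ivp (p \Po (r *: 'X + s%:P)).
Proof.
move=> r0 Hp a b ab; rewrite !horner_comp !hornerE.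
have ab' : r * a + s < r * b + s by rewrite ltrD2r ltr_pM2l.
move=> /(Hp _ _ ab')[x /andP[xa xb] rx]; exists ((x - s) / r).
  by rewrite ltr_pdivlMr // ltr_pdivrMr // -ltrBDr -ltrBDr; apply/andP; split; lra.
by rewrite /root horner_comp hornerD hornerZ hornerX hornerC mulrC divfK ?lt0r_neq0 // subrK.
Qed.

Lemma ivp_gt0 p : (forall x, 0 < p.[x]) -> has_ivp p.
Proof. by move=> H a b _; rewrite ltNge mulr_ge0 // ltW. Qed.

End PolySign.

Lemma rcf_noroot (p : {poly R}) : p \is monic -> (forall x, ~~ root p x) -> forall x, 0 < p.[x].
Proof.
move=> mp H x; have [//|x0] := ltrP 0 p.[x].
have [n Hn] := @poly_pinfty_gt_lc _ p (eq_ind_r (fun c => 0 < c) ltr01 (eqP mp)).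
have h1 := Hn (Num.max n x); rewrite le_max lexx (eqP mp) /= in h1.
have h2 : p.[x] <= 0 <= p.[Num.max n x] by rewrite x0 (le_trans ler01) // h1.
have [|y _] := poly_ivt _ h2; first by rewrite le_max lexx orbT.
by move=> ry; have := H y; rewrite ry.
Qed.

Lemma rcf_noroot_even (p : {poly R}) : p \is monic -> (forall x, ~~ root p x) -> ~~ odd (size p).-1.
Proof.
move=> mp H; apply/negP => od.
have Hp := rcf_noroot mp H.
pose q := - (p \Po (- 'X)).
have sq : size q = size p by rewrite size_polyN size_comp_poly2 // size_polyN size_polyX.
have lq : lead_coef q = 1.
  rewrite lead_coefN lead_coef_comp ?size_polyN ?size_polyX // lead_coefN lead_coefX (eqP mp) mul1r.
  by rewrite -signr_odd od expr1 opprK.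
have [n Hn] := @poly_pinfty_gt_lc _ q (eq_ind_r (fun c => 0 < c) ltr01 lq).
have := Hn n (lexx _); rewrite lq hornerN horner_comp hornerN hornerX => h.
have := Hp (- n); rewrite ltNge => /negP; apply; lra.
Qed.

(** The residue polynomial, a meaningful reduction when [pvle p 0]. *)
Definition pres (p : {poly puiseux}) : {poly R} := map_poly (fun x : puiseux => x 0) p.

Lemma coef_pres p i : (pres p)`_i = p`_i 0.
Proof. by rewrite coef_map_id0. Qed.

Lemma pvle_gap p : pvle p 0 -> exists2 eps, 0 < eps & pvle (p - map_poly pcst (pres p)) (- eps).
Proof.
move=> hp.
suff [eps e0 H] : exists2 eps, 0 < eps & forall i, (i < size p)%N ->
    vle (p - map_poly pcst (pres p))`_i (- eps).
  exists eps => // i; have [/H //|si] := ltnP i (size p).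
  rewrite coefB coef_map coef_pres nth_default // sub0r; apply: vleN; have E : pcst ((0 : puiseux) 0) = 0 by exact: (rmorph0 pcst).
  by have h := vle0 (- eps); rewrite -E in h; exact: h.
elim: (size p) => [|n [eps e0 IH]]; first by exists 1.
have [eps' e'0 H'] := vle_gap (hp n).
exists (Num.min eps eps'); first by rewrite lt_min e0.
move=> i; rewrite ltnS leq_eqVlt => /orP[/eqP ->|/IH h].
  rewrite coefB coef_map coef_pres; apply: vle_trans H' _.
  by rewrite lerN2 ge_min lexx orbT.
by apply: vle_trans h _; rewrite lerN2 ge_min lexx.
Qed.

(** If [x] has valuation at most 0, the constant coefficient of [p.[x]] is the value of the residue
    polynomial at that of [x]. If [x] has positive valuation, the monic term [x ^+ n] dominates, and
    [n] is even. *)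
Lemma horner_gt0_res (p : {poly puiseux}) n : p \is monic -> size p = n.+1 -> ~~ odd n ->
  pvle p 0 -> (forall x, 0 < (pres p).[x]) -> forall x, 0 < p.[x].
Proof.
move=> mp sp ev hp Hp x.
have sr : (size (pres p) <= n.+1)%N by apply: leq_trans (size_poly _ _) _; rewrite sp.
have low : vle x 0 -> 0 < p.[x].
  move=> hx.
  have hi (i : 'I_n.+1) : vle (p`_i * x ^+ i) 0.
    by apply: vle_trans (vleM (hp i) (vleX i hx)) _; rewrite mulr0 addr0.
  have hX i : (x ^+ i) 0 = x 0 ^+ i.
    elim: i => [|i IH]; first by rewrite expr0 -mono1 pcoef_mono eqxx.
    have := pcoefM_lead hx (vleX i hx); rewrite mulr0 addr0 exprS => ->.
    by rewrite IH exprS.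
  have E : p.[x] 0 = (pres p).[x 0].
    rewrite (horner_coef_wide _ sr) horner_coef sp pcoef_sum; apply: eq_bigr => i _.
    have := pcoefM_lead (hp i) (vleX i hx); rewrite mulr0 addr0 => ->.
    by rewrite hX coef_pres.
  have V : isval p.[x] 0.
    split; first by rewrite E gt_eqF.
    by rewrite horner_coef sp; apply: vle_sum => i _.
  by rewrite (gt0_isval V) E.
have [x0|x0] := eqVneq x 0; first by apply: low; rewrite x0; exact: vle0.
have [l hl] := isval_exists x0; have [l0|l0] := lerP l 0; first by apply: low; apply: vle_trans hl.2 _.
have pn : p`_n = 1 by move/monicP: mp; rewrite /lead_coef sp.
have [xl hx] := hl.
have V : isval (x ^+ n) (n%:R * l).
  elim: n {sp ev sr low pn} => [|n IH]; first by rewrite expr0 mul0r; exact: isval_mono (oner_neq0 _).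
  by rewrite exprS -natr1 mulrDl mul1r addrC; exact: isvalM.
have hs : vle (\sum_(i < n) p`_i * x ^+ i) (n%:R * l - l).
  apply: vle_sum => i _; apply: vle_trans (vleM (hp i) (vleX i hx)) _.
  have h : (i%:R + 1) * l <= n%:R * l by rewrite ler_pM2r // natr1 ler_nat; exact: ltn_ord.
  by lra.
have Ep : p.[x] = \sum_(i < n) p`_i * x ^+ i + x ^+ n.
  by rewrite horner_coef sp big_ord_recr /= pn mul1r.
have E : p.[x] (n%:R * l) = (x ^+ n) (n%:R * l).
  rewrite Ep pcoefD -[RHS]add0r; congr (_ + _).
  by apply/eqP/negP => /negP/hs; lra.
have V' : isval p.[x] (n%:R * l).
  split; first by rewrite E V.1.
  rewrite Ep; apply: vleD; last exact: V.2.
  by apply: vle_trans hs _; lra.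
rewrite (gt0_isval V') E -(gt0_isval V).
by rewrite exprn_even_gt0 // x0 orbT.
Qed.

Lemma coef_exp_XsubC_lead (A : nzRingType) (c : A) n : (('X - c%:P) ^+ n)`_n = 1.
Proof.
have : lead_coef (('X - c%:P) ^+ n) = 1 by apply/eqP; rewrite -monicE monic_exp // monicXsubC.
by rewrite /lead_coef size_exp_XsubC.
Qed.

Lemma coef_exp_XsubC_sub (A : nzRingType) (c : A) n : (('X - c%:P) ^+ n.+1)`_n = - (c *+ n.+1).
Proof.
elim: n => [|n IH]; first by rewrite expr1 coefB coefX coefC sub0r.
rewrite exprS mulrBl coefB coefXM coefCM /= IH coef_exp_XsubC_lead mulr1.
by rewrite [in RHS]mulrS opprD addrC.
Qed.

Lemma coef_comp_XsubC (A : nzRingType) (p : {poly A}) c n : size p = n.+2 ->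
  (p \Po ('X - c%:P))`_n = p`_n - p`_n.+1 * (c *+ n.+1).
Proof.
move=> sp; rewrite comp_polyE sp !big_ord_recr /= !coefD !coefZ.
rewrite coef_exp_XsubC_lead coef_exp_XsubC_sub mulr1 mulrN coef_sum big1 ?add0r // => i _.
by rewrite coefZ [(polyseq (_ ^+ _))`_n]nth_default ?mulr0 // size_exp_XsubC.
Qed.

Lemma coef_comp_scaleX (A : comNzRingType) (p : {poly A}) c i : (p \Po (c *: 'X))`_i = p`_i * c ^+ i.
Proof.
rewrite comp_polyE coef_sum.
have E (j : 'I_(size p)) : (p`_j *: (c *: 'X) ^+ j)`_i = if i == j then p`_j * c ^+ j else 0.
  by rewrite exprZn !coefZ coefXn; case: eqP => _; rewrite ?mulr1 ?mulr0.
under eq_bigr do rewrite E.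
have [si|si] := ltnP i (size p); last first.
  rewrite [p`_i]nth_default // mul0r big1 // => j _; case: eqP => // ij.
  by have := ltn_ord j; rewrite -ij ltnNge si.
rewrite (bigD1 (Ordinal si)) //= eqxx big1 ?addr0 // => j.
by rewrite eq_sym -val_eqE /= => /negPf ->.
Qed.

Lemma mono1X e n : mono 1 e ^+ n = mono 1 (n%:R * e).
Proof.
elim: n => [|n IH]; first by rewrite mul0r.
by rewrite exprS IH mono_mul mulr1 -natr1 mulrDl mul1r addrC.
Qed.

Lemma mono1_gt0 e : 0 < mono 1 e.
Proof. by rewrite (gt0_isval (isval_mono e (oner_neq0 _))) pcoef_mono eqxx ltr01. Qed.

(* Hensel's lemma splits off a root of the residue polynomial; being depressed and not [X^n],
   the residue polynomial is not a power of a linear factor. *)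
Lemma ivp_normalized n (H : {poly puiseux}) : (forall p : {poly puiseux}, (size p <= n.+2)%N -> has_ivp p) ->
  H \is monic -> size H = n.+3 -> pvle H 0 -> H`_n.+1 = 0 ->
  (exists2 i, (i < n.+2)%N & H`_i 0 != 0) -> has_ivp H.
Proof.
move=> IH mH sH vH H1 [i0 hi0 Hi0].
have lH : H`_n.+2 = 1 by move/monicP: mH; rewrite /lead_coef sH.
have lh : (pres H)`_n.+2 = 1 by rewrite coef_pres lH -mono1 pcoef_mono eqxx.
have sh : size (pres H) = n.+3.
  apply/eqP; rewrite eqn_leq -{1}sH size_poly /= ltnNge; apply/negP => /leq_sizeP/(_ n.+2 (leqnn _)) /eqP.
  by rewrite lh oner_eq0.
have mh : pres H \is monic by rewrite monicE /lead_coef sh lh.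
have [[r rr]|nr] := pselect (exists r, root (pres H) r); last first.
  apply: ivp_gt0; apply: (horner_gt0_res mH sH) => //.
    by have := rcf_noroot_even mh; rewrite sh; apply=> x; apply/negP => rx; apply: nr; exists x.
  by apply: rcf_noroot => // x; apply/negP => rx; apply: nr; exists x.
have [m [q qr Eq]] := multiplicity_XsubC (pres H) r.
rewrite monic_neq0 //= in qr.
have m0 : (0 < m)%N.
  by case: m Eq => // Eq; move: rr qr; rewrite Eq expr0 mulr1 => ->.
have mX : ('X - r%:P) ^+ m \is monic by rewrite monic_exp // monicXsubC.
have mq : q \is monic by rewrite -(monicMr q mX) -Eq.
have [k sq] : exists k, size q = k.+1.
  by exists (size q).-1; rewrite prednK // lt0n size_poly_eq0 monic_neq0.
have sX : size (('X - r%:P) ^+ m) = m.+1 by rewrite size_exp_XsubC.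
have mk : (m + k = n.+2)%N.
  by apply/succn_inj; rewrite -sh Eq size_Mmonic ?monic_neq0 // sq sX addnS addnC.
have k0 : (0 < k)%N.
  rewrite lt0n; apply/eqP => k0; rewrite k0 in sq.
  have Eh : pres H = ('X - r%:P) ^+ n.+2.
    rewrite Eq (size1_polyC (eq_leq sq)) in mq *.
    move: mq; rewrite monicE lead_coefC => /eqP ->.
    by rewrite mul1r -mk k0 addn0.
  have : (pres H)`_n.+1 = 0 by rewrite coef_pres H1.
  rewrite Eh coef_exp_XsubC_sub => /eqP; rewrite oppr_eq0 mulrn_eq0 /= => /eqP r0.
  move: Hi0; rewrite -coef_pres Eh r0 subr0 coefXn.
  by rewrite (ltn_eqF hi0) eqxx.
have [eps e0 He] := pvle_gap vH.
have [A [B [EAB sA sB]]] : exists A B : {poly puiseux}, [/\ H = A * B, size A = m.+1 & size B = k.+1].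
  apply: (@hensel H (('X - r%:P) ^+ m) q m k eps) => //.
  - by rewrite sH -mk.
  - by apply: coprimep_expl; rewrite coprimep_sym coprimep_XsubC.
  - by rewrite mulrC -Eq.
rewrite EAB; apply: ivp_mul; apply: IH; rewrite ?sA ?sB -mk.
  by rewrite -addn1 leq_add2l.
by rewrite -add1n leq_add2r.
Qed.

(** The substitution of [t^rho * 'X] for ['X], with [rho] the largest slope [v j / (n + 2 - j)] of
    the Newton polygon, brings all coefficients to valuation at most 0 and some lower coefficient to
    valuation exactly 0. Without a nonzero lower coefficient, [q] is a power of ['X]. *)
Lemma ivp_depressed n (q : {poly puiseux}) : (forall p : {poly puiseux}, (size p <= n.+2)%N -> has_ivp p) ->
  q \is monic -> size q = n.+3 -> q`_n.+1 = 0 -> has_ivp q.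
Proof.
move=> IH mq sq q1.
have lq : q`_n.+2 = 1 by move/monicP: mq; rewrite /lead_coef sq.
have [/existsP[j0 hj0]|] := boolP [exists j : 'I_n.+2, q`_j != 0]; last first.
  rewrite negb_exists => /forallP H.
  have -> : q = ('X - 0%:P) ^+ n.+2; last by apply: ivp_exp; exact: ivp_XsubC.
  apply/polyP => i; rewrite subr0 coefXn; case: ltngtP => hi.
  - by have := H (Ordinal hi); rewrite negbK => /eqP.
  - by rewrite nth_default // sq.
  - by rewrite hi.
have [|v Hv] := @choice 'I_n.+2 R (fun j l => q`_j != 0 -> isval q`_j l).
  move=> j; have [->|h] := eqVneq q`_j 0; first by exists 0.
  by have [l hl] := isval_exists h; exists l.
pose s (j : 'I_n.+2) := v j / (n.+2%:R - j%:R).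
have [i hi Hi] := @arg_maxP _ _ _ j0 (fun j : 'I_n.+2 => q`_j != 0) s hj0.
pose rho := s i.
pose c := mono 1 rho.
pose H := \poly_(j < n.+3) (q`_j * mono 1 ((j%:R - n.+2%:R) * rho)).
have cH j : H`_j = q`_j * mono 1 ((j%:R - n.+2%:R) * rho).
  by rewrite coef_poly; case: ltnP => // h; rewrite nth_default ?mul0r // sq.
have Eq : q = mono 1 (n.+2%:R * rho) *: (H \Po (mono 1 (- rho) *: 'X + 0%:P)).
  apply/polyP => j; rewrite addr0 coefZ coef_comp_scaleX cH mono1X mulrCA -mulrA !mono_mul !mulr1.
  have -> : (j%:R - n.+2%:R) * rho + (n.+2%:R * rho + j%:R * - rho) = 0 by ring.
  by rewrite mono1 mulr1.
have dpos (j : 'I_n.+2) : 0 < n.+2%:R - j%:R :> R by rewrite subr_gt0 ltr_nat.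
rewrite Eq; apply: ivp_scale; first by rewrite gt_eqF // mono1_gt0.
apply: ivp_comp_affine; first exact: mono1_gt0.
have lH : H`_n.+2 = 1 by rewrite cH lq subrr mul0r mono1 mulr1.
have sH : size H = n.+3.
  apply/eqP; rewrite eqn_leq size_poly /= ltnNge; apply/negP => /leq_sizeP/(_ n.+2 (leqnn _)) /eqP.
  by rewrite lH oner_eq0.
apply: (ivp_normalized IH) => //.
- by rewrite monicE /lead_coef sH lH.
- move=> j; have [hj|hj] := ltnP j n.+2; last first.
    move: hj; rewrite leq_eqVlt => /orP[/eqP <-|hj]; first by rewrite lH; exact: vle1.
    by rewrite nth_default ?sH //; exact: vle0.
  rewrite cH; have [->|qj] := eqVneq q`_j 0; first by rewrite mul0r; exact: vle0.
  have hv := Hv (Ordinal hj) qj; have h := Hi (Ordinal hj) qj.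
  apply: vle_trans (vleM hv.2 (@vle_mono _ _)) _.
  have := dpos (Ordinal hj); rewrite /rho; move: h; rewrite /= /s /= => h d0.
  have -> : (j%:R - n.+2%:R) * (v i / (n.+2%:R - i%:R)) =
     - ((v i / (n.+2%:R - i%:R)) * (n.+2%:R - j%:R)) by ring.
  by rewrite subr_le0 -ler_pdivrMr.
- by rewrite cH q1 mul0r.
exists i => //; rewrite cH.
have hv := Hv i hi.
have E : v i + (i%:R - n.+2%:R) * rho = 0.
  by rewrite /rho /s -[i%:R - _]opprB mulNr mulrC divfK ?subrr // gt_eqF //; exact: dpos.
have := pcoefM_lead hv.2 (@vle_mono 1 ((i%:R - n.+2%:R) * rho)); rewrite E => ->.
by rewrite pcoef_mono eqxx mulr1; exact: hv.1.
Qed.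

Lemma puiseux_ivp n (p : {poly puiseux}) : (size p <= n)%N -> has_ivp p.
Proof.
elim: n p => [|n IH] p.
  by rewrite leqn0 size_poly_eq0 => /eqP -> a b _; rewrite !horner0 mul0r ltxx.
rewrite leq_eqVlt => /orP[/eqP sp|]; last exact: IH.
have p0 : p != 0 by rewrite -size_poly_eq0 sp.
have lp : lead_coef p != 0 by rewrite lead_coef_eq0.
suff H (q : {poly puiseux}) : q \is monic -> size q = n.+1 -> has_ivp q.
  have -> : p = lead_coef p *: ((lead_coef p)^-1 *: p) by rewrite scalerA mulfV // scale1r.
  apply: ivp_scale => //; apply: H; last by rewrite size_scale ?invr_eq0.
  by rewrite monicE lead_coefZ mulVf.
case: n IH {p sp p0 lp} => [|[|n]] IH mq sq.
- have -> : q = 1 by move: mq; rewrite (size1_polyC (eq_leq sq)) monicE lead_coefC => /eqP ->.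
  by move=> a b _; rewrite !hornerE ?mulr1 ltr10.
- have -> : q = 'X - (- q`_0)%:P; last exact: ivp_XsubC.
  move/monicP: mq; rewrite /lead_coef sq /= => q1.
  apply/polyP => -[|[|i]]; rewrite polyCN opprK coefD coefX coefC /= ?add0r ?addr0 //.
  by rewrite nth_default // sq.
(* Tschirnhaus translation: substituting ['X - c] kills the subleading coefficient. *)
pose c := q`_n.+1 / n.+2%:R.
have Eq : q = (q \Po ('X - c%:P)) \Po (1 *: 'X + c%:P).
  by rewrite -comp_polyA scale1r comp_polyB comp_polyX comp_polyC addrK comp_polyXr.
rewrite Eq; apply: ivp_comp_affine => //.
have sc : size (q \Po ('X - c%:P)) = n.+3 by rewrite size_comp_poly2 // size_XsubC.
apply: (ivp_depressed IH) => //.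
  by rewrite monicE lead_coef_comp ?size_XsubC // lead_coefXsubC expr1n mulr1.
rewrite (coef_comp_XsubC _ sq); move/monicP: mq; rewrite /lead_coef sq /= => ->.
by rewrite mul1r -[c *+ _]mulr_natr divfK ?subrr // pnatr_eq0.
Qed.

Fact puiseux_rcf : Num.real_closed_axiom puiseux.
Proof.
move=> p a b ab /andP[pa pb].
have [/eqP|a0] := boolP (p.[a] == 0); first by move=> h; exists a; rewrite ?lexx //; apply/eqP.
have [/eqP|b0] := boolP (p.[b] == 0); first by move=> h; exists b; rewrite ?ab ?lexx //; apply/eqP.
have {}ab : a < b.
  rewrite lt_neqAle ab andbT; apply/eqP => E; move: pa; rewrite E => pa.
  by move/eqP: b0; apply; apply/eqP; rewrite eq_le pa.
have [] := puiseux_ivp (leqnn (size p)) ab.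
  by rewrite nmulr_rlt0 lt_neqAle ?a0 // eq_sym b0.
by move=> x /andP[h1 h2] rx; exists x => //; rewrite !ltW.
Qed.

HB.instance Definition _ := Num.RealField_isClosed.Build puiseux puiseux_rcf.

(** * Quantifier elimination *)

Import (canonicals) ord.

Section Semialgebraic.
Variable F : rcfType.

(** Each pair lists the equations first and the strict inequalities second, the reverse of
    [basic_sa]. *)
Definition in_dnf N (L : seq (seq {mpoly F[N]} * seq {mpoly F[N]})) (x : 'I_N -> F) :=
  exists2 bc, bc \in L & (forall p, p \in bc.1 -> p.@[x] = 0) /\ (forall p, p \in bc.2 -> 0 < p.@[x]).

Definition saset N (S : ('I_N -> F) -> Prop) := exists L, forall x, S x <-> in_dnf L x.

Lemma saset_ext N (S T : ('I_N -> F) -> Prop) : (forall x, S x <-> T x) -> saset S -> saset T.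
Proof. by move=> H [L HL]; exists L => x; rewrite -H. Qed.

Lemma saset_eq0 N (p : {mpoly F[N]}) : saset (fun x => p.@[x] = 0).
Proof.
exists [:: ([:: p], [::])] => x; split=> [h|[bc]].
  by exists ([:: p], [::]); rewrite ?mem_head //; split=> // q; rewrite inE => /eqP ->.
by rewrite inE => /eqP -> [/(_ p)]; rewrite mem_head => /(_ isT).
Qed.

Lemma saset_gt0 N (p : {mpoly F[N]}) : saset (fun x => 0 < p.@[x]).
Proof.
exists [:: ([::], [:: p])] => x; split=> [h|[bc]].
  by exists ([::], [:: p]); rewrite ?mem_head //; split=> // q; rewrite inE => /eqP ->.
by rewrite inE => /eqP -> [_ /(_ p)]; rewrite mem_head => /(_ isT).
Qed.

Lemma saset_or N (S T : ('I_N -> F) -> Prop) : saset S -> saset T -> saset (fun x => S x \/ T x).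
Proof.
move=> [L HL] [M HM]; exists (L ++ M) => x; rewrite HL HM; split.
  by case=> -[bc bcL H]; exists bc => //; rewrite mem_cat bcL ?orbT.
by case=> bc; rewrite mem_cat => /orP[] bcL H; [left|right]; exists bc.
Qed.

Lemma saset_and N (S T : ('I_N -> F) -> Prop) : saset S -> saset T -> saset (fun x => S x /\ T x).
Proof.
move=> [L HL] [M HM].
exists [seq (a.1 ++ b.1, a.2 ++ b.2) | a <- L, b <- M] => x; rewrite HL HM; split.
  move=> [[a aL [a1 a2]] [b bM [b1 b2]]]; exists (a.1 ++ b.1, a.2 ++ b.2).
    by apply/allpairsP; exists (a, b).
  by split=> p /=; rewrite mem_cat => /orP[]; auto.
move=> [_ /allpairsP[[a b] /= [aL bM ->]] [h1 h2]].
by split; [exists a|exists b] => //; split=> p pi; [apply: h1|apply: h2|apply: h1|apply: h2];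
  rewrite /= mem_cat pi ?orbT.
Qed.

Lemma saset_True N : saset (fun _ : 'I_N -> F => True).
Proof. by exists [:: ([::], [::])] => x; split=> // _; exists ([::], [::]); rewrite ?mem_head. Qed.

Lemma saset_False N : saset (fun _ : 'I_N -> F => False).
Proof. by exists [::] => x; split=> // -[]. Qed.

Lemma saset_all N (I : eqType) (s : seq I) (S : I -> ('I_N -> F) -> Prop) :
  (forall i, i \in s -> saset (S i)) -> saset (fun x => forall i, i \in s -> S i x).
Proof.
elim: s => [|i s IH] H; first by apply: saset_ext (@saset_True N).
apply: saset_ext (saset_and (H i (mem_head _ _)) (IH _)) => [x|j js]; last first.
  by apply: H; rewrite inE js orbT.
split=> [[h1 h2] j|h]; first by rewrite inE => /orP[/eqP ->|/h2].
by split=> [|j js]; apply: h; rewrite inE ?eqxx ?js ?orbT.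
Qed.

Lemma saset_forall N (I : finType) (S : I -> ('I_N -> F) -> Prop) :
  (forall i, saset (S i)) -> saset (fun x => forall i, S i x).
Proof.
move=> H; apply: saset_ext (@saset_all _ _ (enum I) S _) => // x.
by split=> h i // ; apply: h; rewrite mem_enum.
Qed.

Lemma saset_ge0 N (p : {mpoly F[N]}) : saset (fun x => 0 <= p.@[x]).
Proof.
apply: saset_ext (saset_or (saset_eq0 p) (saset_gt0 p)) => x.
rewrite le_eqVlt eq_sym; split=> [[->|->]|/orP[/eqP|]]; rewrite ?eqxx ?orbT; by [|left|right].
Qed.

Local Notation Var := (GRing.Var F).
Local Notation Nat := (GRing.NatConst F).

Definition mterm N (p : {mpoly F[N]}) : GRing.term F :=
  foldr (fun (m : 'X_{1.. N}) t => GRing.Add (GRing.Mul (GRing.Const p@_m)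
      (foldr (fun (i : 'I_N) t => GRing.Mul (GRing.Exp (Var i) (m i)) t) (Nat 1) (enum 'I_N))) t)
    (Nat 0) (msupp p).

Lemma eval_mterm N (p : {mpoly F[N]}) (e : seq F) :
  GRing.eval e (mterm p) = p.@[fun i : 'I_N => e`_i].
Proof.
rewrite mevalE /mterm; elim: (msupp p) => [|m s IH] /=; first by rewrite big_nil.
rewrite big_cons IH; congr (_ * _ + _); rewrite -[index_enum _]enumT.
by elim: (enum 'I_N) => [|i t IHt] /=; rewrite ?big_nil ?big_cons // IHt.
Qed.

(** Faithful on inverse-free terms only. A variable beyond [N] becomes 0, which is the default value
    read outside the environment. *)
Fixpoint tpoly N (t : GRing.term F) : {mpoly F[N]} :=
  match t with
  | GRing.Var i => if insub i is Some j then 'X_j else 0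
  | GRing.Const c => c%:MP
  | GRing.NatConst n => n%:R
  | GRing.Add a b => tpoly N a + tpoly N b
  | GRing.Opp a => - tpoly N a
  | GRing.NatMul a n => tpoly N a *+ n
  | GRing.Mul a b => tpoly N a * tpoly N b
  | GRing.Exp a n => tpoly N a ^+ n
  | GRing.Inv _ => 0
  end.

Definition env N (x : 'I_N -> F) : seq F := [seq x i | i <- enum 'I_N].

Lemma env_nth N (x : 'I_N -> F) (i : 'I_N) : (env x)`_i = x i.
Proof. by rewrite (nth_map i) ?size_enum_ord // nth_ord_enum. Qed.

Lemma size_env N (x : 'I_N -> F) : size (env x) = N.
Proof. by rewrite size_map size_enum_ord. Qed.

Lemma eval_tpoly N (x : 'I_N -> F) t : GRing.rterm t -> (tpoly N t).@[x] = GRing.eval (env x) t.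
Proof.
elim: t => //=.
- move=> i _; case: insubP => [j _ <-|]; first by rewrite mevalXU env_nth.
  by rewrite meval0 -leqNgt => h; rewrite nth_default // size_env.
- by move=> c _; rewrite mevalC.
- by move=> n _; rewrite mevalMn meval1.
- by move=> a IHa b IHb /andP[/IHa <- /IHb <-]; rewrite mevalD.
- by move=> a IHa /IHa <-; rewrite mevalN.
- by move=> a IHa n /IHa <-; rewrite mevalMn.
- by move=> a IHa b IHb /andP[/IHa <- /IHb <-]; rewrite mevalM.
- by move=> a IHa n /IHa <-; rewrite rmorphXn.
Qed.

Definition fdnf N (L : seq (seq {mpoly F[N]} * seq {mpoly F[N]})) : ord.formula F :=
  foldr (fun bc f => ord.Or (ord.And
    (foldr (fun p f => ord.And (ord.Equal (mterm p) (Nat 0)) f) (@ord.Bool F true) bc.1)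
    (foldr (fun p f => ord.And (ord.Lt (Nat 0) (mterm p)) f) (@ord.Bool F true) bc.2)) f)
   (@ord.Bool F false) L.

Lemma holds_foldr_and (T : eqType) (f : T -> ord.formula F) (P : T -> Prop) (e : seq F) s :
  (forall t, ord.holds e (f t) <-> P t) ->
  ord.holds e (foldr (fun t g => ord.And (f t) g) (@ord.Bool F true) s) <-> forall t, t \in s -> P t.
Proof.
move=> H; elim: s => [|t s IH] //=; rewrite IH H; split=> [[h1 h2] q|h].
  by rewrite inE => /orP[/eqP ->|/h2].
by split=> [|q qs]; apply: h; rewrite inE ?eqxx ?qs ?orbT.
Qed.

Lemma holds_fdnf N L (e : seq F) : ord.holds e (@fdnf N L) <-> in_dnf L (fun i : 'I_N => e`_i).
Proof.
elim: L => [|[b c] L IH] /=; first by split=> // -[].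
rewrite IH (holds_foldr_and b (P := fun p => p.@[fun i : 'I_N => e`_i] = 0)); last first.
  by move=> p /=; rewrite eval_mterm.
rewrite (holds_foldr_and c (P := fun p => 0 < p.@[fun i : 'I_N => e`_i])); last first.
  by move=> p /=; rewrite eval_mterm.
split.
  case=> [[h1 h2]|[bc bL h]]; first by exists (b, c); rewrite ?mem_head.
  by exists bc => //; rewrite inE bL orbT.
case=> bc; rewrite inE => /orP[/eqP -> /= h|bL h]; [by left|by right; exists bc].
Qed.

Lemma holds_dnf e (l : seq (ord.oclause F)) :
  ord.holds e (ord.odnf_to_oform l) <-> exists2 oc, oc \in l & ord.holds e (ord.odnf_to_oform [:: oc]).
Proof.
elim: l => [|oc l IH]; first by split=> // -[].
have -> : ord.holds e (ord.odnf_to_oform (oc :: l)) <->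
    ord.holds e (ord.odnf_to_oform [:: oc]) \/ ord.holds e (ord.odnf_to_oform l).
  by rewrite -[oc :: l]cat1s; exact: ord.odnf_to_oform_cat.
rewrite IH; split.
  case=> [h|[oc' ol h]]; first by exists oc; rewrite ?mem_head.
  by exists oc' => //; rewrite inE ol orbT.
by case=> oc'; rewrite inE => /orP[/eqP ->|ol h]; [left|right; exists oc'].
Qed.

Lemma holds_w e (w : seq (GRing.term F) * seq (GRing.term F)) :
  ord.holds e (ord.odnf_to_oform [:: ord.w_to_oclause w]) <->
  (forall t, t \in w.1 -> GRing.eval e t = 0) /\ (forall t, t \in w.2 -> 0 < GRing.eval e t).
Proof.
case: w => a b /=.
rewrite (holds_foldr_and a (P := fun t => GRing.eval e t = 0)) //.
rewrite (holds_foldr_and b (P := fun t => 0 < GRing.eval e t)) //.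
by split=> [[[h1 [_ [h2 _]]]|]|[h1 h2]] //; left.
Qed.

(** The disjunctive normal form of the eliminated formula still contains disequations and weak
    inequalities; [oclause_to_w] splits them into equations and strict inequalities, the only
    conditions of [in_dnf]. *)
Lemma saset_holds N (f : ord.formula F) : saset (fun x : 'I_N -> F => ord.holds (env x) f).
Proof.
have rf := ord.to_rform_rformula f.
pose g := ord.quantifier_elim (fun i bc => qe_rcf.qfr_to_formula (@qe_rcf.wproj F i bc)) (ord.to_rform f).
have wfg : ord.qf_form g && ord.rformula g := ord.quantifier_elim_wf (@qe_rcf.wf_QE_wproj F) rf.
pose l := ord.qf_to_odnf g false.
have rl : all (@ord.dnf_rterm F) l by apply: ord.qf_to_dnf_rterm; case/andP: wfg.
pose ws := flatten [seq ord.oclause_to_w oc | oc <- l].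
pose L := [seq ([seq tpoly N t | t <- w.1], [seq tpoly N t | t <- w.2]) | w <- ws].
exists L => x.
have -> : ord.holds (env x) f <-> exists2 w, w \in ws &
  (forall t, t \in w.1 -> GRing.eval (env x) t = 0) /\ (forall t, t \in w.2 -> 0 < GRing.eval (env x) t).
  rewrite -ord.to_rformP.
  have -> : ord.holds (env x) (ord.to_rform f) <-> ord.qf_eval (env x) g.
    by split=> /(ord.quantifier_elim_rformP (@qe_rcf.wf_QE_wproj F) (@qe_rcf.valid_QE_wproj F) _ rf).
  rewrite -(ord.qf_to_dnfP (env x) wfg).
  have -> : ord.qf_eval (env x) (ord.odnf_to_oform l) <-> ord.holds (env x) (ord.odnf_to_oform l).
    by split=> /(ord.qf_evalP _ (ord.dnf_to_form_qf l)).
  rewrite holds_dnf; split.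
    move=> [oc ocl]; rewrite ord.oclause_neq_leq_elimP ord.oclause_to_wP holds_dnf => -[_ /mapP[w wo ->]].
    rewrite holds_w => h; exists w => //; apply/flatten_mapP; by exists oc.
  move=> [w /flatten_mapP[oc ol wo] h]; exists oc => //.
  rewrite ord.oclause_neq_leq_elimP ord.oclause_to_wP holds_dnf; exists (ord.w_to_oclause w).
    exact: map_f.
  by rewrite holds_w.
have rw w : w \in ws -> all (@GRing.rterm F) w.1 /\ all (@GRing.rterm F) w.2.
  move=> /flatten_mapP[oc ol wo]; have := ord.dnf_rterm_subproof (allP rl _ ol).
  by move=> /allP/(_ _ wo); rewrite /= /ord.dnf_rterm /= andbT => /andP.
split.
  move=> [w wws [h1 h2]]; have [/allP r1 /allP r2] := rw w wws.
  exists ([seq tpoly N t | t <- w.1], [seq tpoly N t | t <- w.2]); first exact: map_f.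
  by split=> _ /mapP[t tw ->]; rewrite eval_tpoly; auto.
move=> [_ /mapP[w wws ->] /= [h1 h2]]; have [/allP r1 /allP r2] := rw w wws.
by exists w => //; split=> t tw; rewrite -eval_tpoly; auto; [apply: h1|apply: h2]; apply: map_f.
Qed.

Definition ocat A n k (x : 'I_n -> A) (w : 'I_k -> A) (i : 'I_(n + k)) : A :=
  match split i with inl a => x a | inr b => w b end.

Lemma ocat_lshift A n k (x : 'I_n -> A) (w : 'I_k -> A) i : ocat x w (lshift k i) = x i.
Proof. by rewrite /ocat; case: splitP => j /= => [/val_inj ->|E] //; have := ltn_ord i; rewrite E ltnNge leq_addr. Qed.

Lemma ocat_rshift A n k (x : 'I_n -> A) (w : 'I_k -> A) i : ocat x w (rshift n i) = w i.
Proof.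
rewrite /ocat; case: splitP => j /= => [E|/addnI/val_inj -> //].
by have := ltn_ord j; rewrite -E ltnNge leq_addr.
Qed.

Lemma set_nth_size (e : seq F) x : set_nth 0 e (size e) x = rcons e x.
Proof. by elim: e => //= a e ->. Qed.

Lemma holds_exists (e : seq F) k f :
  ord.holds e (foldr (@ord.Exists F) f (iota (size e) k)) <->
  exists2 w, size w = k & ord.holds (e ++ w) f.
Proof.
elim: k e => [|k IH] e /=.
  split=> [h|[w /size0nil ->]]; last by rewrite cats0.
  by exists [::]; rewrite ?cats0.
split.
  move=> [x]; rewrite set_nth_size; rewrite -(size_rcons e x) IH => -[w sw h].
  by exists (x :: w) => /=; rewrite ?sw -?cat_rcons.
move=> [[|x w] //= [sw]]; rewrite -cat_rcons => h; exists x.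
rewrite set_nth_size -(size_rcons e x) IH; by exists w.
Qed.

Lemma saset_exists n k (S : ('I_(n + k) -> F) -> Prop) :
  saset S -> saset (fun x => exists w, S (ocat x w)).
Proof.
move=> [L HL].
apply: saset_ext (saset_holds n (foldr (@ord.Exists F) (fdnf L) (iota n k))) => x.
have := holds_exists (env x) k (fdnf L); rewrite size_env => ->.
have E (w : 'I_k -> F) : in_dnf L (fun i : 'I_(n + k) => (env x ++ env w)`_i) <-> S (ocat x w).
  rewrite HL.
  have -> // : (fun i : 'I_(n + k) => (env x ++ env w)`_i) = ocat x w.
  apply: funext => i; rewrite nth_cat size_env /ocat; case: splitP => j ->.
    by rewrite env_nth.
  by rewrite addKn env_nth.
split=> [[w sw]|[w /E h]]; last by exists (env w); rewrite ?size_env // holds_fdnf.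
rewrite holds_fdnf => h; exists (fun i => w`_i); apply/E.
have -> // : env (fun i : 'I_k => w`_i) = w.
apply: (@eq_from_nth _ 0); rewrite size_env ?sw // => i ik.
exact: (env_nth _ (Ordinal ik)).
Qed.

End Semialgebraic.

(** * Semialgebraic sets of series *)

Definition plift (f : Kser) : puiseux :=
  if pselect (is_puiseux f) is left Pf then Puiseux Pf else 0.

Lemma pliftK f : is_puiseux f -> pser (plift f) = f.
Proof. by rewrite /plift; case: pselect. Qed.

Definition mpoly_of_kpoly n (P : kpoly n) : {mpoly puiseux[n]} :=
  \sum_(m <- P) plift m.1 *: 'X_[[multinom m.2 i | i < n]].

Definition kpoly_of_mpoly n (p : {mpoly puiseux[n]}) : kpoly n :=
  [seq (pser p@_m, fun i : 'I_n => m i) | m <- msupp p].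

Lemma pser_monomial n (x : 'I_n -> puiseux) (m : 'I_n -> nat) :
  List.fold_right (fun i a => kmul (kpow (x i) (m i)) a) kone (enum 'I_n)
  = \prod_i x i ^+ m i.
Proof.
rewrite -[index_enum _]enumT; elim: (enum 'I_n) => [|i s IH] /=; first by rewrite big_nil pser1.
by rewrite big_cons IH pserM pserX.
Qed.

Lemma keval_mpoly_of_kpoly n (P : kpoly n) (x : 'I_n -> puiseux) : kpoly_coeffs P ->
  keval P (fun i => x i) = (mpoly_of_kpoly P).@[x].
Proof.
rewrite /mpoly_of_kpoly; elim: P => [|m P IH] HP; first by rewrite big_nil meval0.
rewrite big_cons mevalD mevalZ mevalX pserD pserM /= pser_monomial pliftK; last by apply: HP; left.
rewrite -IH; last by move=> m' hm; apply: HP; right.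
by congr (kadd (kmul _ _) _); congr (pser _); apply: eq_bigr => i _; rewrite mnmE.
Qed.

Lemma keval_kpoly_of_mpoly n (p : {mpoly puiseux[n]}) (x : 'I_n -> puiseux) :
  keval (kpoly_of_mpoly p) (fun i => x i) = p.@[x].
Proof.
rewrite mevalE /kpoly_of_mpoly; elim: (msupp p) => [|m s IH] /=; first by rewrite big_nil.
by rewrite big_cons IH pserD pserM pser_monomial.
Qed.

Lemma kpoly_of_mpoly_wf n (p : {mpoly puiseux[n]}) : kpoly_coeffs (kpoly_of_mpoly p).
Proof.
rewrite /kpoly_of_mpoly => m; elim: (msupp p) => //= a s IH [<-|/IH //]; exact: pserP.
Qed.

Lemma semialgebraic_saset n (S : ('I_n -> Kser) -> Prop) : semialgebraic S ->
  saset (fun x : 'I_n -> puiseux => S (fun i => x i)).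
Proof.
move=> [_ [Bs [wf H]]].
apply: (@saset_ext _ _ (fun x : 'I_n -> puiseux =>
    exists B, List.In B Bs /\ in_basic_sa B (fun i => x i))).
  by move=> x; rewrite H // => i; exact: pserP.
elim: Bs wf {H} => [|B Bs IH] wf; first by apply: saset_ext (@saset_False _ _) => x; split=> // -[] ? [].
have {}IH := IH (fun B' hB' => wf B' (or_intror hB')).
have [w1 w2] := wf B (or_introl erefl).
have H1 : saset (fun x : 'I_n -> puiseux => forall P, List.In P B.1 -> kpos (keval P (fun i => x i))).
  elim: (B.1) w1 => [|P s IHs] w1; first by apply: saset_ext (@saset_True _ _) => x; split.
  have := saset_and (saset_gt0 (mpoly_of_kpoly P)) (IHs (fun P' hP' => w1 P' (or_intror hP'))).
  apply: saset_ext => x; rewrite -kpos_gt0 -keval_mpoly_of_kpoly; last by apply: w1; left.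
  by split=> [[h1 h2] Q [<-|/h2]|h] //; split=> [|Q hQ]; apply: h; [left|right].
have H2 : saset (fun x : 'I_n -> puiseux => forall P, List.In P B.2 -> kis0 (keval P (fun i => x i))).
  elim: (B.2) w2 => [|P s IHs] w2; first by apply: saset_ext (@saset_True _ _) => x; split.
  have := saset_and (saset_eq0 (mpoly_of_kpoly P)) (IHs (fun P' hP' => w2 P' (or_intror hP'))).
  apply: saset_ext => x; rewrite -kis0P -keval_mpoly_of_kpoly; last by apply: w2; left.
  by split=> [[h1 h2] Q [<-|/h2]|h] //; split=> [|Q hQ]; apply: h; [left|right].
apply: saset_ext (saset_or (saset_and H1 H2) IH) => x; split.
  by case=> [h|[B' [hB' h]]]; [exists B; split=> //; left|exists B'; split=> //; right].
by case=> B' [[<-|hB'] h]; [left|right; exists B'].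
Qed.

Lemma saset_semialgebraic n (T : ('I_n -> puiseux) -> Prop) : saset T ->
  semialgebraic (fun y : 'I_n -> Kser => exists2 x : 'I_n -> puiseux, T x & y = (fun i => pser (x i))).
Proof.
move=> [L HL]; split; first by move=> _ [x _ ->] i; exact: pserP.
pose f (bc : seq {mpoly puiseux[n]} * seq {mpoly puiseux[n]}) : basic_sa n :=
  (List.map (@kpoly_of_mpoly n) bc.2, List.map (@kpoly_of_mpoly n) bc.1).
exists (List.map f L); split.
  move=> B /List.in_map_iff[bc [<- _]]; split=> P /= /List.in_map_iff[p [<- _]]; exact: kpoly_of_mpoly_wf.
move=> y hy; pose x i := plift (y i).
have Ey : y = (fun i => pser (x i)) by apply: funext => i; rewrite pliftK.
rewrite Ey; transitivity (T x).
  split=> [[x' Tx' E]|]; last by exists x.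
  have -> // : x = x'.
  by apply: funext => i; apply: puiseux_ext => e; rewrite -[pser (x i)]/((fun i => pser (x i)) i) E.
rewrite HL; split.
  move=> [bc bcL [h1 h2]]; exists (f bc); split; first by apply: List.in_map; apply/InE.
  split=> P /= /List.in_map_iff[p [<- /InE hp]]; rewrite keval_kpoly_of_mpoly.
    by apply/kpos_gt0; exact: h2.
  by apply/kis0P; exact: h1.
move=> [_ [/List.in_map_iff[bc [<- /InE bcL]] [h1 h2]]]; exists bc => //; split=> p hp.
  apply/kis0P; rewrite -keval_kpoly_of_mpoly; apply: h2; apply: List.in_map; exact/InE.
apply/kpos_gt0; rewrite -keval_kpoly_of_mpoly; apply: h1; apply: List.in_map; exact/InE.
Qed.

Lemma saset_comp (F : rcfType) n N (s : 'I_n -> 'I_N) (S : ('I_n -> F) -> Prop) :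
  saset S -> saset (fun x : 'I_N -> F => S (fun i => x (s i))).
Proof.
move=> [L HL].
pose sub (p : {mpoly F[n]}) : {mpoly F[N]} := p \mPo [tuple 'X_(s i) | i < n].
have E p (x : 'I_N -> F) : (sub p).@[x] = p.@[fun i => x (s i)].
  by rewrite comp_mpoly_meval; apply: meval_eq => i; rewrite tnth_mktuple mevalXU.
exists [seq ([seq sub p | p <- bc.1], [seq sub p | p <- bc.2]) | bc <- L] => x; rewrite HL; split.
  move=> [bc bcL [h1 h2]]; exists ([seq sub p | p <- bc.1], [seq sub p | p <- bc.2]); first exact: map_f.
  by split=> _ /mapP[p hp ->]; rewrite E; auto.
move=> [_ /mapP[bc bcL ->] /= [h1 h2]]; exists bc => //.
by split=> p hp; rewrite -E; [apply: h1|apply: h2]; apply: map_f.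
Qed.

(** * Tropical convexity of the valuation of a convex set *)

Lemma avoid_finite (s : seq R) : exists2 c, 0 < c < 1 & forall a, a \in s -> a != c.
Proof.
elim: s => [|a s [c /andP[c0 c1] Hc]]; first by exists (1 / 2) => //; lra.
pose m := \big[Num.min/c]_(b <- a :: s | 0 < b) b.
have m0 : 0 < m by rewrite /m; elim/big_ind: _ => // x y; rewrite lt_min => -> ->.
have mc : m <= c by exact: bigmin_le_id.
exists (m / 2); first by lra.
move=> b hb; have [b0|b0] := ltrP 0 b; last by rewrite lt_eqF //; lra.
have : m <= b by exact: (@ge_bigmin_seq _ _ _ (a :: s) c b (fun b => 0 < b) id hb b0).
by move=> mb; rewrite gt_eqF //; lra.
Qed.

Lemma kval_cases (x : puiseux) : (x = 0 /\ kval x = None) \/ exists2 l, isval x l & kval x = Some l.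
Proof.
have [->|/isval_exists[l hl]] := eqVneq x 0; first by left; split=> //; apply/kval_None.
by right; exists l => //; apply/kval_Some.
Qed.

Lemma isvalD_gt (x y : puiseux) l m : isval x l -> vle y m -> m < l -> isval (x + y) l /\ (x + y) l = x l.
Proof.
move=> [xl hx] hy ml.
have yl : y l = 0 by apply/eqP/negP => /negP/hy; rewrite leNgt ml.
have E : (x + y) l = x l by rewrite pcoefD yl addr0.
by split=> //; split; [rewrite E|apply: vleD => //; apply: vle_trans hy _; exact: ltW].
Qed.

(** The leading terms can only cancel when both products have the same valuation. If [l < 0], the
    leading coefficient of [1 - mono c l] is 1 and cancellation means [c = - Y b / X a]; if [l = 0],
    it is [1 - c] and cancellation means [c = Y b / (Y b - X a)]. Both values are excluded. *)
Lemma kval_mix (X Y : puiseux) c l : 0 < c < 1 -> l <= 0 ->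
  (forall a b, isval X a -> isval Y b -> (- Y b / X a != c) && (Y b / (Y b - X a) != c)) ->
  kval (mono c l * X + (1 - mono c l) * Y) = tmax (tplus (Some l) (kval X)) (tplus (Some 0) (kval Y)).
Proof.
move=> /andP[c0 c1] l0 H; set t := mono c l.
have vt : isval t l by apply: isval_mono; rewrite gt_eqF.
have tl : t l = c by rewrite pcoef_mono eqxx.
have [d [d0 vs ds]] : exists d, [/\ d != 0, isval (1 - t) 0 & (1 - t) 0 = d /\ (d = 1 \/ d = 1 - c)].
  have [ll|ll] := eqVneq l 0.
    have E : (1 - t) 0 = 1 - c by rewrite pcoefB -mono1 !pcoef_mono ll eqxx.
    have d0 : 1 - c != 0 by rewrite subr_eq0 gt_eqF.
    exists (1 - c); split=> //; [split; rewrite ?E //|by split=> //; right].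
    apply: vleB; first exact: vle1.
    by rewrite -ll; exact: vt.2.
  have ll0 : l < 0 by rewrite lt_neqAle ll.
  have [V E] := @isvalD_gt 1 (- t) 0 l (isval_mono 0 (oner_neq0 _)) (vleN vt.2) ll0.
  have E1 : (1 - t) 0 = 1 by rewrite E -mono1 pcoef_mono eqxx.
  by exists 1; rewrite oner_neq0; split=> //; split=> //; left.
have [[-> ->]|[a va ->]] := kval_cases X.
  have [[-> ->]|[b vb ->]] := kval_cases Y.
    by rewrite !mulr0 addr0; exact: (proj2 (kval_None 0) erefl).
  by rewrite mulr0 add0r; exact: (proj2 (kval_Some _ _) (isvalM vs vb)).
have vtX := isvalM vt va.
have [[-> ->]|[b vb ->]] := kval_cases Y.
  by rewrite mulr0 addr0; exact: (proj2 (kval_Some _ _) vtX).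
have vsY := isvalM vs vb; rewrite add0r in vsY.
have -> : tmax (tplus (Some l) (Some a)) (tplus (Some 0) (Some b)) = Some (Num.max (l + a) b).
  by rewrite /= RmaxE !RplusE add0r.
apply/kval_Some.
have [h|h|h] := ltrgtP (l + a) b.
- by rewrite addrC; apply: (isvalD_gt vsY vtX.2 h).1.
- by apply: (isvalD_gt vtX vsY.2 h).1.
rewrite ?h; split; last by apply: vleD; [rewrite -h; exact: vtX.2|exact: vsY.2].
have e1 : (t * X) b = c * X a by rewrite -h (pcoefM_lead vt.2 va.2) tl.
have e2 : ((1 - t) * Y) b = d * Y b by rewrite -{1}[b]add0r (pcoefM_lead vs.2 vb.2) ds.1.
rewrite pcoefD e1 e2; apply/eqP => E.
have [xa0 _] := va; have [yb0 _] := vb.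
have /andP[/eqP h1 /eqP h2] := H a b va vb.
case: ds.2 => Ed; rewrite Ed in E.
  by apply: h1; apply: (mulIf xa0); rewrite divfK //; lra.
have [E0|E0] := eqVneq (Y b - X a) 0; last by apply: h2; apply: (mulIf E0); rewrite divfK //; lra.
by move/eqP: yb0; apply; nra.
Qed.

(** The tropical weights [l <= 0] and 0 are lifted to [mono c l] and [1 - mono c l], where the real
    [c] between 0 and 1 avoids the finitely many values at which some coordinate cancels. *)
Lemma val_image_trop_convex n (S : ('I_n -> Kser) -> Prop) Sc :
  semialgebraic S -> kconvex S -> val_image S Sc -> trop_convex Sc.
Proof.
move=> [kp _] cS HS.
have key x y l : Sc x -> Sc y -> l <= 0 -> Sc (fun i => tmax (tplus (Some l) (x i)) (tplus (Some 0) (y i))).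
  move=> /HS[X [SX hX]] /HS[Y [SY hY]] l0.
  pose X' i := plift (X i); pose Y' i := plift (Y i).
  have EX i : X i = X' i by rewrite pliftK //; exact: kp SX i.
  have EY i : Y i = Y' i by rewrite pliftK //; exact: kp SY i.
  have [f Hf] := choice (fun x : puiseux => (ltac:(have [->|/isval_exists[l' h]] := eqVneq x 0;
     [by exists 0|by exists l']) : exists l, x != 0 -> isval x l)).
  pose s := [seq - Y' i (f (Y' i)) / X' i (f (X' i)) | i <- enum 'I_n]
     ++ [seq Y' i (f (Y' i)) / (Y' i (f (Y' i)) - X' i (f (X' i))) | i <- enum 'I_n].
  have [c c01 Hc] := avoid_finite s.
  pose t := mono c l.
  have /andP[c0 c1] := c01.
  have t0 : 0 <= t by apply: ltW; rewrite (@gt0_isval _ l) ?pcoef_mono ?eqxx //; apply: isval_mono; rewrite gt_eqF.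
  have t1 : t <= 1.
    rewrite -subr_ge0; apply: ltW.
    have [ll|ll] := eqVneq l 0.
      rewrite /t ll -mono1 (_ : _ - _ = mono (1 - c) 0).
        by rewrite (@gt0_isval _ 0) ?pcoef_mono ?eqxx ?subr_gt0 //; apply: isval_mono; rewrite subr_eq0 gt_eqF.
      by apply: puiseux_ext => e; rewrite pcoefB !pcoef_mono; case: ifP; rewrite ?subr0.
    have ll0 : l < 0 by rewrite lt_neqAle ll.
    have [V E] := @isvalD_gt 1 (- t) 0 l (isval_mono 0 (oner_neq0 _)) (vleN (@vle_mono _ _)) ll0.
    by rewrite (gt0_isval V) E -mono1 pcoef_mono eqxx.
  apply/HS; eexists; split.
    apply: (cS X Y t) => //; first exact: pserP.
      by rewrite -pser0; apply/kle_le.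
    by rewrite -pser1; apply/kle_le.
  move=> i /=; rewrite hX hY EX EY -pser1 -[kadd _ (kopp _)]/(pser (1 - t)).
  rewrite -[kadd _ _]/(pser (t * X' i + (1 - t) * Y' i)); symmetry; apply: kval_mix => // a b va vb.
  have <- := isval_uniq (Hf _ (isval_neq0 va)) va.
  have <- := isval_uniq (Hf _ (isval_neq0 vb)) vb.
  rewrite !Hc // /s mem_cat; apply/orP; [right|left]; apply/mapP; exists i => //; by rewrite mem_enum.
move=> x y [l|] [m|] Sx Sy //=; last 2 first.
- case=> ->; rewrite (_ : (fun i => _) = x) //; apply: funext => i.
  by case: (x i) => //= a; rewrite Rplus_0_l.
- case=> ->; rewrite (_ : (fun i => _) = y) //; apply: funext => i.
  by case: (y i) => //= a; rewrite Rplus_0_l.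
rewrite RmaxE => -[E]; have [ml|lm] := lerP m l.
  have l0 : l = 0 by move: E; rewrite max_l.
  rewrite l0; have := key y x m Sy Sx; rewrite -l0 => /(_ ml).
  congr Sc; apply: funext => i.
  by case: (x i) (y i) => [a|] [b|] //=; rewrite Rmax_comm.
have m0 : m = 0 by move: E; rewrite max_r // ltW.
by rewrite m0; apply: key => //; rewrite -m0 ltW.
Qed.

(** * Semilinear sets and signs at infinitely small perturbations *)

Lemma rdotE d (a : 'I_d -> Q) (x : 'I_d -> R) : rdot a x = \sum_i Q2R (a i) * x i.
Proof.
rewrite /rdot -[index_enum _]enumT; elim: (enum 'I_d) => [|i s IH] /=; first by rewrite big_nil.
by rewrite big_cons IH.
Qed.

Section Semilinear.
Variable d : nat.
Implicit Types S T : ('I_d -> R) -> Prop.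

Lemma semilinear_ext S T : (forall x, S x <-> T x) -> semilinear S -> semilinear T.
Proof. by move=> H [Bs HB]; exists Bs => x; rewrite -H. Qed.

Lemma semilinear_or S T : semilinear S -> semilinear T -> semilinear (fun x => S x \/ T x).
Proof.
move=> [Bs HB] [Cs HC]; exists (Bs ++ Cs)%list => x; rewrite HB HC; split.
  by case=> -[B [hB h]]; exists B; split=> //; apply/List.in_or_app; [left|right].
by case=> B [hB h]; case: (List.in_app_or _ _ _ hB) => hB'; [left|right]; exists B.
Qed.

Lemma semilinear_and S T : semilinear S -> semilinear T -> semilinear (fun x => S x /\ T x).
Proof.
move=> [Bs HB] [Cs HC].
exists (List.map (fun BC : basic_sl d * basic_sl d => (BC.1.1 ++ BC.2.1, BC.1.2 ++ BC.2.2)%list)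
  (List.list_prod Bs Cs)) => x; rewrite HB HC; split.
  move=> [[B [hB [b1 b2]]] [C [hC [c1 c2]]]]; eexists; split.
    by apply: (List.in_map _ _ (B, C)); apply/List.in_prod.
  by split=> r /= hr; case: (List.in_app_or _ _ _ hr); auto.
move=> [_ [/List.in_map_iff[[B C] [<- /List.in_prod_iff[hB hC]]] [h1 h2]]].
split; [exists B|exists C]; split=> //; split=> r hr; [apply: h1|apply: h2|apply: h1|apply: h2];
  by apply/List.in_or_app; auto.
Qed.

Lemma semilinear_const (P : Prop) : semilinear (fun _ : 'I_d -> R => P).
Proof.
have [p|np] := pselect P; last by exists [::] => x; split=> // -[? []].
by exists [:: ([::], [::])] => x; split=> // _; exists ([::], [::]); split; [left|split].
Qed.

Lemma semilinear_gt (a : 'I_d -> Q) b : semilinear (fun x => b < rdot a x).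
Proof.
exists [:: ([:: (a, b)], [::])] => x; split=> [/RltP h|[B [[<-|[]] [h _]]]].
  by exists ([:: (a, b)], [::]); split; [left|split=> // r [<-|[]]].
by have /RltP := h _ (or_introl erefl).
Qed.

Lemma semilinear_eq (a : 'I_d -> Q) b : semilinear (fun x => rdot a x = b).
Proof.
exists [:: ([::], [:: (a, b)])] => x; split=> [h|[B [[<-|[]] [_ h]]]].
  by exists ([::], [:: (a, b)]); split; [left|split=> // r [<-|[]]].
by have := h _ (or_introl erefl).
Qed.

Lemma semilinear_ex (I : eqType) (s : seq I) (S : I -> ('I_d -> R) -> Prop) :
  (forall i, semilinear (S i)) -> semilinear (fun x => exists2 i, i \in s & S i x).
Proof.
move=> H; elim: s => [|i s IH].
  by apply: semilinear_ext (semilinear_const False) => x; split=> // -[].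
apply: semilinear_ext (semilinear_or (H i) IH) => x; split.
  by case=> [h|[j js h]]; [exists i; rewrite ?mem_head|exists j; rewrite // inE js orbT].
by case=> j; rewrite inE => /orP[/eqP ->|js] h; [left|right; exists j].
Qed.

Lemma semilinear_all (I : eqType) (s : seq I) (S : I -> ('I_d -> R) -> Prop) :
  (forall i, semilinear (S i)) -> semilinear (fun x => forall i, i \in s -> S i x).
Proof.
move=> H; elim: s => [|i s IH]; first by apply: semilinear_ext (semilinear_const True).
apply: semilinear_ext (semilinear_and (H i) IH) => x; split.
  by move=> [h1 h2] j; rewrite inE => /orP[/eqP ->|/h2].
by move=> h; split=> [|j js]; apply: h; rewrite inE ?eqxx ?js ?orbT.
Qed.
End Semilinear.

(** * Properties of all small positive reals *)

Definition ev (P : R -> Prop) := exists2 e : R, 0 < e & forall h, 0 < h < e -> P h.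

Lemma ev_mono (P Q : R -> Prop) : (forall h, 0 < h -> P h -> Q h) -> ev P -> ev Q.
Proof. by move=> PQ [e e0 H]; exists e => // h /[dup] /andP[h0 _] /H; exact: PQ. Qed.

Lemma ev_and (P Q : R -> Prop) : ev P -> ev Q -> ev (fun h => P h /\ Q h).
Proof.
move=> [e e0 H] [f f0 G]; exists (Num.min e f); first by rewrite lt_min e0.
by move=> h /andP[h0]; rewrite lt_min => /andP[he hf]; split; [apply: H|apply: G]; rewrite h0.
Qed.

Lemma ev_lt a : 0 < a -> ev (fun h => h < a).
Proof. by move=> a0; exists a => // h /andP[]. Qed.

Lemma ev_ex P : ev P -> exists2 h, 0 < h & P h.
Proof. by move=> [e e0 H]; exists (e / 2); [lra|apply: H; apply/andP; split; lra]. Qed.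

Lemma ev_all (I : eqType) (s : seq I) (P : I -> R -> Prop) :
  (forall i, i \in s -> ev (P i)) -> ev (fun h => forall i, i \in s -> P i h).
Proof.
elim: s => [|i s IH] H; first by exists 1.
have := ev_and (H i (mem_head _ _)) (IH (fun j js => H j (@mem_behead _ (i :: s) j js))).
by apply: ev_mono => h _ [h1 h2] j; rewrite inE => /orP[/eqP ->|/h2].
Qed.

Lemma poly_bounded01 (q : {poly R}) : exists B, forall h, 0 <= h <= 1 -> `|q.[h]| <= B.
Proof.
elim/poly_ind: q => [|q c [B HB]]; first by exists 0 => h _; rewrite horner0 normr0.
exists (B + `|c|) => h /[dup] /HB hb /andP[h0 h1].
rewrite !hornerE; apply: (le_trans (ler_normD _ _)); rewrite lerD2r normrM (ger0_norm h0).
by apply: le_trans hb; rewrite ler_piMr.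
Qed.

Lemma poly_ev_pos (q : {poly R}) : 0 < q.[0] -> ev (fun h => 0 < q.[h]).
Proof.
elim/poly_ind: q => [|q c _]; first by rewrite horner0 ltxx.
rewrite !hornerE => c0; have [B HB] := poly_bounded01 q.
have B0 : 0 <= B by apply: (le_trans (normr_ge0 q.[0])); apply: HB; rewrite lexx ler01.
have B1 : 0 < B + 1 by lra.
apply: ev_mono (ev_and (ev_lt ltr01) (ev_lt (divr_gt0 c0 B1))) => h h0 [h1 h2].
rewrite !hornerE; rewrite ltr_pdivlMr // in h2.
have : `|q.[h]| <= B by apply: HB; rewrite !ltW.
by rewrite ler_norml => /andP[h3 h4]; nra.
Qed.

(** Once the largest power of [h], which is positive, is factored out, the value at 0 of the
    remaining factor decides. *)
Lemma poly_ev_sign (q : {poly R}) : q != 0 -> ev (fun h => 0 < q.[h]) \/ ev (fun h => q.[h] < 0).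
Proof.
move=> q0; have [m [r]] := multiplicity_XsubC q 0; rewrite q0 /root /= => r0 ->.
have [rp|rn] := ltrP 0 r.[0]; [left|right].
  apply: ev_mono (poly_ev_pos rp) => h h0 H.
  by rewrite hornerM horner_exp subr0 hornerX mulr_gt0 // exprn_gt0.
have : 0 < (- r).[0] by rewrite hornerN oppr_gt0 lt_neqAle r0.
move/poly_ev_pos; apply: ev_mono => h h0; rewrite hornerN oppr_gt0 => H.
by rewrite hornerM horner_exp subr0 hornerX nmulr_rlt0 // exprn_gt0.
Qed.

(** Makes the valuation a total real function [pval]; its value at 0 is arbitrary. *)
Lemma pval_subproof (x : puiseux) : exists l, x != 0 -> isval x l.
Proof. by have [->|/isval_exists[l hl]] := eqVneq x 0; [exists 0|exists l]. Qed.

Definition pval x := projT1 (cid (pval_subproof x)).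

Lemma pvalP x : x != 0 -> isval x (pval x).
Proof. by rewrite /pval; case: cid. Qed.

Lemma isval_sum_dom (I : eqType) (s : seq I) (a : I -> puiseux) (w : I -> R) i0 :
  uniq s -> i0 \in s -> isval (a i0) (w i0) ->
  (forall i, i \in s -> i != i0 -> vle (a i) (w i) /\ w i < w i0) ->
  isval (\sum_(i <- s) a i) (w i0) /\ (\sum_(i <- s) a i) (w i0) = a i0 (w i0).
Proof.
move=> us si [h1 h2] H.
have E : (\sum_(i <- s) a i) (w i0) = a i0 (w i0).
  rewrite pcoef_sum (bigD1_seq i0) //= big_seq_cond big1 ?addr0 // => i /andP[is_ ii0].
  have [h3 h4] := H i is_ ii0.
  by apply/eqP/negP => /negP/h3; rewrite leNgt h4.
split=> //; split; first by rewrite E.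
rewrite big_seq; apply: vle_sum => i is_; have [->//|ii0] := eqVneq i i0.
by have [h3 h4] := H i is_ ii0; apply: vle_trans h3 _; exact: ltW.
Qed.

Lemma mono1_prod (I : Type) (r : seq I) (f : I -> R) :
  \prod_(i <- r) mono 1 (f i) = mono 1 (\sum_(i <- r) f i).
Proof.
elim: r => [|i r IH]; first by rewrite !big_nil.
by rewrite !big_cons IH mono_mul mulr1.
Qed.

(** * Sign of a polynomial at a perturbed monomial point *)

Section Sign.
Variable N : nat.
Implicit Types (p : {mpoly puiseux[N]}) (u : 'I_N -> R) (m : 'X_{1.. N}).

Definition mpoint (e : 'I_N -> R) : 'I_N -> puiseux := fun i => mono 1 (e i).

Definition mweight p (e : 'I_N -> R) m : R := pval p@_m + \sum_i (m i)%:R * e i.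

(** The coordinates are powers of [t] with coefficient 1, so that the sign of the dominating term is
    the sign of its coefficient. *)
Lemma meval_dom p e m : m \in msupp p ->
  (forall m', m' \in msupp p -> m' != m -> mweight p e m' < mweight p e m) ->
  p.@[mpoint e] != 0 /\ (0 < p.@[mpoint e]) = (0 < p@_m).
Proof.
move=> mp H.
pose a m := p@_m * \prod_i mpoint e i ^+ m i.
have aE m' : a m' = p@_m' * mono 1 (\sum_i (m' i)%:R * e i).
  congr (_ * _); rewrite /mpoint; under eq_bigr do rewrite mono1X.
  by rewrite mono1_prod.
have va m' : m' \in msupp p -> isval (a m') (mweight p e m').
  rewrite mcoeff_msupp => h; rewrite aE; apply: isvalM; first exact: pvalP.
  exact: isval_mono (oner_neq0 _).
have [V E] := @isval_sum_dom _ (msupp p) a (mweight p e) m (msupp_uniq p) mp (va m mp)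
  (fun i ip ii => conj (va i ip).2 (H i ip ii)).
rewrite mevalE; split; first exact: isval_neq0 V.
rewrite (gt0_isval V) E aE pcoefM_lead; last exact: vle_mono.
  have pm : p@_m != 0 by rewrite -mcoeff_msupp.
  by rewrite pcoef_mono eqxx mulr1 -(gt0_isval (pvalP pm)).
by apply: (pvalP _).2; rewrite -mcoeff_msupp.
Qed.

(* The perturbation [h, h^2, h^3, ...] makes distinct monomials have distinct valuations. *)
Definition perturb u (h : R) : 'I_N -> R := fun i => u i + h ^+ i.+1.

Definition beats p u m m' := ev (fun h => mweight p (perturb u h) m' < mweight p (perturb u h) m).

Definition wdiff p u m m' : R := pval p@_m - pval p@_m' + \sum_i ((m i)%:R - (m' i)%:R) * u i.
(** The perturbation adds [h] times this polynomial to the difference of the two weights; it is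
    nonzero for distinct monomials because each variable is perturbed by its own power of [h]. *)
Definition wpoly m m' : {poly R} :=
  \poly_(i < N) oapp (fun j : 'I_N => (m j)%:R - (m' j)%:R) 0 (insub i).

Lemma wpoly_neq0 m m' : m != m' -> wpoly m m' != 0.
Proof.
apply: contra => /eqP E; apply/eqP/mnmP => i; apply/eqP.
have := congr1 (fun q : {poly R} => q`_i) E; rewrite coef0 coef_poly ltn_ord valK /= => /eqP.
by rewrite subr_eq0 eqr_nat.
Qed.

Lemma wpolyE m m' h : (wpoly m m').[h] = \sum_i ((m i)%:R - (m' i)%:R) * h ^+ i.
Proof. by rewrite horner_poly; apply: eq_bigr => i _; rewrite valK. Qed.

Lemma mweightB p u m m' h : mweight p (perturb u h) m - mweight p (perturb u h) m' =
  ((wdiff p u m m')%:P + wpoly m m' * 'X).[h].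
Proof.
rewrite hornerD hornerC hornerMX wpolyE /wdiff /mweight /perturb mulr_suml.
have E : \sum_i (m i)%:R * (u i + h ^+ i.+1) - \sum_i (m' i)%:R * (u i + h ^+ i.+1) =
    \sum_i ((m i)%:R - (m' i)%:R) * u i + \sum_i ((m i)%:R - (m' i)%:R) * h ^+ i * h.
  by rewrite -sumrB -big_split /=; apply: eq_bigr => i _; rewrite exprSr; ring.
by rewrite -[RHS]addrA -E; ring.
Qed.

Lemma beatsE p u m m' : beats p u m m' <-> ev (fun h => 0 < ((wdiff p u m m')%:P + wpoly m m' * 'X).[h]).
Proof. by split; apply: ev_mono => h _; rewrite -mweightB subr_gt0. Qed.

Lemma beats_total p u m m' : m != m' -> beats p u m m' \/ beats p u m' m.
Proof.
move=> /wpoly_neq0 w0; set q := (wdiff p u m m')%:P + wpoly m m' * 'X.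
have q0 : q != 0.
  apply/eqP => E; have {E} : wpoly m m' * 'X = - (wdiff p u m m')%:P by apply/eqP; rewrite -addr_eq0 addrC -/q E.
  move=> /(congr1 (fun r : {poly R} => size r)); rewrite size_mulX // size_polyN size_polyC.
  by case: size (size_poly_eq0 (wpoly m m')) => [|k _]; [rewrite (negPf w0)|case: (_ != 0)].
have [h|h] := poly_ev_sign q0; [left; exact/beatsE|right].
apply: ev_mono h => h _.
by rewrite -mweightB subr_lt0.
Qed.

(** The comparison is linear in [u], and ties are broken by a condition that does not involve [u].
    Hence the relation is semilinear. *)
Lemma beats_iff p u m m' : m != m' ->
  beats p u m m' <-> 0 < wdiff p u m m' \/ (wdiff p u m m' = 0 /\ ev (fun h => 0 < (wpoly m m' * 'X).[h])).
Proof.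
move=> mm; rewrite beatsE; set A := wdiff p u m m'; split.
  move=> H; have [a0|a0|a0] := ltrgtP 0 A; first by left.
    exfalso; have : 0 < (- (A%:P + wpoly m m' * 'X)).[0].
      by rewrite hornerN hornerD hornerC hornerMX mulr0 addr0; lra.
    move=> /poly_ev_pos/(ev_and H)/ev_ex[h _ []]; rewrite hornerN; lra.
  right; split=> //; apply: ev_mono H => h _; by rewrite -a0 add0r.
case=> [a0|[-> //]]; last by apply: ev_mono => h _; rewrite add0r.
by apply: poly_ev_pos; rewrite hornerD hornerC hornerMX mulr0 addr0.
Qed.

Lemma beats_trans p u m1 m2 m3 : beats p u m1 m2 -> beats p u m2 m3 -> beats p u m1 m3.
Proof. by move=> h1 h2; apply: ev_mono (ev_and h1 h2) => h _ [h3 h4]; exact: lt_trans h4 h3. Qed.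

Definition eventually_gt0 p u := exists2 m, m \in msupp p &
  0 < p@_m /\ forall m', m' \in [seq m' <- msupp p | m' != m] -> beats p u m m'.

(** [beats] is transitive and total on distinct monomials, hence has a maximum on the finite support
    of [p]. *)
Lemma exists_dom p u : p != 0 -> exists2 m, m \in msupp p &
  forall m', m' \in [seq m' <- msupp p | m' != m] -> beats p u m m'.
Proof.
rewrite -msupp_eq0; elim: (msupp p) => [//|a s IH] _.
have [->|s0] := eqVneq s [::].
  by exists a; rewrite ?mem_head // => m'; rewrite mem_filter inE => /andP[/negP].
have [m ms Hm] := IH s0.
have [Ea|am] := eqVneq a m.
  exists m; first by rewrite inE ms orbT.
  move=> m'; rewrite mem_filter inE Ea => /andP[mm' /orP[/eqP E|h]]; last by apply: Hm; rewrite mem_filter mm'.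
  by rewrite E eqxx in mm'.
have [bam|bma] := beats_total p u am.
  exists a; rewrite ?mem_head // => m'; rewrite mem_filter inE => /andP[aa /orP[/eqP E|h]].
    by rewrite E eqxx in aa.
  have [->//|mm'] := eqVneq m' m.
  by apply: beats_trans bam (Hm m' _); rewrite mem_filter mm'.
exists m; first by rewrite inE ms orbT.
move=> m'; rewrite mem_filter inE => /andP[mm' /orP[/eqP -> //|h]].
by apply: Hm; rewrite mem_filter mm'.
Qed.

Lemma ev_dom p u m : m \in msupp p ->
  (forall m', m' \in [seq m' <- msupp p | m' != m] -> beats p u m m') ->
  ev (fun h => p.@[mpoint (perturb u h)] != 0 /\ (0 < p.@[mpoint (perturb u h)]) = (0 < p@_m)).
Proof.
move=> mp /ev_all; apply: ev_mono => h _ H; apply: meval_dom => // m' m'p mm.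
by apply: H; rewrite mem_filter mm.
Qed.

Lemma eventually_gt0_ev p u : eventually_gt0 p u -> ev (fun h => 0 < p.@[mpoint (perturb u h)]).
Proof. by move=> [m mp [p0 /(ev_dom mp)]]; apply: ev_mono => h _ [_ ->]. Qed.

Lemma sign_decided p u : ev (fun h => (p.@[mpoint (perturb u h)] = 0 -> p = 0) /\ (0 < p.@[mpoint (perturb u h)] -> eventually_gt0 p u)).
Proof.
have [->|p0] := eqVneq p 0; first by exists 1 => // h _; rewrite meval0 ltxx.
have [m mp Hm] := exists_dom u p0.
apply: ev_mono (ev_dom mp Hm) => h _ [h1 ->]; split; first by move/eqP: h1.
by move=> h2; exists m.
Qed.

End Sign.

(** Coordinate 0 stands for the factor rho. Its exponent 0 is perturbed to [h] while the others move
    by [h^2], [h^3], ...: a single perturbation provides both rho and the much smaller displacements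
    of the centre. *)
Definition cons0 k (y : 'I_k -> R) : 'I_k.+1 -> R := fun i => if unlift ord0 i is Some j then y j else 0.

Lemma Q2R_natB (a b : nat) : Q2R (Qmake (Z.of_nat a - Z.of_nat b) 1) = a%:R - b%:R.
Proof. by rewrite /Q2R /= minus_IZR -!INR_IZR_INZ !INRE Rinv_1 RmultE mulr1. Qed.

Lemma semilinear_beats k p (m m' : 'X_{1.. k.+1}) : m != m' ->
  semilinear (fun y : 'I_k -> R => beats p (cons0 y) m m').
Proof.
move=> mm.
pose a (j : 'I_k) := Qmake (Z.of_nat (m (lift ord0 j)) - Z.of_nat (m' (lift ord0 j))) 1.
pose c := pval p@_m - pval p@_m'.
have E y : wdiff p (cons0 y) m m' = c + rdot a y.
  rewrite rdotE /wdiff big_ord_recl /cons0 unlift_none mulr0 add0r; congr (_ + _).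
  by apply: eq_bigr => j _; rewrite liftK Q2R_natB.
have := semilinear_or (semilinear_gt a (- c)) (semilinear_and (semilinear_eq a (- c))
  (semilinear_const _ (ev (fun h => 0 < (wpoly m m' * 'X).[h])))).
apply: semilinear_ext => y.
rewrite beats_iff // E; split.
  by case=> [h|[-> h]]; [left; lra|right; split=> //; ring].
by case=> [h|[h h']]; [left; lra|right; split=> //; lra].
Qed.

Lemma semilinear_eventually_gt0 k (p : {mpoly puiseux[k.+1]}) :
  semilinear (fun y : 'I_k -> R => eventually_gt0 p (cons0 y)).
Proof.
apply: semilinear_ex => m; apply: semilinear_and; first exact: semilinear_const.
have H m' : semilinear (fun y : 'I_k -> R => m' != m -> beats p (cons0 y) m m').
  have [->|mm] := eqVneq m' m; first by apply: semilinear_ext (semilinear_const _ True) => y; split.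
  by apply: semilinear_ext (semilinear_beats p (_ : m != m')) => [y|]; [split=> // h; exact: h|rewrite eq_sym].
apply: semilinear_ext (semilinear_all (msupp p) H) => y; split=> h m'.
  by rewrite mem_filter => /andP[mm m'p]; exact: h.
by move=> m'p mm; apply: h; rewrite mem_filter mm.
Qed.

(** A nonzero polynomial does not vanish at small perturbations, so that an equation holds there
    only if its polynomial is 0. *)
Definition eventually_in k (L : seq (seq {mpoly puiseux[k]} * seq {mpoly puiseux[k]})) u :=
  exists2 bc, bc \in L & (forall p, p \in bc.1 -> p = 0) /\ (forall p, p \in bc.2 -> eventually_gt0 p u).

Lemma eventually_inP k L (u : 'I_k -> R) :
  (eventually_in L u -> ev (fun h => in_dnf L (mpoint (perturb u h)))) /\ ev (fun h => in_dnf L (mpoint (perturb u h)) -> eventually_in L u).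
Proof.
split.
  move=> [bc bcL [h1 h2]].
  have := ev_all (fun p hp => eventually_gt0_ev (h2 p hp)); apply: ev_mono => h _ H.
  by exists bc => //; split=> // p /h1 ->; rewrite meval0.
pose s := flatten [seq bc.1 ++ bc.2 | bc <- L].
have := ev_all (fun p (_ : p \in s) => sign_decided p u); apply: ev_mono => h _ H [bc bcL [h1 h2]].
exists bc => //; split=> p hp.
  apply: (H p _).1; last exact: h1.
  by apply/flatten_mapP; exists bc => //; rewrite mem_cat hp.
apply: (H p _).2; last exact: h2.
by apply/flatten_mapP; exists bc => //; rewrite mem_cat hp orbT.
Qed.

Lemma semilinear_eventually_in k (L : seq (seq {mpoly puiseux[k.+1]} * seq {mpoly puiseux[k.+1]})) :
  semilinear (fun y : 'I_k -> R => eventually_in L (cons0 y)).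
Proof.
apply: semilinear_ex => bc; apply: semilinear_and; first exact: semilinear_const.
apply: semilinear_all => p; exact: semilinear_eventually_gt0.
Qed.

(** * Infinitely small powers and large constants *)

Lemma poly_sign_pinfty (r : {poly R}) : r != 0 ->
  exists M0, forall M, M0 < M -> r.[M] != 0 /\ (0 < r.[M]) = (0 < lead_coef r).
Proof.
move=> r0; have [lp|ln] := ltrP 0 (lead_coef r).
  have [M0 H] := poly_pinfty_gt_lc lp; exists M0 => M /ltW/H h.
  by rewrite gt_eqF ?(lt_le_trans lp).
have lp : 0 < lead_coef (- r) by rewrite lead_coefN oppr_gt0 lt_neqAle lead_coef_eq0 r0.
have [M0 H] := poly_pinfty_gt_lc lp; exists M0 => M /ltW/H h.
have : r.[M] < 0 by rewrite -oppr_gt0 -hornerN (lt_le_trans lp).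
by move=> h'; rewrite lt_eqF // ltNge ltW.
Qed.

Lemma pcoefM_cst (x : puiseux) c e : (x * pcst c) e = x e * c.
Proof.
rewrite (@pcoefM _ _ _ [:: e]) //; first by rewrite big_seq1 subrr pcoef_mono eqxx.
by move=> a _; rewrite pcoef_mono inE subr_eq0; have [_|_] := eqVneq e a; rewrite ?eqxx.
Qed.

(* An infinitesimally small power [t^h] and a large real constant give every polynomial in one
   variable the same sign. *)
Lemma sign_mono_pcst (g : {poly puiseux}) : exists M0, ev (fun h => forall M, M0 < M ->
  (g.[mono 1 h] = 0 -> g.[pcst M] = 0) /\ (0 < g.[mono 1 h] -> 0 < g.[pcst M])).
Proof.
have [->|g0] := eqVneq g 0; first by exists 0, 1 => // h _ M _; rewrite !horner0.
pose l j := pval g`_j.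
have sg : (0 < size g)%N by rewrite lt0n size_poly_eq0.
have lg : g`_(size g).-1 != 0 by rewrite -[g`__]/(lead_coef g) lead_coef_eq0.
have lt0 : ((size g).-1 < size g)%N by rewrite prednK.
have [i1 gi1 Hi1] := @arg_maxP _ _ _ (Ordinal lt0) (fun j : 'I_(size g) => g`_j != 0) (fun j => l j) lg.
pose v := l i1.
pose P2 (j : 'I_(size g)) := (g`_j != 0) && (l j == v).
have P2i : P2 i1 by rewrite /P2 gi1 eqxx.
(* [b] is the largest degree among the coefficients of maximal valuation [v]. At [t^h] with small
   [h], degree breaks the ties between valuations; at a large constant, degree decides in the real
   polynomial [r] formed by the coefficients of [t^v]. Both signs are that of the coefficient of
   degree [b]. *)
case: (@arg_maxnP _ i1 P2 (fun j => val j) P2i) => b /andP[gb /eqP lb] Hb.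
have vb : isval g`_b v by rewrite -lb; exact: pvalP.
have lev j : g`_j != 0 -> l j <= v.
  by move=> gj; have [hj|hj] := ltnP j (size g); [exact: (Hi1 (Ordinal hj))|rewrite nth_default ?eqxx in gj].
have ltb j : g`_j != 0 -> j != b -> l j < v \/ (l j = v /\ (j < b)%N).
  move=> gj jb; have [h|h|h] := ltrgtP (l j) v; first by left.
    by have := lev j gj; rewrite leNgt h.
  have [hj|hj] := ltnP j (size g); last by rewrite nth_default ?eqxx in gj.
  right; split=> //; rewrite ltn_neqAle jb; apply: (Hb (Ordinal hj)); by rewrite /P2 /= gj h eqxx.
pose r := \poly_(j < size g) g`_j v.
have rE j : r`_j = g`_j v by rewrite coef_poly; case: ltnP => // h; rewrite [g`_j]nth_default.
have rb : r`_b != 0 by rewrite rE; case: vb.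
have r0 : r != 0 by apply: contra rb => /eqP ->; rewrite coef0.
have sr : size r = b.+1.
  apply/eqP; rewrite eqn_leq; apply/andP; split.
    apply/leq_sizeP => j bj; rewrite rE; have [->|gj] := eqVneq g`_j 0; first by [].
    have [h|[_ h]] := ltb j gj (negbT (gtn_eqF bj)); last by rewrite ltnNge ltnW in h.
    apply/eqP/negP => /negP/(pvalP gj).2; by rewrite leNgt h.
  by rewrite ltnNge; apply/negP => /leq_sizeP/(_ b (leqnn _)) /eqP; rewrite (negPf rb).
have lr : lead_coef r = g`_b v by rewrite /lead_coef sr /= rE.
have [M0 HM] := poly_sign_pinfty r0.
have sgnM M : M0 < M -> g.[pcst M] != 0 /\ (0 < g.[pcst M]) = (0 < g`_b).
  move=> /HM[h1 h2].
  have E : g.[pcst M] v = r.[M].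
    rewrite horner_coef (horner_coef_wide _ (size_poly _ _)) pcoef_sum; apply: eq_bigr => j _.
    by rewrite -rmorphXn pcoefM_cst -rE.
  have V : isval g.[pcst M] v.
    split; first by rewrite E.
    rewrite horner_coef; apply: vle_sum => j _; have [->|gj] := eqVneq g`_j 0.
      by rewrite mul0r; exact: vle0.
    rewrite -[v]addr0 -rmorphXn; apply: vleM; last exact: vle_mono.
    by apply: vle_trans (pvalP gj).2 _; exact: lev.
  by rewrite (isval_neq0 V) (gt0_isval V) E h2 lr (gt0_isval vb).
have sgnh : ev (fun h => g.[mono 1 h] != 0 /\ (0 < g.[mono 1 h]) = (0 < g`_b)).
  pose s := [seq j <- iota 0 (size g) | g`_j != 0].
  have H j : j \in s -> ev (fun h => j != b -> l j + j%:R * h < v + b%:R * h).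
    rewrite mem_filter => /andP[gj _].
    have [->|jb] := eqVneq j (b : nat); first by exists 1.
    have [h|[-> h]] := ltb j gj jb.
      have d0 : 0 < (v - l j) / (j%:R + 1) by rewrite divr_gt0 ?subr_gt0 // ltr_wpDl.
      apply: ev_mono (ev_lt d0) => h' h'0; rewrite ltr_pdivlMr; last by rewrite ltr_wpDl.
      move=> h2 _; have : 0 <= b%:R * h' by rewrite mulr_ge0 // ltW.
      by lra.
    by exists 1 => // h' /andP[h'0 _] _; rewrite ltrD2l ltr_pM2r // ltr_nat.
  apply: ev_mono (ev_all H) => h h0 Hh.
  pose a j := g`_j * mono 1 (j%:R * h).
  have E : g.[mono 1 h] = \sum_(j <- s) a j.
    rewrite horner_coef /s [RHS]big_filter [RHS]big_mkcond /= -(big_mkord xpredT (fun j => g`_j * mono 1 h ^+ j)).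
    rewrite /index_iota subn0; apply: eq_bigr => j _; rewrite /a mono1X.
    by case: eqVneq => [->|//]; rewrite mul0r.
  have va j : j \in s -> isval (a j) (l j + j%:R * h).
    rewrite mem_filter => /andP[gj _]; apply: isvalM; first exact: pvalP.
    exact: isval_mono (oner_neq0 _).
  have bs : (b : nat) \in s by rewrite mem_filter gb mem_iota /= ltn_ord.
  have [||V Ev] := @isval_sum_dom _ s a (fun j => l j + j%:R * h) b _ bs (va b bs).
  - by rewrite filter_uniq // iota_uniq.
  - by move=> j js jb; split; [exact: (va j js).2|rewrite lb; apply: Hh].
  rewrite E (isval_neq0 V) (gt0_isval V) Ev /a.
  by rewrite (pcoefM_lead (pvalP gb).2 (@vle_mono _ _)) pcoef_mono eqxx mulr1 -(gt0_isval (pvalP gb)).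
exists M0; apply: ev_mono sgnh => h _ [h1 h2] M /sgnM[h3 h4]; split; first by move/eqP; rewrite (negPf h1).
by rewrite h2 h4.
Qed.

Definition spec0 k (p : {mpoly puiseux[k.+1]}) (x : 'I_k -> puiseux) : {poly puiseux} :=
  \sum_(m <- msupp p) (p@_m * \prod_(j < k) x j ^+ m (lift ord0 j)) *: 'X^(m ord0).

Definition pcons k (a : puiseux) (x : 'I_k -> puiseux) : 'I_k.+1 -> puiseux :=
  fun i => if unlift ord0 i is Some j then x j else a.

Lemma horner_spec0 k (p : {mpoly puiseux[k.+1]}) x a : (spec0 p x).[a] = p.@[pcons a x].
Proof.
rewrite mevalE /spec0 horner_sum; apply: eq_bigr => m _; rewrite hornerZ hornerXn big_ord_recl.
rewrite /pcons unlift_none -mulrA; congr (_ * _); rewrite mulrC; congr (_ * _).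
by apply: eq_bigr => j _; rewrite liftK.
Qed.

Lemma in_dnf_mono_pcst k (L : seq (seq {mpoly puiseux[k.+1]} * seq {mpoly puiseux[k.+1]})) x :
  exists M0, ev (fun h => forall M, M0 < M -> in_dnf L (pcons (mono 1 h) x) -> in_dnf L (pcons (pcst M) x)).
Proof.
pose s := flatten [seq bc.1 ++ bc.2 | bc <- L].
have [M0 H] : exists M0, ev (fun h => forall M, M0 < M -> forall p, p \in s ->
    ((spec0 p x).[mono 1 h] = 0 -> (spec0 p x).[pcst M] = 0) /\
    (0 < (spec0 p x).[mono 1 h] -> 0 < (spec0 p x).[pcst M])).
  elim: s => [|p s [M1 H1]]; first by exists 0, 1.
  have [M2 H2] := sign_mono_pcst (spec0 p x).
  exists (Num.max M1 M2); apply: ev_mono (ev_and H1 H2) => h _ [h1 h2] M.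
  rewrite gt_max => /andP[m1 m2] q; rewrite inE => /orP[/eqP ->|]; [exact: h2|exact: h1].
exists M0; apply: ev_mono H => h _ H M /H{}H [bc bcL [h1 h2]]; exists bc => //; split=> p hp.
  have ps : p \in s by apply/flatten_mapP; exists bc => //; rewrite mem_cat hp.
  by rewrite -horner_spec0; apply: (H p ps).1; rewrite horner_spec0; exact: h1.
have ps : p \in s by apply/flatten_mapP; exists bc => //; rewrite mem_cat hp orbT.
by rewrite -horner_spec0; apply: (H p ps).2; rewrite horner_spec0; exact: h2.
Qed.

(** * Strata of the valuation of a semialgebraic set *)

Lemma lt_of_isval (a b : puiseux) l m : isval a l -> isval b m -> l < m -> 0 < b -> a < b.
Proof.
move=> va vb lm b0; rewrite -subr_gt0.
have [V E] := isvalD_gt vb (vleN va.2) lm.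
by rewrite (gt0_isval V) E -(gt0_isval vb).
Qed.

Lemma isval_sqr x l : isval x l -> isval (x ^+ 2) (l + l).
Proof. by move=> h; rewrite expr2; exact: isvalM. Qed.

Lemma isval_pcst M : 0 < M -> isval (pcst M) 0.
Proof. by move=> M0; apply: isval_mono; rewrite gt_eqF. Qed.

Section Strata.
Variables (n : nat) (S : ('I_n -> Kser) -> Prop) (Sc : ('I_n -> Trop) -> Prop) (K : {set 'I_n}).
Hypotheses (saS : semialgebraic S) (HS : val_image S Sc).
Let k := #|K|.

(* The points [x] within a factor [v ord0] of [S] restricted to the coordinates in [K].
   Squares absorb the signs of the coordinates. *)
Definition fat (v : 'I_k.+1 -> puiseux) := exists x : 'I_n -> puiseux,
  [/\ S (fun i => x i),
      forall j : 'I_k, v (lift ord0 j) ^+ 2 <= v ord0 ^+ 2 * x (enum_val j) ^+ 2,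
      forall j : 'I_k, x (enum_val j) ^+ 2 <= v ord0 ^+ 2 * v (lift ord0 j) ^+ 2 &
      forall i, i \notin K -> x i = 0].

Lemma saset_fat : saset fat.
Proof.
pose vv (i : 'I_k.+1) : {mpoly puiseux[k.+1 + n]} := 'X_(lshift n i).
pose xx (i : 'I_n) : {mpoly puiseux[k.+1 + n]} := 'X_(rshift k.+1 i).
have H1 := saset_comp (@rshift k.+1 n) (semialgebraic_saset saS).
have H2 := @saset_forall _ _ 'I_k _ (fun j : 'I_k =>
  saset_ge0 (vv ord0 ^+ 2 * xx (enum_val j) ^+ 2 - vv (lift ord0 j) ^+ 2)).
have H3 := @saset_forall _ _ 'I_k _ (fun j : 'I_k =>
  saset_ge0 (vv ord0 ^+ 2 * vv (lift ord0 j) ^+ 2 - xx (enum_val j) ^+ 2)).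
have H4 := @saset_all _ _ _ (enum (~: K)) _ (fun i _ => saset_eq0 (xx i)).
apply: saset_ext (saset_exists (saset_and (saset_and H1 H2) (saset_and H3 H4))) => v.
have Ev i w : (vv i).@[ocat v w] = v i by rewrite mevalXU ocat_lshift.
have Ex i w : (xx i).@[ocat v w] = w i by rewrite mevalXU ocat_rshift.
have Es w : (fun i => pser (ocat v w (rshift k.+1 i))) = (fun i => pser (w i)).
  by apply: funext => i; rewrite ocat_rshift.
split=> [[w [[h1 h2] [h3 h4]]]|[w [h1 h2 h3 h4]]]; exists w.
  split; first by rewrite -Es.
  - by move=> j; have := h2 j; rewrite mevalB mevalM !rmorphXn /= !Ev Ex subr_ge0.
  - by move=> j; have := h3 j; rewrite mevalB mevalM !rmorphXn /= !Ev Ex subr_ge0.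
  - by move=> i iK; have := h4 i; rewrite Ex; apply; rewrite mem_enum inE.
split; split.
- by rewrite Es.
- by move=> j; have := h2 j; rewrite mevalB mevalM !rmorphXn /= !Ev Ex subr_ge0.
- by move=> j; have := h3 j; rewrite mevalB mevalM !rmorphXn /= !Ev Ex subr_ge0.
- by move=> i; rewrite mem_enum inE Ex; exact: h4.
Qed.

Lemma pcons0 m a (x : 'I_m -> puiseux) : pcons a x ord0 = a.
Proof. by rewrite /pcons unlift_none. Qed.
Lemma pconsS m a (x : 'I_m -> puiseux) j : pcons a x (lift ord0 j) = x j.
Proof. by rewrite /pcons liftK. Qed.

Lemma stratum_fat z d h : stratum Sc K z -> (forall j, `|d j| < h) ->
  fat (pcons (mono 1 h) (fun j => mono 1 (z j + d j))).
Proof.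
move=> [y [Sy [Ky Ey]]] dh.
have [X [SX EX]] := (HS y).1 Sy; pose x i := plift (X i).
have Ex i : X i = x i by rewrite pliftK //; exact: saS.1 SX i.
have vx j : isval (x (enum_val j)) (z j) by apply/kval_Some; rewrite -Ex -EX.
have vm e : isval (mono 1 e) e := isval_mono e (oner_neq0 _).
exists x; split; rewrite ?pcons0.
- by rewrite (_ : (fun i => _) = X) //; apply: funext => i.
- move=> j; rewrite pconsS; have := dh j; rewrite ltr_norml => /andP[h1 h2].
  apply/ltW/(lt_of_isval (isval_sqr (vm _)) (isvalM (isval_sqr (vm _)) (isval_sqr (vx j)))); first lra.
  by rewrite mulr_gt0 // lt_def sqr_ge0 expf_neq0 // ?(isval_neq0 (vm _)) ?(isval_neq0 (vx j)).
- move=> j; rewrite pconsS; have := dh j; rewrite ltr_norml => /andP[h1 h2].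
  apply/ltW/(lt_of_isval (isval_sqr (vx j)) (isvalM (isval_sqr (vm _)) (isval_sqr (vm _)))); first lra.
  by rewrite mulr_gt0 // lt_def sqr_ge0 expf_neq0 // (isval_neq0 (vm _)).
- move=> i iK; apply/kval_None; rewrite -Ex -EX; case E : (y i) => [a|] //.
  by move: iK; rewrite (introT idP ((Ky i).2 _)) // E.
Qed.

(** Moving the centre from [z + d] to [z] costs a factor of at most [t^h]; the resulting [t^(2 h)]
    is rounded up to [t^(3 h)]. *)
Lemma fat_widen z d h : (forall j, `|d j| <= h) -> fat (pcons (mono 1 h) (fun j => mono 1 (z j + d j))) ->
  fat (pcons (mono 1 (3 * h)) (fun j => mono 1 (z j))).
Proof.
move=> dh [x [h1 h2 h3 h4]]; exists x.
have le_mono a b : a <= b -> mono 1 a <= mono 1 b.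
  rewrite le_eqVlt => /orP[/eqP -> //|ab]; apply/ltW.
  exact: (lt_of_isval (isval_mono a (oner_neq0 _)) (isval_mono b (oner_neq0 _)) ab (mono1_gt0 _)).
split=> // j; move: (h2 j) (h3 j) (dh j); rewrite !pcons0 !pconsS ler_norml => {}h2 {}h3 /andP[d1 d2].
  have -> : mono 1 (z j) ^+ 2 = mono 1 (- 2 * d j) * mono 1 (z j + d j) ^+ 2.
    by rewrite !mono1X mono_mul mulr1; congr (mono 1 _); ring.
  apply: (le_trans (ler_wpM2l (ltW (mono1_gt0 _)) h2)); rewrite mulrA ler_wpM2r ?sqr_ge0 //.
  by rewrite !mono1X mono_mul mulr1; apply: le_mono; lra.
apply: (le_trans h3); rewrite !mono1X !mono_mul mulr1; apply: le_mono; lra.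
Qed.

(** Real constants have valuation 0, so that a series within a constant factor of [t^(z j)] has
    valuation exactly [z j]. *)
Lemma fat_pcst z M : 0 < M -> fat (pcons (pcst M) (fun j => mono 1 (z j))) -> stratum Sc K z.
Proof.
move=> M0 [x [h1 h2 h3 h4]]; rewrite pcons0 in h2 h3.
have vM := isval_sqr (isval_pcst M0).
have vx j : isval (x (enum_val j)) (z j).
  have := h2 j; have := h3 j; rewrite pconsS => {}h3 {}h2.
  have vm := isval_sqr (isval_mono (z j) (oner_neq0 _)).
  have x0 : x (enum_val j) != 0.
    apply/eqP => E; move: h2; rewrite E expr0n mulr0 leNgt => /negP; apply.
    by rewrite exprn_gt0 // mono1_gt0.
  have [l vl] := isval_exists x0; have vl2 := isval_sqr vl.
  have x2 : 0 < x (enum_val j) ^+ 2 by rewrite lt_def sqr_ge0 expf_neq0.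
  have [lz|zl|<- //] := ltrgtP l (z j).
    have := lt_of_isval (isvalM vM vl2) vm; rewrite exprn_gt0 ?mono1_gt0 // => H.
    by move: h2; rewrite leNgt H //; lra.
  have := lt_of_isval (isvalM vM vm) vl2; rewrite x2 => H.
  by move: h3; rewrite leNgt H //; lra.
exists (fun i => kval (x i)); split; first by apply/HS; exists (fun i => pser (x i)).
split=> [i|j]; last by apply/kval_Some.
split=> [iK|].
  have -> : i = enum_val (enum_rank_in iK i) by rewrite enum_rankK_in.
  by rewrite (proj2 (kval_Some _ _) (vx _)).
by apply: contra_notT => /h4 ->; apply/(kval_None 0).
Qed.

Lemma not_stratum_not_fat z : ~ stratum Sc K z ->
  ev (fun h => ~ fat (pcons (mono 1 h) (fun j => mono 1 (z j)))).
Proof.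
move=> nz; have [L HL] := saset_fat.
have [M0 H] := in_dnf_mono_pcst L (fun j => mono 1 (z j)).
apply: ev_mono H => h _ H /HL Hf; apply: nz.
have M1 : 0 < `|M0| + 1 by have := normr_ge0 M0; lra.
by apply: (fat_pcst M1); apply/HL; apply: H => //; have := ler_norm M0; lra.
Qed.

Lemma stratum_closed : rclosed (stratum Sc K).
Proof.
move=> z /not_stratum_not_fat/ev_ex[h h0 H].
exists (h / 3); split; first by apply/RltP; rewrite R0E; lra.
move=> y Hy Sy; apply: H.
have -> : h = 3 * (h / 3) by field.
pose d j := y j - z j.
have dh j : `|d j| < h / 3 by have /RltP := Hy j; rewrite RabsE.
apply: (@fat_widen z d) => [j|]; first exact: ltW.
have -> : (fun j => mono 1 (z j + d j)) = (fun j => mono 1 (y j + 0)).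
  by apply: funext => j; rewrite addr0 /d addrC subrK.
by apply: stratum_fat => // j; rewrite normr0; lra.
Qed.

(** The condition [eventually_in] tests [fat] at a slightly displaced centre. From the stratum to
    the condition, [stratum_fat] tolerates the displacement; conversely [fat_widen] recentres at
    scale [3 h], where [not_stratum_not_fat] would exclude it. *)
Lemma stratum_semilinear : semilinear (stratum Sc K).
Proof.
have [L HL] := saset_fat.
apply: semilinear_ext (semilinear_eventually_in L) => z.
have E h : mpoint (perturb (cons0 z) h) = pcons (mono 1 h) (fun j => mono 1 (z j + h ^+ j.+2)).
  apply: funext => i; rewrite /mpoint /perturb /cons0 /pcons; case: unliftP => [j ->|->].
    by rewrite lift0.
  by rewrite add0r expr1.
have dh h : 0 < h < 1 -> forall j : 'I_k, `|h ^+ j.+2| < h.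
  move=> /andP[h0 h1] j; rewrite ger0_norm ?exprn_ge0 ?ltW //.
  by rewrite exprS gtr_pMr // exprn_ilt1 // ltW.
have [H1 H2] := eventually_inP L (cons0 z); split.
  move=> /H1 {}H1; apply: contrapT => /not_stratum_not_fat [e e0 He].
  have e3 : 0 < e / 3 by lra.
  have [h h0 [Hf [h1 h2]]] := ev_ex (ev_and H1 (ev_and (ev_lt ltr01) (ev_lt e3))).
  apply: (He (3 * h)); first by apply/andP; split; lra.
  apply: (@fat_widen z (fun j => h ^+ j.+2)); last by apply/HL; rewrite -E.
  by move=> j; apply/ltW/dh; rewrite h0.
move=> Sz; have [h h0 [H h1]] := ev_ex (ev_and H2 (ev_lt ltr01)); apply: H.
apply/HL; rewrite E; apply: stratum_fat => // j; apply: dh; by rewrite h0.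
Qed.
End Strata.

(** * Lifting tropical Metzler spectrahedra *)

Definition tmono (a : Trop) : puiseux := if a is Some r then mono 1 r else 0.

Lemma tmono_ge0 a : 0 <= tmono a.
Proof. by case: a => [r|] //=; exact: ltW (mono1_gt0 _). Qed.

Lemma kval_mono1 e : kval (mono 1 e) = Some e.
Proof. by apply/kval_Some; exact: isval_mono (oner_neq0 _). Qed.

Lemma kval_tmono a : kval (tmono a) = a.
Proof. by case: a => [r|]; [exact: kval_mono1|apply/(kval_None 0)]. Qed.

Lemma tmono_le a b : tle a b -> tmono a <= tmono b.
Proof.
case: a b => [a|] [b|] //=; last by move=> _; exact: ltW (mono1_gt0 _).
move=> /RleP; rewrite le_eqVlt => /orP[/eqP -> //|ab].
by apply: ltW; exact: (lt_of_isval (isval_mono a (oner_neq0 _)) (isval_mono b (oner_neq0 _)) ab (mono1_gt0 _)).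
Qed.

Lemma tmonoD a b : tmono (tplus a b) = tmono a * tmono b.
Proof. by case: a b => [a|] [b|] /=; rewrite ?mul0r ?mulr0 // mono_mul mulr1. Qed.

Lemma kvalM (x y : puiseux) : kval (x * y) = tplus (kval x) (kval y).
Proof.
have [[-> ->]|[l vl ->]] := kval_cases x; first by rewrite mul0r; apply/(kval_None 0).
have [[-> ->]|[m vm ->]] := kval_cases y; first by rewrite mulr0; apply/(kval_None 0).
by apply/kval_Some; exact: isvalM.
Qed.

Lemma kval_le (x y : puiseux) : 0 <= x -> x <= y -> tle (kval x) (kval y).
Proof.
move=> x0 xy; have [[_ ->]//|[l vl ->]] := kval_cases x.
have y0 : 0 < y by apply: lt_le_trans xy; rewrite lt_def (isval_neq0 vl).
have [[E _]|[m vm ->]] := kval_cases y; first by rewrite E ltxx in y0.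
apply/RleP; rewrite leNgt; apply/negP => ml.
have := lt_of_isval vm vl ml; rewrite lt_def (isval_neq0 vl) x0 => /(_ isT).
by rewrite ltNge xy.
Qed.

Lemma kval_addr (x y : puiseux) : 0 <= x -> 0 <= y -> kval (x + y) = tmax (kval x) (kval y).
Proof.
move=> x0 y0.
have [[-> ->]|[l vl ->]] := kval_cases x; first by rewrite add0r.
have [[-> ->]|[m vm ->]] := kval_cases y; first by rewrite addr0; apply/kval_Some.
have xl : 0 < x l by rewrite -(gt0_isval vl) lt_def (isval_neq0 vl).
have ym : 0 < y m by rewrite -(gt0_isval vm) lt_def (isval_neq0 vm).
have -> : tmax (Some l) (Some m) = Some (Num.max l m) by rewrite /= RmaxE.
apply/kval_Some; have [h|h|h] := ltrgtP l m.
- by rewrite addrC; apply: (isvalD_gt vm vl.2 h).1.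
- by apply: (isvalD_gt vl vm.2 h).1.
rewrite -h in vm ym *; split; last by apply: vleD; [exact: vl.2|exact: vm.2].
by rewrite pcoefD gt_eqF // addr_gt0.
Qed.

Lemma kval_pcstM c (x : puiseux) : 0 < c -> kval (pcst c * x) = kval x.
Proof.
move=> c0; rewrite kvalM (proj2 (kval_Some _ _) (isval_pcst c0)).
by case: (kval x) => [a|] //=; rewrite Rplus_0_l.
Qed.

(** The sign is dropped here: the positive and the negative entries are separated by the predicate
    [p] of [lform]. *)
Definition scoef (a : stnum) : puiseux := tmono (smod a).

Definition hext N (x : 'I_N -> puiseux) (k : 'I_N.+1) : puiseux :=
  if unlift ord0 k is Some j then x j else 1.

Definition lform N (p : 'I_N.+1 -> bool) (q : 'I_N.+1 -> stnum) (x : 'I_N -> puiseux) : puiseux :=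
  \sum_(k <- enum 'I_N.+1) (if p k then scoef (q k) else 0) * hext x k.

Definition tform N (p : 'I_N.+1 -> bool) (q : 'I_N.+1 -> stnum) (x : 'I_N -> Trop) : Trop :=
  tbigmax p (fun k => tplus (smod (q k)) (xext x k)).

Section Forms.
Variables (N : nat) (p : 'I_N.+1 -> bool) (q : 'I_N.+1 -> stnum).

Lemma hext_ge0 (x : 'I_N -> puiseux) k : (forall i, 0 <= x i) -> 0 <= hext x k.
Proof. by move=> x0; rewrite /hext; case: unliftP => // _; rewrite ler01. Qed.

Lemma lform_ge0 x : (forall i, 0 <= x i) -> 0 <= lform p q x.
Proof.
move=> x0; apply: sumr_ge0 => k _; rewrite mulr_ge0 ?hext_ge0 //.
by case: ifP => _ //; exact: tmono_ge0.
Qed.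

Lemma kval_hext (x : 'I_N -> puiseux) k : kval (hext x k) = xext (fun i => kval (x i)) k.
Proof. by rewrite /hext /xext; case: unliftP => // _; rewrite -mono1 kval_mono1. Qed.

Lemma kval_lform x : (forall i, 0 <= x i) -> kval (lform p q x) = tform p q (fun i => kval (x i)).
Proof.
move=> x0; rewrite /lform /tform /tbigmax.
elim: (enum 'I_N.+1) => [|k s IH] /=; first by rewrite big_nil; apply/(kval_None 0).
rewrite big_cons kval_addr ?IH; first last.
- apply: sumr_ge0 => j _; rewrite mulr_ge0 ?hext_ge0 //; case: ifP => _ //; exact: tmono_ge0.
- rewrite mulr_ge0 ?hext_ge0 //; case: ifP => _ //; exact: tmono_ge0.
case: (p k); first by rewrite kvalM kval_hext kval_tmono.
by rewrite mul0r (proj2 (kval_None 0) erefl).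
Qed.

Lemma hext_tmono (y : 'I_N -> Trop) k : hext (fun i => tmono (y i)) k = tmono (xext y k).
Proof. by rewrite /hext /xext; case: unliftP. Qed.

Lemma tle_maxl a b : tle a (tmax a b).
Proof. by case: a b => [a|] [b|] //=; apply/RleP; rewrite ?RmaxE ?le_max lexx. Qed.
Lemma tle_maxr a b : tle b (tmax a b).
Proof. by case: a b => [a|] [b|] //=; apply/RleP; rewrite ?RmaxE ?le_max lexx ?orbT. Qed.

(** A sum of [N + 1] nonnegative terms lies between its largest term and [N + 1] times that term. *)
Lemma lform_tmono y : tmono (tform p q y) <= lform p q (fun i => tmono (y i)) <=
  N.+1%:R * tmono (tform p q y).
Proof.
rewrite /lform /tform /tbigmax.
have -> : N.+1%:R = (size (enum 'I_N.+1))%:R :> puiseux by rewrite size_enum_ord.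
elim: (enum 'I_N.+1) => [|k s /andP[IH1 IH2]]; first by rewrite big_nil mul0r lexx.
rewrite big_cons [List.fold_right _ _ _]/=; set F := List.fold_right _ _ s in IH1 IH2 *.
set sm := \sum_(j <- s) _ in IH1 IH2 *.
case: (p k); last by rewrite mul0r add0r IH1 /= (le_trans IH2) // ler_wpM2r ?tmono_ge0 // ler_nat.
rewrite hext_tmono /scoef -tmonoD; set a := tplus _ _; apply/andP; split.
  case: (a) (F) IH1 => [u|] [v|] /= h; rewrite ?add0r //.
  - rewrite RmaxE; have [uv|uv] := lerP u v.
      by apply: (le_trans h); rewrite lerDr; exact: ltW (mono1_gt0 _).
    by rewrite lerDl (le_trans _ h) // (tmono_ge0 (Some v)).
  - by rewrite lerDl (le_trans _ h).
rewrite [size _]/= -natr1 mulrDl mul1r addrC; apply: lerD.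
  by apply: (le_trans IH2); apply: ler_wpM2l; [exact: ler0n|apply: tmono_le; exact: tle_maxr].
by apply: tmono_le; exact: tle_maxl.
Qed.

Lemma lform_mix (t : puiseux) x y :
  lform p q (fun i => t * x i + (1 - t) * y i) = t * lform p q x + (1 - t) * lform p q y.
Proof.
rewrite /lform !mulr_sumr -big_split /=; apply: eq_bigr => k _.
by rewrite /hext; case: (unlift ord0 k) => [j|]; ring.
Qed.

Definition mform : {mpoly puiseux[N]} :=
  \sum_(k <- enum 'I_N.+1) (if p k then scoef (q k) else 0) *: (if unlift ord0 k is Some j then 'X_j else 1).

Lemma meval_mform x : mform.@[x] = lform p q x.
Proof.
rewrite /mform /lform rmorph_sum; apply: eq_bigr => k _ /=; rewrite mevalZ /hext.
by case: (unlift ord0 k) => [j|]; rewrite ?mevalXU ?meval1.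
Qed.
End Forms.

(** Multiplying the two hypotheses bounds [(a a')^2] by [C^2 (b c') (b' c)], so that the inequality
    of arithmetic and geometric means gives [2 a a' <= C (b c' + b' c)], the bound on the mixed
    term. *)
Lemma sqr_mix (F : realFieldType) (C a b c a' b' c' s t : F) : 0 <= C ->
  0 <= a -> 0 <= b -> 0 <= c -> 0 <= a' -> 0 <= b' -> 0 <= c' -> 0 <= s -> 0 <= t ->
  a ^+ 2 <= C * (b * c) -> a' ^+ 2 <= C * (b' * c') ->
  (s * a + t * a') ^+ 2 <= C * ((s * b + t * b') * (s * c + t * c')).
Proof.
move=> C0 a0 b0 c0 a'0 b'0 c'0 s0 t0 h h'.
have H : a * a' * 2 <= C * (b * c' + b' * c).
  rewrite -(@ler_pXn2r _ 2) ?nnegrE ?mulr_ge0 ?addr_ge0 ?mulr_ge0 //.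
  have h1 : (a * a') ^+ 2 <= (C * (b * c)) * (C * (b' * c')).
    by rewrite exprMn; apply: ler_pM => //; exact: sqr_ge0.
  have h2 : 0 <= C ^+ 2 * (b * c' - b' * c) ^+ 2 by rewrite mulr_ge0 ?sqr_ge0.
  rewrite exprMn; apply: (le_trans (ler_wpM2r (sqr_ge0 _) h1)).
  by rewrite -subr_ge0 (le_trans h2) // le_eqVlt; apply/orP; left; apply/eqP; ring.
have e1 : s ^+ 2 * a ^+ 2 <= s ^+ 2 * (C * (b * c)) by rewrite ler_wpM2l ?sqr_ge0.
have e2 : t ^+ 2 * a' ^+ 2 <= t ^+ 2 * (C * (b' * c')) by rewrite ler_wpM2l ?sqr_ge0.
have e3 : s * t * (a * a' * 2) <= s * t * (C * (b * c' + b' * c)) by rewrite ler_wpM2l ?mulr_ge0.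
rewrite -subr_ge0; move: e1 e2 e3; rewrite -!(subr_ge0 _ (_ * _)) => e1 e2 e3.
apply: (le_trans (addr_ge0 (addr_ge0 e1 e2) e3)); rewrite le_eqVlt; apply/orP; left; apply/eqP; ring.
Qed.

Lemma mevalXn (F : comNzRingType) n (x : 'I_n -> F) p k : (p ^+ k).@[x] = p.@[x] ^+ k.
Proof. exact: rmorphXn. Qed.

Section Lift.
Variables (N m : nat) (Qs : 'I_N.+1 -> smatrix m).

(** The off-diagonal form enters squared, hence the square of the number of terms; it also covers
    the factor [N + 1] of the diagonal condition. *)
Definition liftC : R := N.+1%:R ^+ 2.
Local Notation C := (pcst liftC).
Local Notation Lp i := (lform (fun k => is_spos (Qs k i i)) (fun k => Qs k i i)).
Local Notation Lm i := (lform (fun k => is_sneg (Qs k i i)) (fun k => Qs k i i)).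
Local Notation Lij i j := (lform (fun _ => true) (fun k => Qs k i j)).

(* The nonnegative points with [Lm i <= C Lp i] and [(Lij i j)^2 <= C Lp i Lp j]; the constant [C]
   absorbs the number of terms of the linear forms. *)
Definition lifted (x : 'I_N -> puiseux) := [/\ forall i, 0 <= x i,
  forall i, Lm i x <= C * Lp i x & forall i j, i <> j -> Lij i j x ^+ 2 <= C * (Lp i x * Lp j x)].

Lemma liftC_gt0 : 0 < liftC. Proof. by rewrite exprn_gt0. Qed.
Lemma pliftC_ge0 : 0 <= C.
Proof. by apply: ltW; rewrite (gt0_isval (isval_pcst liftC_gt0)) pcoef_mono eqxx liftC_gt0. Qed.

Lemma saset_lifted : saset lifted.
Proof.
pose P i := mform (fun k => is_spos (Qs k i i)) (fun k => Qs k i i).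
pose M i := mform (fun k => is_sneg (Qs k i i)) (fun k => Qs k i i).
pose O i j := mform (fun _ => true) (fun k => Qs k i j).
have H1 := @saset_forall _ _ _ _ (fun i : 'I_N => saset_ge0 ('X_i : {mpoly puiseux[N]})).
have H2 := @saset_forall _ _ _ _ (fun i : 'I_m => saset_ge0 (C *: P i - M i)).
have H3 := @saset_all _ _ _ [seq ij <- enum [set: 'I_m * 'I_m] | ij.1 != ij.2] _
  (fun ij _ => saset_ge0 (C *: (P ij.1 * P ij.2) - O ij.1 ij.2 ^+ 2)).
apply: saset_ext (saset_and H1 (saset_and H2 H3)) => x; split.
  move=> [h1 [h2 h3]]; split.
  - by move=> i; have := h1 i; rewrite mevalXU.
  - by move=> i; have := h2 i; rewrite mevalB mevalZ !meval_mform subr_ge0.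
  - move=> i j /eqP ij; have := h3 (i, j); rewrite mem_filter ij mem_enum inE => /(_ isT).
    by rewrite mevalB mevalZ mevalM mevalXn !meval_mform subr_ge0.
move=> [h1 h2 h3]; split; first by move=> i; rewrite mevalXU.
split; first by move=> i; rewrite mevalB mevalZ !meval_mform subr_ge0.
move=> [i j]; rewrite mem_filter => /andP[/eqP ij _].
by rewrite mevalB mevalZ mevalM mevalXn !meval_mform subr_ge0; exact: h3.
Qed.

Lemma lifted_mix x y t : lifted x -> lifted y -> 0 <= t -> t <= 1 ->
  lifted (fun i => t * x i + (1 - t) * y i).
Proof.
move=> [x1 x2 x3] [y1 y2 y3] t0 t1; have s0 : 0 <= 1 - t by rewrite subr_ge0.
have C0 := pliftC_ge0.
split.
- by move=> i; rewrite addr_ge0 // mulr_ge0.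
- move=> i; rewrite !lform_mix mulrDr; apply: lerD; rewrite mulrCA ler_wpM2l //.
- by move=> i j ij; rewrite !lform_mix; apply: sqr_mix => //; rewrite ?lform_ge0 //; auto.
Qed.

Lemma lifted_kval x : lifted x -> metzler_spec Qs (fun i => kval (x i)).
Proof.
move=> [x0 h1 h2]; split.
  move=> i; have := kval_le (lform_ge0 _ _ x0) (h1 i).
  by rewrite kval_pcstM ?liftC_gt0 // !kval_lform.
move=> i j ij; have := kval_le (sqr_ge0 _) (h2 i j ij).
by rewrite kval_pcstM ?liftC_gt0 // expr2 !kvalM !kval_lform.
Qed.

Lemma lifted_tmono y : metzler_spec Qs y -> lifted (fun i => tmono (y i)).
Proof.
move=> [h1 h2]; split; first by move=> i; exact: tmono_ge0.
- move=> i; have /andP[_ hm] := lform_tmono (fun k => is_sneg (Qs k i i)) (fun k => Qs k i i) y.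
  have /andP[hp _] := lform_tmono (fun k => is_spos (Qs k i i)) (fun k => Qs k i i) y.
  apply: (le_trans hm); rewrite /liftC rmorphXn rmorph_nat.
  apply: (@le_trans _ _ (N.+1%:R * tmono (Qplus_ii Qs y i))); first by rewrite ler_wpM2l ?ler0n //; apply: tmono_le; exact: h1.
  apply: ler_pM => //; first exact: tmono_ge0.
  by rewrite expr2 -{1}[N.+1%:R]mulr1 ler_wpM2l // ler1n.
move=> i j ij; have /andP[l0 hm] := lform_tmono (fun k => true) (fun k => Qs k i j) y.
have /andP[hp _] := lform_tmono (fun k => is_spos (Qs k i i)) (fun k => Qs k i i) y.
have /andP[hq _] := lform_tmono (fun k => is_spos (Qs k j j)) (fun k => Qs k j j) y.
have l1 := le_trans (tmono_ge0 _) l0.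
apply: (@le_trans _ _ ((N.+1%:R * tmono (Q_ij Qs y i j)) ^+ 2)); first by rewrite ler_pXn2r ?nnegrE // mulr_ge0 ?tmono_ge0.
rewrite exprMn /liftC rmorphXn rmorph_nat ler_wpM2l ?sqr_ge0 // expr2 -tmonoD.
by apply: (le_trans (tmono_le (h2 i j ij))); rewrite tmonoD; apply: ler_pM => //; exact: tmono_ge0.
Qed.
End Lift.

Lemma projection_spec_lift n n' m (Qs : 'I_(n + n').+1 -> smatrix m) (Sc : ('I_n -> Trop) -> Prop) :
  (forall y : 'I_n -> Trop, Sc y <-> exists w, metzler_spec Qs w /\ forall i, w (lshift n' i) = y i) ->
  exists S : ('I_n -> Kser) -> Prop, semialgebraic S /\ kconvex S /\ val_image S Sc.
Proof.
move=> HSc; pose T x := exists w, lifted Qs (ocat x w).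
exists (fun y => exists2 x : 'I_n -> puiseux, T x & y = (fun i => pser (x i))).
split; first by apply: saset_semialgebraic; apply: saset_exists; exact: saset_lifted.
split.
  move=> _ _ t [x [w Tx] ->] [y [v Ty] ->] pt t0 t1.
  pose s := Puiseux pt.
  have s0 : 0 <= s by apply/kle_le; rewrite pser0.
  have s1 : s <= 1 by apply/kle_le; rewrite pser1.
  exists (fun i => s * x i + (1 - s) * y i); last first.
    by apply: funext => i; rewrite pserD !pserM -pser1.
  exists (fun i => s * w i + (1 - s) * v i).
  have := lifted_mix Tx Ty s0 s1; congr lifted.
  by apply: funext => i; rewrite /ocat; case: splitP.
move=> y; rewrite HSc; split.
  move=> [w [Hw Ew]]; exists (fun i => pser (tmono (w (lshift n' i)))); split.
    exists (fun i => tmono (w (lshift n' i))) => //.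
    exists (fun i => tmono (w (rshift n i))); have := lifted_tmono Hw; congr lifted.
    by apply: funext => i; rewrite /ocat; case: splitP => j E; congr (tmono (w _)); apply: val_inj.
  by move=> i; rewrite kval_tmono Ew.
move=> [_ [[x [w Tx] ->] Ey]]; exists (fun i => kval (ocat x w i)); split; first exact: lifted_kval.
by move=> i; rewrite ocat_lshift Ey.
Qed.

(** * Fourier-Motzkin elimination *)

Section FourierMotzkin.
Variable I : finType.

(** A row bounds the linear form from below. Coefficients are integers, so that they can serve later
    as multiplicities in an average. *)
Definition lrow := ({ffun I -> int} * R)%type.
Definition rsat (r : lrow) (x : I -> R) := r.2 <= \sum_i (r.1 i)%:~R * x i.
Definition rcomb (a b : nat) (r s : lrow) : lrow :=
  ([ffun i => a%:Z * r.1 i + b%:Z * s.1 i], a%:R * r.2 + b%:R * s.2).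
(** Properties stable under nonnegative integer combinations survive elimination; this transports
    sign, support and coefficient sum from the initial rows to the final ones. *)
Definition conic (Q : lrow -> Prop) := forall a b r s, Q r -> Q s -> Q (rcomb a b r s).
Definition upd (x : I -> R) v t := fun i => if i == v then t else x i.

Lemma rcomb_sum a b (r s : lrow) (x : I -> R) : \sum_i ((rcomb a b r s).1 i)%:~R * x i =
  a%:R * (\sum_i (r.1 i)%:~R * x i) + b%:R * (\sum_i (s.1 i)%:~R * x i).
Proof.
rewrite !mulr_sumr -big_split /=; apply: eq_bigr => i _.
by rewrite ffunE rmorphD !rmorphM /= -!pmulrn mulrDl !mulrA.
Qed.

Lemma upd_sum (r : lrow) (x : I -> R) v t : \sum_i (r.1 i)%:~R * upd x v t i =
  \sum_i (r.1 i)%:~R * x i + (r.1 v)%:~R * (t - x v).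
Proof.
rewrite (eq_bigr (fun i => (r.1 i)%:~R * x i + (if i == v then (r.1 v)%:~R * (t - x v) else 0))).
  by rewrite big_split -big_mkcond big_pred1_eq.
move=> i _; rewrite /upd; have [->|_] := eqVneq i v; last by rewrite addr0.
by rewrite mulrBr addrC subrK.
Qed.

Lemma between (A B : seq R) : (forall a b, a \in A -> b \in B -> a <= b) ->
  exists t, (forall a, a \in A -> a <= t) /\ (forall b, b \in B -> t <= b).
Proof.
elim: A => [|a A IH] H.
  exists (\big[Num.min/0]_(b <- B) b); split=> // b bB; exact: (@ge_bigmin_seq _ _ _ B 0 b predT id bB isT).
have [a' b a'A bB|t [h1 h2]] := IH; first by apply: H => //; rewrite inE a'A orbT.
exists (Num.max a t); split=> [a'|b bB].
  by rewrite inE le_max => /orP[/eqP ->|/h1 ->]; rewrite ?lexx ?orbT.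
by rewrite ge_max h2 // H // mem_head.
Qed.

Lemma fourier_motzkin1 (v : I) (L : seq lrow) : exists L' : seq lrow,
  [/\ forall r, r \in L' -> r.1 v = 0,
      forall Q, conic Q -> (forall r, r \in L -> Q r) -> forall r, r \in L' -> Q r &
      forall x, (forall r, r \in L' -> rsat r x) <-> exists t, forall r, r \in L -> rsat r (upd x v t)].
Proof.
pose L0 := [seq r : lrow <- L | r.1 v == 0].
pose Lp := [seq r : lrow <- L | 0 < r.1 v].
pose Ln := [seq r : lrow <- L | r.1 v < 0].
pose cmb (p q : lrow) := rcomb `|q.1 v|%N `|p.1 v|%N p q.
exists (L0 ++ [seq cmb p q | p <- Lp, q <- Ln]); split.
- move=> r; rewrite mem_cat => /orP[|/allpairsP[[p q] /= []]]; first by rewrite mem_filter => /andP[/eqP].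
  rewrite !mem_filter => /andP[p0 _] /andP[q0 _] ->.
  rewrite ffunE !abszE (gtr0_norm p0) (ltr0_norm q0); ring.
- move=> Q cQ QL r; rewrite mem_cat => /orP[|/allpairsP[[p q] /= []]].
    by rewrite mem_filter => /andP[_ /QL].
  by rewrite !mem_filter => /andP[_ /QL Qp] /andP[_ /QL Qq] ->; exact: cQ.
move=> x; split; last first.
  move=> [t Ht] r; rewrite mem_cat => /orP[|/allpairsP[[p q] /= []]].
    rewrite mem_filter => /andP[/eqP r0 /Ht]; rewrite /rsat upd_sum r0 mul0r addr0 //.
  rewrite !mem_filter => /andP[p0 /Ht hp] /andP[q0 /Ht hq] ->.
  move: hp hq; rewrite /rsat !upd_sum rcomb_sum /= => hp hq.
  have e1 : `|q.1 v|%:R = - (q.1 v)%:~R :> R by rewrite -mulrNz -(ltr0_norm q0) -abszE -pmulrn.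
  have e2 : `|p.1 v|%:R = (p.1 v)%:~R :> R by rewrite -{2}(gtr0_norm p0) -abszE -pmulrn.
  have {}p0 : 0 < (p.1 v)%:~R :> R by rewrite ltr0z.
  have {}q0 : (q.1 v)%:~R < 0 :> R by rewrite ltrz0.
  rewrite e1 e2; nra.
move=> H.
pose rest (r : lrow) := \sum_i (r.1 i)%:~R * x i - (r.1 v)%:~R * x v.
pose bnd (r : lrow) := (r.2 - rest r) / (r.1 v)%:~R.
have [a b|t [Ha Hb]] := @between [seq bnd r | r <- Lp] [seq bnd r | r <- Ln].
  move=> /mapP[p pL ->] /mapP[q qL ->].
  have := H (cmb p q); rewrite mem_cat allpairs_f ?orbT // => /(_ isT).
  move: pL qL; rewrite !mem_filter => /andP[p0 _] /andP[q0 _].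
  rewrite /rsat rcomb_sum /=.
  have -> : `|q.1 v|%:R = - (q.1 v)%:~R :> R by rewrite -mulrNz -(ltr0_norm q0) -abszE -pmulrn.
  have -> : `|p.1 v|%:R = (p.1 v)%:~R :> R by rewrite -{2}(gtr0_norm p0) -abszE -pmulrn.
  have {}p0 : 0 < (p.1 v)%:~R :> R by rewrite ltr0z.
  have {}q0 : (q.1 v)%:~R < 0 :> R by rewrite ltrz0.
  rewrite /bnd /rest ler_pdivrMr // mulrAC ler_ndivlMr //; nra.
exists t => r rL; rewrite /rsat upd_sum.
have [r0|r0|r0] := ltrgtP 0 (r.1 v).
- have rp : (0 : R) < (r.1 v)%:~R by rewrite ltr0z.
  have := Ha (bnd r) (map_f _ _); rewrite mem_filter r0 rL => /(_ isT).
  rewrite /bnd ler_pdivrMr // /rest; lra.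
- have rn : (r.1 v)%:~R < (0 : R) by rewrite ltrz0.
  have := Hb (bnd r) (map_f _ _); rewrite mem_filter r0 rL => /(_ isT).
  rewrite /bnd ler_ndivlMr // /rest; lra.
have := H r; rewrite mem_cat mem_filter -r0 eqxx rL => /(_ isT).
by rewrite /rsat mul0r addr0.
Qed.

Lemma fourier_motzkin (vs : seq I) (L : seq lrow) : exists L' : seq lrow,
  [/\ forall r v, r \in L' -> v \in vs -> r.1 v = 0,
      forall Q, conic Q -> (forall r, r \in L -> Q r) -> forall r, r \in L' -> Q r &
      forall x, (forall r, r \in L' -> rsat r x) <->
        exists2 y, (forall i, i \notin vs -> y i = x i) & forall r, r \in L -> rsat r y].
Proof.
elim: vs => [|v vs [L1 [z1 q1 s1]]].
  exists L; split=> // x; split=> [H|[y E H] r /H]; first by exists x.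
  by rewrite /rsat; under eq_bigr do rewrite E //.
have [L2 [z2 q2 s2]] := fourier_motzkin1 v L1; exists L2; split.
- move=> r w rL; rewrite inE => /orP[/eqP ->|wvs]; first exact: z2.
  apply: (q2 (fun r => r.1 w = 0)) rL => [a b r1 r2 h1 h2|r' r'L]; last exact: z1.
  by rewrite ffunE h1 h2 !mulr0 addr0.
- by move=> Q cQ QL r; apply: q2 => //; exact: q1.
move=> x; rewrite s2; split.
  move=> [t /s1 [y E H]]; exists y => // i; rewrite inE negb_or => /andP[iv ivs].
  by rewrite E // /upd (negPf iv).
move=> [y E H]; exists (y v); apply/s1; exists y => // i ivs; rewrite /upd.
by case: eqP => [-> //|/eqP iv]; apply: E; rewrite inE negb_or iv.
Qed.
End FourierMotzkin.

(* [P] is a nonempty polyhedron invariant under adding constants. The largest coordinate [k0] of a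
   point of [P] lying below [x] on [K] is a minimum of averages of the coordinates of [x] in [K]. *)
Lemma max_below n (K : {set 'I_n}) (P : seq (lrow 'I_n)) (k0 : 'I_n) :
  (forall r, r \in P -> \sum_i r.1 i = 0) -> (exists p, forall r, r \in P -> rsat r p) ->
  exists L : seq ({ffun 'I_n -> nat} * R),
    (forall r, r \in L -> (0 < \sum_i r.1 i)%N /\ forall i, i \notin K -> r.1 i = 0%N) /\
    forall x s, (exists p, [/\ forall r, r \in P -> rsat r p, forall i, i \in K -> p i <= x i & s <= p k0]) <->
      forall r, r \in L -> (\sum_i r.1 i)%:R * s + r.2 <= \sum_i (r.1 i)%:R * x i.
Proof.
move=> P0 [p0 Hp0].
(* The variables are the point [p], to be eliminated, then the parameters [x] and [s]. *)
pose I := ('I_n + ('I_n + unit))%type.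
pose unitrow (f : I -> int) b : lrow I := ([ffun i => f i], b).
pose R1 (r : lrow 'I_n) := unitrow (fun i => if i is inl j then r.1 j else 0) r.2.
pose R2 (k : 'I_n) := unitrow (fun i => match i with inl j => - (j == k)%:Z
   | inr (inl j) => (j == k)%:Z | _ => 0 end) 0.
pose R3 := unitrow (fun i => match i with inl j => (j == k0)%:Z | inr (inl _) => 0 | inr (inr _) => -1 end) 0.
pose L := R3 :: [seq R1 r | r <- P] ++ [seq R2 k | k <- enum K].
pose comb (p x : 'I_n -> R) (s : R) (i : I) := match i with inl j => p j | inr (inl j) => x j | inr (inr _) => s end.
have sumI (f : I -> R) : \sum_i f i = \sum_j f (inl j) + (\sum_j f (inr (inl j)) + f (inr (inr tt))).
  by rewrite !big_sumType /= (big_pred1 tt) => [|[]].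
have sumZ (f : I -> int) : \sum_i f i = \sum_j f (inl j) + (\sum_j f (inr (inl j)) + f (inr (inr tt))).
  by rewrite !big_sumType /= (big_pred1 tt) => [|[]].
have delta (A : pzRingType) k (F : 'I_n -> A) : \sum_j (j == k)%:R * F j = F k.
  rewrite (bigD1 k) //= eqxx mul1r big1 ?addr0 // => j /negPf ->; exact: mul0r.
have sat1 r p x s : rsat (R1 r) (comb p x s) <-> rsat r p.
  rewrite /rsat sumI [X in _ + (X + _)]big1 => [|j _]; last by rewrite ffunE /= mul0r.
  rewrite [(R1 r).1 _]ffunE /= mul0r !addr0.
  by rewrite (eq_bigr (fun j => (r.1 j)%:~R * p j)) // => j _; rewrite ffunE.
have sat2 k p x s : rsat (R2 k) (comb p x s) <-> p k <= x k.
  rewrite /rsat sumI [(R2 k).1 (inr (inr tt))]ffunE /= mul0r addr0.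
  rewrite (eq_bigr (fun j => - ((j == k)%:R * p j))); last first.
    by move=> j _; rewrite ffunE rmorphN /= mulNr -pmulrn.
  rewrite [X in _ + X](eq_bigr (fun j => (j == k)%:R * x j)); last by move=> j _; rewrite ffunE /= -pmulrn.
  by rewrite sumrN !delta addrC subr_ge0.
have sat3 p x s : rsat R3 (comb p x s) <-> s <= p k0.
  rewrite /rsat sumI [X in _ + (X + _)]big1 => [|j _]; last by rewrite ffunE /= mul0r.
  rewrite [R3.1 (inr (inr tt))]ffunE /= add0r.
  rewrite (eq_bigr (fun j => (j == k0)%:R * p j)); last by move=> j _; rewrite ffunE /= -pmulrn.
  by rewrite delta mulN1r subr_ge0.
have satL p x s : (forall r, r \in L -> rsat r (comb p x s)) <->
    [/\ forall r, r \in P -> rsat r p, forall i, i \in K -> p i <= x i & s <= p k0].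
  split=> [H|[h1 h2 h3] r].
    split.
    - by move=> r rP; apply/(sat1 r p x s)/H; rewrite inE mem_cat map_f ?orbT.
    - by move=> i iK; apply/(sat2 i p x s)/H; rewrite inE mem_cat (map_f R2) ?orbT // mem_enum.
    - by apply/(sat3 p x s)/H; rewrite mem_head.
  rewrite inE mem_cat => /orP[/eqP ->|/orP[/mapP[r' rP ->]|/mapP[k]]]; first exact/sat3.
    by apply/sat1; exact: h1.
  by rewrite mem_enum => kK ->; apply/sat2; exact: h2.
have [L' [z' q' s']] := fourier_motzkin [seq inl j | j <- enum 'I_n] L.
have zL r j : r \in L' -> r.1 (inl j) = 0.
  by move=> rL; apply: z' => //; apply: map_f; rewrite mem_enum.
(* Nonnegative coefficients on [x], support of [x] in [K] and coefficient sum 0 hold for the initial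
   rows and are conic. As the coefficients of [p] are now 0, that of [s] is minus the sum of those
   of [x]. *)
have posL r j : r \in L' -> 0 <= r.1 (inr (inl j)).
  apply: (q' (fun r => 0 <= r.1 (inr (inl j)))) => [a b r1 r2 h1 h2|r'].
    by rewrite ffunE addr_ge0 // mulr_ge0.
  rewrite inE mem_cat => /orP[/eqP ->|/orP[/mapP[r'' rP ->]|/mapP[k _ ->]]]; by rewrite ffunE.
have offL r j : j \notin K -> r \in L' -> r.1 (inr (inl j)) = 0.
  move=> jK; apply: (q' (fun r => r.1 (inr (inl j)) = 0)) => [a b r1 r2 h1 h2|r'].
    by rewrite ffunE h1 h2 !mulr0 addr0.
  rewrite inE mem_cat => /orP[/eqP ->|/orP[/mapP[r'' rP ->]|/mapP[k]]]; rewrite ?mem_enum => *.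
  - by rewrite ffunE.
  - by rewrite ffunE.
  - by subst; rewrite ffunE; case: eqP => // E; subst; move/negP: jK.
have sum0 r : r \in L' -> \sum_i r.1 i = 0.
  apply: (q' (fun r => \sum_i r.1 i = 0)) => [a b r1 r2 h1 h2|r'].
    by under eq_bigr do rewrite ffunE; rewrite big_split /= -!mulr_sumr h1 h2 !mulr0 addr0.
  have deltaZ k : \sum_(j < n) (j == k)%:Z = 1.
    by have := delta int k (fun _ => 1); under eq_bigr do rewrite mulr1 natz.
  rewrite inE mem_cat sumZ => /orP[/eqP ->|/orP[/mapP[r'' rP ->]|/mapP[k _ ->]]].
  - rewrite [X in _ + (X + _)]big1 => [|j _]; last by rewrite ffunE.
    by rewrite (eq_bigr (fun j => (j == k0)%:Z)) ?deltaZ ?ffunE // => j _; rewrite ffunE.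
  - rewrite [X in _ + (X + _)]big1 => [|j _]; last by rewrite ffunE.
    by rewrite (eq_bigr (fun j => r''.1 j)) ?P0 ?ffunE // => j _; rewrite ffunE.
  - rewrite (eq_bigr (fun j => - (j == k)%:Z)); last by move=> j _; rewrite ffunE.
    rewrite [X in _ + (X + _)](eq_bigr (fun j => (j == k)%:Z)); last by move=> j _; rewrite ffunE.
    by rewrite sumrN deltaZ ffunE.
pose nrow (r : lrow I) : {ffun 'I_n -> nat} * R := ([ffun j => `|r.1 (inr (inl j))|%N], r.2).
have nE r j : r \in L' -> ((nrow r).1 j)%:Z = r.1 (inr (inl j)).
  by move=> rL; rewrite ffunE abszE ger0_norm // posL.
have nS r : r \in L' -> (\sum_j (nrow r).1 j)%N%:Z = - r.1 (inr (inr tt)).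
  move=> rL; have := sum0 r rL; rewrite sumZ big1 => [|j _]; last exact: zL.
  rewrite add0r => /eqP; rewrite addr_eq0 => /eqP <-.
  rewrite -[LHS]natz natr_sum; apply: eq_bigr => j _; by rewrite natz nE.
have satN r p x s : r \in L' -> rsat r (comb p x s) <->
    (\sum_i (nrow r).1 i)%:R * s + r.2 <= \sum_i ((nrow r).1 i)%:R * x i.
  move=> rL; rewrite /rsat sumI big1 => [|j _]; last by rewrite zL // mul0r.
  rewrite add0r /=.
  have -> : \sum_i (r.1 (inr (inl i)))%:~R * x i = \sum_i ((nrow r).1 i)%:R * x i.
    by apply: eq_bigr => j _; rewrite -nE // -pmulrn.
  have -> : (r.1 (inr (inr tt)))%:~R = - (\sum_i (nrow r).1 i)%:R :> R.
    by rewrite -[r.1 _]opprK -nS // rmorphN /= -pmulrn.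
  by split; lra.
exists [seq nrow r | r <- [seq r <- L' | (0 < \sum_i (nrow r).1 i)%N]]; split.
  move=> _ /mapP[r + ->]; rewrite mem_filter => /andP[r0 rL]; split=> // i iK.
  by rewrite ffunE offL.
move=> x s.
have -> : (exists p, [/\ forall r, r \in P -> rsat r p, forall i, i \in K -> p i <= x i & s <= p k0]) <->
    forall r, r \in L' -> rsat r (comb p0 x s).
  rewrite s'; split.
    move=> [p /satL Hp]; exists (comb p x s) => // -[j|[j|[]]] //.
    by rewrite map_f // mem_enum.
  move=> [y E H]; exists (fun j => y (inl j)); apply/satL => r /H.
  rewrite (_ : y = comb (fun j => y (inl j)) x s) //; apply: funext => -[j|[j|[]]] //=; rewrite E //;
    by apply/mapP => -[].
split=> H.
  move=> _ /mapP[r + ->]; rewrite mem_filter => /andP[_ rL]; apply/satN => //; exact: H.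
move=> r rL; have [c0|c0] := ltnP 0 (\sum_i (nrow r).1 i)%N.
  by apply/satN => //; apply: (H (nrow r)); apply: map_f; rewrite mem_filter c0.
have {}c0 : (\sum_i (nrow r).1 i)%N = 0%N by apply/eqP; rewrite -leqn0.
(* a row without [s] is a constant, and it is satisfied by the point of [P] *)
have Z : \sum_i ((nrow r).1 i)%:R * x i = \sum_i ((nrow r).1 i)%:R * p0 i.
  move/eqP: c0; rewrite sum_nat_eq0 => /forallP h; apply: eq_bigr => i _.
  by have /implyP/(_ isT)/eqP -> := h i; rewrite !mul0r.
have : forall r, r \in L' -> rsat r (comb p0 p0 (p0 k0)).
  apply/s'; exists (comb p0 p0 (p0 k0)) => //; apply/satL; split=> //.
by move=> /(_ r rL) /(satN r _ _ _ rL) h; apply/satN => //; rewrite Z; move: h; rewrite c0 !mul0r.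
Qed.

(** * Projections of tropical Metzler spectrahedra *)

Definition tterms (V : Type) := seq (R * option V).
Definition tvar (V : Type) (x : V -> Trop) (o : option V) : Trop := if o is Some v then x v else Some 0.
Definition teval (V : Type) (x : V -> Trop) (L : tterms V) : Trop :=
  foldr (fun c acc => tmax (tplus (Some c.1) (tvar x c.2)) acc) None L.

(* [((L1, L2), L3)] stands for the 2x2 Metzler constraint [L1 + L2 >= 2 L3] *)
Definition tcon (V : Type) := (tterms V * tterms V * tterms V)%type.
Definition tholds (V : Type) (x : V -> Trop) (c : tcon V) :=
  tle (tplus (teval x c.2) (teval x c.2)) (tplus (teval x c.1.1) (teval x c.1.2)).

Definition tmap (V W : Type) (s : V -> W) (L : tterms V) : tterms W := [seq (c.1, omap s c.2) | c <- L].
Definition cmap (V W : Type) (s : V -> W) (c : tcon V) : tcon W := (tmap s c.1.1, tmap s c.1.2, tmap s c.2).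

Lemma teval_tmap V W (s : V -> W) (x : W -> Trop) L : teval x (tmap s L) = teval (fun v => x (s v)) L.
Proof. by elim: L => [|[a [v|]] L IH] //=; rewrite IH. Qed.

Lemma tholds_cmap V W (s : V -> W) (x : W -> Trop) c : tholds x (cmap s c) = tholds (fun v => x (s v)) c.
Proof. by rewrite /tholds /= !teval_tmap. Qed.

Definition scat (I J : Type) (x : I -> Trop) (w : J -> Trop) (k : I + J) : Trop :=
  match k with inl i => x i | inr j => w j end.

Definition treal (V : Type) (x : V -> Trop) := forall v, x v <> None.

Definition holds_all (V : finType) (x : V -> Trop) (C : seq (tcon V)) := forall c, c \in C -> tholds x c.

Lemma holds_all_cat (V : finType) (x : V -> Trop) C C' :
  holds_all x (C ++ C') <-> holds_all x C /\ holds_all x C'.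
Proof.
split=> [h|[h h'] c]; last by rewrite mem_cat => /orP[]; [exact: h|exact: h'].
by split=> c hc; apply: h; rewrite mem_cat hc ?orbT.
Qed.

Lemma holds_all_map (V W : finType) (s : V -> W) (x : W -> Trop) C :
  holds_all x [seq cmap s c | c <- C] <-> holds_all (fun v => x (s v)) C.
Proof.
split=> [h c hc|h _ /mapP[c hc ->]]; last by rewrite tholds_cmap; exact: h.
by rewrite -tholds_cmap; apply: h; exact: map_f.
Qed.

Definition represents (I J : finType) (C : seq (tcon (I + J))) (X : (I -> Trop) -> Prop) :=
  (forall x w, holds_all (scat x w) C -> X x) /\
  (forall x, X x -> exists w, holds_all (scat x w) C /\ (treal x -> treal w)).

(* Projections of tropical Metzler spectrahedra; moreover the auxiliary variables can be chosen
   finite above a finite point. *)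
Definition rep (I : finType) (X : (I -> Trop) -> Prop) :=
  exists (J : finType) (C : seq (tcon (I + J))), represents C X.

Lemma rep_ext (I : finType) (X Y : (I -> Trop) -> Prop) : (forall x, X x <-> Y x) -> rep X -> rep Y.
Proof.
move=> XY [J [C [h1 h2]]]; exists J, C; split=> [x w /h1 /XY //|x /XY]; exact: h2.
Qed.

Lemma rep_con (I : finType) (c : tcon I) : rep (fun x => tholds x c).
Proof.
exists 'I_0, [seq cmap inl c | c <- [:: c]]; split=> [x w /holds_all_map/(_ c (mem_head _ _)) //|x h].
exists (fun _ => None); split; last by move=> _ [].
by apply/holds_all_map => c'; rewrite inE => /eqP ->.
Qed.

Lemma rep_True (I : finType) : rep (fun _ : I -> Trop => True).
Proof. by apply: rep_ext (rep_con ([::], [::], [::])). Qed.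

Lemma rep_and (I : finType) (X Y : (I -> Trop) -> Prop) : rep X -> rep Y -> rep (fun x => X x /\ Y x).
Proof.
move=> [J [C [h1 h2]]] [J' [C' [h1' h2']]].
pose f (k : I + J) : I + (J + J') := match k with inl i => inl i | inr j => inr (inl j) end.
pose f' (k : I + J') : I + (J + J') := match k with inl i => inl i | inr j => inr (inr j) end.
have Ef x (w : J + J' -> Trop) : (fun v => scat x w (f v)) = scat x (fun j => w (inl j)).
  by apply: funext => -[].
have Ef' x (w : J + J' -> Trop) : (fun v => scat x w (f' v)) = scat x (fun j => w (inr j)).
  by apply: funext => -[].
exists (J + J')%type, ([seq cmap f c | c <- C] ++ [seq cmap f' c | c <- C']); split.
  by move=> x w /holds_all_cat[]; rewrite !holds_all_map Ef Ef' => /h1 ? /h1'.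
move=> x [/h2[w [Hw rw]] /h2'[w' [Hw' rw']]]; exists (scat w w'); split.
  by apply/holds_all_cat; rewrite !holds_all_map Ef Ef'.
by move=> rx [j|j]; [exact: rw|exact: rw'].
Qed.

Lemma rep_all (I : finType) (A : eqType) (s : seq A) (X : A -> (I -> Trop) -> Prop) :
  (forall a, a \in s -> rep (X a)) -> rep (fun x => forall a, a \in s -> X a x).
Proof.
elim: s => [|a s IH] H; first by apply: rep_ext (rep_True I).
apply: rep_ext (rep_and (H a (mem_head _ _)) (IH _)) => [x|b bs]; last by apply: H; rewrite inE bs orbT.
split=> [[h1 h2] b|h]; first by rewrite inE => /orP[/eqP ->|/h2].
by split=> [|b bs]; apply: h; rewrite inE ?eqxx ?bs ?orbT.
Qed.

Lemma rep_comp (I I' : finType) (s : I -> I') (X : (I -> Trop) -> Prop) :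
  rep X -> rep (fun x => X (fun i => x (s i))).
Proof.
move=> [J [C [h1 h2]]].
pose f (k : I + J) : I' + J := match k with inl i => inl (s i) | inr j => inr j end.
have Ef x (w : J -> Trop) : (fun v => scat x w (f v)) = scat (fun i => x (s i)) w.
  by apply: funext => -[].
exists J, [seq cmap f c | c <- C]; split=> [x w|x]; first by rewrite holds_all_map Ef => /h1.
move=> /h2[w [Hw rw]]; exists w; rewrite holds_all_map Ef; split=> // rx; apply: rw => i; exact: rx.
Qed.

(** The extra hypothesis provides the finiteness clause of [rep] for the variables that are
    projected out. *)
Lemma rep_exists (I K : finType) (Z : (I + K -> Trop) -> Prop) : rep Z ->
  (forall x, treal x -> (exists v, Z (scat x v)) -> exists2 v, treal v & Z (scat x v)) ->
  rep (fun x => exists v, Z (scat x v)).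
Proof.
move=> [J [C [h1 h2]]] Hr.
pose f (k : (I + K) + J) : I + (K + J) :=
  match k with inl (inl i) => inl i | inl (inr k) => inr (inl k) | inr j => inr (inr j) end.
have Ef x (w : K + J -> Trop) : (fun v => scat x w (f v)) = scat (scat x (fun k => w (inl k))) (fun j => w (inr j)).
  by apply: funext => -[[]|].
exists (K + J)%type, [seq cmap f c | c <- C]; split=> x.
  by move=> w; rewrite holds_all_map Ef => /h1; exists (fun k => w (inl k)).
have [rx|nrx] := pselect (treal x).
  move=> /(Hr x rx)[v rv /h2[w [Hw rw]]]; exists (scat v w); rewrite holds_all_map Ef; split=> //.
  move=> _ [k|j] /=; first exact: rv.
  by apply: rw => -[i|k]; [exact: rx|exact: rv].
by move=> [v /h2[w [Hw rw]]]; exists (scat v w); rewrite holds_all_map Ef; split.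
Qed.

(** The value 0 at [-oo] is a default; statements pair [rv] with finiteness conditions. *)
Definition rv (a : Trop) : R := odflt 0 a.

Lemma Some_neq_None (s : R) : Some s <> None :> Trop.
Proof. by []. Qed.

(* Binary averaging: a tree of constraints [2 w <= v1 + v2]. *)
Lemma rep_average_pow2 (I : finType) k (l : seq I) (w : I) : size l = (2 ^ k)%N ->
  rep (fun x => x w <> None -> (forall i, i \in l -> x i <> None) /\
    (2 ^ k)%:R * rv (x w) <= \sum_(i <- l) rv (x i)).
Proof.
elim: k I l w => [|k IH] I l w sl.
  case: l sl => [|a [|]] // _.
  apply: rep_ext (rep_con ([:: (0, Some a)], [:: (0, Some a)], [:: (0, Some w)])) => x.
  rewrite /tholds /= big_seq1 mul1r.
  case Ew : (x w) => [s|] /=; last by split.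
  case Ea : (x a) => [t|] /=; last first.
    by split=> // /(_ (@Some_neq_None _))[/(_ a)]; rewrite mem_head Ea => /(_ isT).
  split=> [/RleP h|]; last by move=> /(_ (@Some_neq_None _))[_ h]; apply/RleP; rewrite !RplusE; lra.
  move=> _; split; first by move=> i; rewrite inE => /eqP ->; rewrite Ea.
  by rewrite !RplusE in h; lra.
pose l1 := take (2 ^ k) l; pose l2 := drop (2 ^ k) l.
have s1 : size l1 = (2 ^ k)%N by rewrite size_takel // sl expnS mul2n -addnn leq_addr.
have s2 : size l2 = (2 ^ k)%N by rewrite size_drop sl expnS mul2n -addnn addnK.
have El : l = l1 ++ l2 by rewrite cat_take_drop.
pose up i : I + 'I_2 := inl i.
have r1 := IH _ [seq up i | i <- l1] (inr ord0) (etrans (size_map _ _) s1).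
have r2 := IH _ [seq up i | i <- l2] (inr ord_max) (etrans (size_map _ _) s2).
have r3 := rep_con ([:: (0, Some (inr ord0 : I + 'I_2))], [:: (0, Some (inr ord_max : I + 'I_2))], [:: (0, Some (inl w : I + 'I_2))]).
have pk : (0 : R) < (2 ^ k)%:R by rewrite ltr0n expn_gt0.
have E2 : (2 ^ k.+1)%:R = 2 * (2 ^ k)%:R :> R by rewrite expnS natrM.
have mk (x : I -> Trop) : (x w <> None -> (forall i, i \in l -> x i <> None) /\
    (2 ^ k.+1)%:R * rv (x w) <= \sum_(i <- l) rv (x i)) -> x w <> None ->
    let v (j : 'I_2) := Some ((\sum_(i <- if j == ord0 then l1 else l2) rv (x i)) / (2 ^ k)%:R) in
    tholds (scat x v) ([:: (0, Some (inr ord0))], [:: (0, Some (inr ord_max))], [:: (0, Some (inl w))]).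
  move=> H xw v; have [_] := H xw; rewrite E2 El big_cat /tholds /=.
  case: (x w) xw => [s|] //= _ h; apply/RleP; rewrite !RplusE !add0r -mulrDl ler_pdivlMr //; lra.
apply: rep_ext (rep_exists (rep_and r3 (rep_and r1 r2)) _) => x.
  split.
    move=> [v [h3 [h1 h2]]] xw; rewrite !big_map /= in h1 h2.
    move: h3; rewrite /tholds /=; case Ew : (x w) xw => [s|] //= _.
    case E0 : (v ord0) h1 => [a|] //= h1; case E1 : (v ord_max) h2 => [b|] //= h2 /RleP h3.
    have [{}h1 h1'] := h1 (@Some_neq_None _); have [{}h2 h2'] := h2 (@Some_neq_None _).
    split=> [i|].
      by rewrite El mem_cat => /orP[il|il]; [apply: (h1 (up i))|apply: (h2 (up i))]; exact: map_f.
    by rewrite E2 El big_cat /=; rewrite !RplusE in h3; nra.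
  (* If [x w] is [-oo], the two intermediate variables are [-oo] as well and nothing is asked of the
     leaves; otherwise they are the means over the two halves of [l]. *)
  move=> H; have [xw|xw] := pselect (x w = None).
    exists (fun _ => None); split; last by split.
    by rewrite /tholds /= xw.
  exists (fun j : 'I_2 => Some ((\sum_(i <- if j == ord0 then l1 else l2) rv (x i)) / (2 ^ k)%:R)).
  split; first exact: mk.
  have [Hl _] := H xw.
  split=> _; (split; [move=> _ /mapP[i il ->]; apply: Hl; rewrite El mem_cat il ?orbT //|
    rewrite big_map /= mulrC divfK // gt_eqF //]).
move=> rx [v [h3 [h1 h2]]].
exists (fun j : 'I_2 => Some ((\sum_(i <- if j == ord0 then l1 else l2) rv (x i)) / (2 ^ k)%:R)) => //.
split; last first.
  split=> _; (split; [by move=> _ /mapP[i il ->]; apply: rx|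
    rewrite big_map /= mulrC divfK // gt_eqF //]).
apply: mk; last exact: rx.
rewrite !big_map /= in h1 h2.
move: h3; rewrite /tholds /=; case Ew : (x w) => [s|] //=.
case E0 : (v ord0) h1 => [a|] //= h1; case E1 : (v ord_max) h2 => [b|] //= h2 /RleP h3 _.
have [{}h1 h1'] := h1 (@Some_neq_None _); have [{}h2 h2'] := h2 (@Some_neq_None _).
split=> [i _|]; first exact: rx.
by rewrite E2 El big_cat /=; rewrite !RplusE in h3; nra.
Qed.

(* Padding the average with copies of [w] itself makes the number of terms a power of 2. *)
Lemma rep_average (I : finType) (l : seq I) (w : I) :
  rep (fun x => x w <> None -> (forall i, i \in l -> x i <> None) /\
    (size l)%:R * rv (x w) <= \sum_(i <- l) rv (x i)).
Proof.
have [k Hk] : exists k, (size l <= 2 ^ k)%N by exists (size l); apply: ltnW; exact: ltn_expl.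
pose l' := l ++ nseq (2 ^ k - size l) w.
have sl : size l' = (2 ^ k)%N by rewrite size_cat size_nseq subnKC.
apply: rep_ext (rep_average_pow2 w sl) => x.
have E : \sum_(i <- l') rv (x i) = \sum_(i <- l) rv (x i) + ((2 ^ k)%:R - (size l)%:R) * rv (x w).
  rewrite big_cat big_nseq /= -natrB // mulr_natl; congr (_ + _).
  by elim: (_ - _)%N => [|j IHj] //=; rewrite mulrS IHj.
split=> H xw; have [h1 h2] := H xw.
  split; first by move=> i il; apply: h1; rewrite mem_cat il.
  by move: h2; rewrite E; lra.
split; last by rewrite E; lra.
by move=> i; rewrite mem_cat => /orP[/h1 //|]; rewrite mem_nseq => /andP[_ /eqP ->].
Qed.

(** * Tropical order and coefficients of tropical linear forms *)

Lemma tle_refl a : tle a a.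
Proof. by case: a => [a|] //=; exact: Rle_refl. Qed.

Lemma tle_trans a b c : tle a b -> tle b c -> tle a c.
Proof. by case: a b c => [a|] [b|] [c|] //=; exact: Rle_trans. Qed.

Lemma tle_anti a b : tle a b -> tle b a -> a = b.
Proof. by case: a b => [a|] [b|] //= h1 h2; congr Some; exact: Rle_antisym. Qed.

Lemma tle_tmax a b c : tle (tmax a b) c <-> tle a c /\ tle b c.
Proof.
case: a b c => [a|] [b|] [c|] //=; try tauto.
rewrite RmaxE; split=> [/RleP|[/RleP h1 /RleP h2]].
  by rewrite ge_max => /andP[/RleP h1 /RleP h2].
by apply/RleP; rewrite ge_max h1.
Qed.

Lemma eq_tle a b : (forall c, tle a c <-> tle b c) -> a = b.
Proof. by move=> H; apply: tle_anti; apply/H; exact: tle_refl. Qed.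

Lemma teval_le (V : eqType) (x : V -> Trop) L c :
  tle (teval x L) c <-> forall t, t \in L -> tle (tplus (Some t.1) (tvar x t.2)) c.
Proof.
elim: L => [|a L IH] //; rewrite /= tle_tmax IH; split.
  by move=> [h1 h2] t; rewrite inE => /orP[/eqP ->|/h2].
by move=> h; split=> [|t tL]; apply: h; rewrite inE ?eqxx ?tL ?orbT.
Qed.

Lemma tbigmax_le N (p : 'I_N.+1 -> bool) F c :
  tle (tbigmax p F) c <-> forall k, p k -> tle (F k) c.
Proof.
suff H (s : seq 'I_N.+1) :
    tle (List.fold_right (fun k acc => if p k then tmax (F k) acc else acc) None s) c <->
    forall k, k \in s -> p k -> tle (F k) c.
  by rewrite H; split=> h k *; apply: h => //; rewrite mem_enum.
elim: s => [|a s IH] //=; split.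
  move=> h k; rewrite inE => /orP[/eqP ->|ks pk]; move: h; case: ifP => // _.
    by rewrite tle_tmax => -[].
  - by rewrite tle_tmax IH => -[_]; apply.
  - by rewrite IH; apply.
move=> h; have h' : forall k, k \in s -> p k -> tle (F k) c.
  by move=> k ks; apply: h; rewrite inE ks orbT.
case: ifP => pa; last exact/IH.
by apply/tle_tmax; split; [apply: h => //; rewrite mem_head|exact/IH].
Qed.

(** A variable may occur several times in a list of terms; a matrix entry records the largest of its
    coefficients. *)
Definition tcoef (V : eqType) (L : tterms V) (o : option V) : Trop :=
  foldr (fun c acc => if c.2 == o then tmax (Some c.1) acc else acc) None L.

Lemma tplus_tmax a b c : tplus (tmax a b) c = tmax (tplus a c) (tplus b c).
Proof.
case: a b c => [a|] [b|] [c|] //=; rewrite ?RmaxE ?RplusE; congr Some.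
by rewrite addr_maxl.
Qed.

Lemma tcoef_cons (V : eqType) a (L : tterms V) o :
  tcoef (a :: L) o = if a.2 == o then tmax (Some a.1) (tcoef L o) else tcoef L o.
Proof. by []. Qed.

Lemma tcoef_le (V : eqType) (L : tterms V) o t c :
  tle (tplus (tcoef L o) t) c <-> forall u, u \in L -> u.2 = o -> tle (tplus (Some u.1) t) c.
Proof.
elim: L => [|a L IH]; first by split.
rewrite tcoef_cons; split.
  move=> h u; rewrite inE => /orP[/eqP -> E|uL Eu]; move: h.
    by rewrite E eqxx tplus_tmax tle_tmax => -[].
  by case: ifP => _; [rewrite tplus_tmax tle_tmax IH => -[_]|rewrite IH]; apply.
move=> h; have h' : forall u, u \in L -> u.2 = o -> tle (tplus (Some u.1) t) c.
  by move=> u uL; apply: h; rewrite inE uL orbT.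
case: eqP => E; last exact/IH.
by rewrite tplus_tmax; apply/tle_tmax; split; [apply: h => //; rewrite mem_head|exact/IH].
Qed.

(** * Metzler matrices of a system of constraints *)

Section Matrices.
Variables (n : nat) (J : finType) (C : seq (tcon ('I_n + J))).
Local Notation V := ('I_n + J)%type.
Local Notation N := (n + #|J|)%N.
Local Notation c0 := ([::], [::], [::]).

Definition vpos (v : V) : 'I_N := match v with inl i => lshift _ i | inr j => rshift n (enum_rank j) end.
Definition vkey (k : 'I_N.+1) : option V :=
  if unlift ord0 k is Some j then Some (match split j with inl i => inl i | inr j => inr (enum_val j) end)
  else None.
Definition kpos_of (o : option V) : 'I_N.+1 := if o is Some v then lift ord0 (vpos v) else ord0.

Lemma kpos_ofK o : vkey (kpos_of o) = o.
Proof.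
case: o => [v|]; last by rewrite /vkey unlift_none.
rewrite /vkey liftK; congr Some; case: v => [i|j] /=.
  by rewrite (unsplitK (inl i : 'I_n + 'I_#|J|)).
by rewrite (unsplitK (inr (enum_rank j) : 'I_n + 'I_#|J|)) enum_rankK.
Qed.

Lemma vkeyK k : kpos_of (vkey k) = k.
Proof.
rewrite /vkey; case: unliftP => [j ->|-> //] /=; congr lift; apply: val_inj => /=.
by case: splitP => i -> //=; rewrite enum_valK.
Qed.

Lemma xext_vkey (w : 'I_N -> Trop) k : xext w k = tvar (fun v => w (vpos v)) (vkey k).
Proof.
rewrite -{1}(vkeyK k); case: (vkey k) => [v|] /=; last by rewrite /xext unlift_none.
by rewrite /xext liftK.
Qed.

Local Notation idx := ('I_(size C) * bool)%type.
Definition spos (a : Trop) := if a is Some r then SPos r else SZero.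
Definition sneg (a : Trop) := if a is Some r then SNeg r else SZero.

(* The constraint [L1 + L2 >= 2 L3] of index [c] occupies the rows [(c, true)] and [(c, false)]. *)
Definition tmatrix (k : 'I_N.+1) : smatrix #|{: idx}| := fun i j =>
  let a := enum_val i in let b := enum_val j in
  let c := nth c0 C a.1 in
  if i == j then spos (tcoef (if a.2 then c.1.1 else c.1.2) (vkey k))
  else if a.1 == b.1 then sneg (tcoef c.2 (vkey k)) else SZero.

Lemma tmatrix_metzler : metzler_family tmatrix.
Proof.
move=> k; split=> [i j|i j /eqP ij].
  rewrite /tmatrix eq_sym; case: eqP => [-> //|_].
  by rewrite eq_sym; case: eqP => // ->.
rewrite /tmatrix (negPf ij); case: ifP => _; last by right.
by case: (tcoef _ _) => [r|]; [left|right].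
Qed.

Lemma tform_teval p (q : 'I_N.+1 -> stnum) (w : 'I_N -> Trop) (L : tterms V) :
  (forall k, (if p k then smod (q k) else None) = tcoef L (vkey k)) ->
  tform p q w = teval (fun v => w (vpos v)) L.
Proof.
move=> H; apply: eq_tle => B; rewrite /tform tbigmax_le teval_le; split.
  move=> h t tL.
  have : tle (tplus (tcoef L t.2) (tvar (fun v => w (vpos v)) t.2)) B.
    rewrite -(kpos_ofK t.2) -H -xext_vkey; case: ifP => pk //; exact: h.
  by move/tcoef_le; apply.
move=> h k pk; have := H k; rewrite pk => ->; rewrite xext_vkey.
by apply/tcoef_le => u uL <-; exact: h.
Qed.

(** No diagonal entry is negative, so that the diagonal conditions are void, and an off-diagonal
    entry is nonzero only between the two rows of one constraint. *)
Lemma tmatrix_spec w : metzler_spec tmatrix w <->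
  holds_all (fun v => w (vpos v)) C.
Proof.
pose L1 (i : 'I_#|{: idx}|) := let a := enum_val i in let c := nth c0 C a.1 in if a.2 then c.1.1 else c.1.2.
have Hp i : Qplus_ii tmatrix w i = teval (fun v => w (vpos v)) (L1 i).
  apply: tform_teval => k; rewrite /tmatrix eqxx -/(L1 i).
  by case: (tcoef _ _).
have Hm i : Qminus_ii tmatrix w i = None.
  apply: tle_anti => //; apply/tbigmax_le => k; rewrite /tmatrix eqxx.
  by case: (tcoef _ _).
have Ho i j : i <> j -> Q_ij tmatrix w i j =
    if (enum_val i).1 == (enum_val j).1 then teval (fun v => w (vpos v)) (nth c0 C (enum_val i).1).2 else None.
  move=> /eqP ij; case: ifP => E.
    by apply: (@tform_teval (fun _ => true) (fun k => tmatrix k i j)) => k; rewrite /tmatrix (negPf ij) E; case: (tcoef _ _).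
  by apply: tle_anti => //; apply/tbigmax_le => k _; rewrite /tmatrix (negPf ij) E.
split.
  move=> [_ H] c cC; have iC : (index c C < size C)%N by rewrite index_mem.
  pose a b : 'I_#|{: idx}| := enum_rank (Ordinal iC, b).
  have ab : a true <> a false by move=> /enum_rank_inj.
  by have := H _ _ ab; rewrite !Hp (Ho _ _ ab) /L1 !enum_rankK /= eqxx nth_index.
move=> H; split=> [i|i j ij]; first by rewrite Hm.
rewrite !Hp (Ho _ _ ij); case: eqP => // E.
have := H _ (mem_nth c0 (ltn_ord (enum_val i).1)); rewrite /tholds /L1 -E.
have : (enum_val i).2 != (enum_val j).2.
  apply: contra_notN ij => /eqP E2; apply: enum_val_inj.
  by rewrite [LHS]surjective_pairing [RHS]surjective_pairing E E2.
case: (enum_val i).2; case: (enum_val j).2 => //= _ h.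
by rewrite [tplus (teval _ _.1.2) _](_ : _ = tplus (teval (fun v => w (vpos v)) (nth c0 C (enum_val i).1).1.1)
  (teval (fun v => w (vpos v)) (nth c0 C (enum_val i).1).1.2)) //; case: (teval _ _) (teval _ _) => [u|] [v|] //=; rewrite !RplusE addrC.
Qed.

Lemma scat_vpos (w : 'I_N -> Trop) :
  (fun v => w (vpos v)) = scat (fun i => w (lshift _ i)) (fun j => w (rshift n (enum_rank j))).
Proof. by apply: funext => -[]. Qed.

Lemma vpos_lift (x : 'I_n -> Trop) (u : J -> Trop) : exists w : 'I_N -> Trop,
  (fun v => w (vpos v)) = scat x u.
Proof.
exists (fun k => match split k with inl i => x i | inr j => u (enum_val j) end).
apply: funext => -[i|j] /=.
  by rewrite (unsplitK (inl i : 'I_n + 'I_#|J|)).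
by rewrite (unsplitK (inr (enum_rank j) : 'I_n + 'I_#|J|)) enum_rankK.
Qed.
End Matrices.

Lemma rep_metzler n (X : ('I_n -> Trop) -> Prop) : rep X ->
  exists (n' m : nat) (Qs : 'I_(n + n').+1 -> smatrix m), metzler_family Qs /\
    forall y, X y <-> exists w, metzler_spec Qs w /\ forall i, w (lshift n' i) = y i.
Proof.
move=> [J [C [h1 h2]]]; exists #|J|, _, (@tmatrix _ _ C); split; first exact: tmatrix_metzler.
move=> y; split.
  move=> /h2[u [Hu _]]; have [w Ew] := vpos_lift y u; exists w; split.
    by apply/tmatrix_spec; rewrite Ew.
  by move=> i; have := congr1 (fun f => f (inl i)) Ew.
move=> [w [/tmatrix_spec Hw Ey]]; apply: (h1 y (fun j => w (rshift n (enum_rank j)))).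
by move: Hw; rewrite scat_vpos (_ : (fun i => w (lshift _ i)) = y) //; exact: funext.
Qed.

(* The constraint [2 * 0 <= x_v + u_v] on a fresh variable [u_v] forces [x_v] to be finite. *)
Lemma rep_real_metzler n (X : ('I_n -> Trop) -> Prop) : rep X ->
  exists (n' m : nat) (Qs : 'I_(n + n').+1 -> smatrix m), metzler_family Qs /\
    (forall w, metzler_spec Qs w -> forall k, w k <> None) /\
    forall z : 'I_n -> R, X (fun i => Some (z i)) <->
      exists w, metzler_spec Qs w /\ forall j, w (lshift n' j) = Some (z j).
Proof.
move=> [J [C [h1 h2]]]; pose V := ('I_n + J)%type; pose J' := (J + V)%type.
pose up (v : V) : 'I_n + J' := match v with inl i => inl i | inr j => inr (inl j) end.
pose rc (v : V) : tcon ('I_n + J') := ([:: (0, Some (up v))], [:: (0, Some (inr (inr v)))], [:: (0, None)]).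
pose C' := [seq cmap up c | c <- C] ++ [seq rc v | v <- enum {: V}].
have HC' x : holds_all x C' <-> holds_all (fun v => x (up v)) C /\ forall v, tholds x (rc v).
  rewrite holds_all_cat holds_all_map; split=> -[h h']; split=> //.
    by move=> v; apply: h'; rewrite map_f // mem_enum.
  by move=> _ /mapP[v _ ->].
have rcE x v : tholds x (rc v) -> x (up v) <> None /\ x (inr (inr v)) <> None.
  by rewrite /tholds /=; case: (x (up v)) (x (inr (inr v))) => [a|] [b|].
have upE x w : (fun v => scat x w (up v)) = scat x (fun j => w (inl j)) by apply: funext => -[].
exists #|{: J'}|, _, (@tmatrix _ _ C'); split; first exact: tmatrix_metzler.
split.
  move=> w /tmatrix_spec/HC'[_ H] k.
  have := vkeyK (lift ord0 k : 'I_(n + #|{: J'}|).+1); case: (vkey _) => [v|] /= E; last first.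
    by have /eqP := E; rewrite (negPf (neq_lift _ _)).
  have {E} -> : k = vpos v by apply: (@lift_inj _ ord0); rewrite E.
  case: v => [i|[j|v]].
  - exact: (rcE _ _ (H (inl i))).1.
  - exact: (rcE _ _ (H (inr j))).1.
  - exact: (rcE _ _ (H v)).2.
move=> z; split.
  move=> /h2[u [Hu ru]]; have {}ru : treal u by apply: ru.
  pose x := fun i => Some (z i) : Trop.
  (* The fresh variable attached to [v] takes the opposite value, which makes the constraint an
     equality. *)
  pose u' (j : J') : Trop := match j with inl j => u j | inr v => Some (- rv (scat x u v)) end.
  have [w Ew] := vpos_lift x u'; exists w; split.
    apply/tmatrix_spec; rewrite Ew; apply/HC'; split; first by rewrite upE.
    move=> v; rewrite /tholds /=.
    have -> : scat x u' (up v) = Some (rv (scat x u v)).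
      case: v => [i|j] //=; case E : (u j) => [a|] //; by have := ru j.
    by apply/RleP; rewrite !RplusE; lra.
  by move=> i; have := congr1 (fun f => f (inl i)) Ew.
move=> [w [/tmatrix_spec Hw Ey]]; rewrite scat_vpos in Hw; move/HC': Hw => [Hw _].
have Ex : (fun i => w (lshift _ i)) = (fun i => Some (z i)) by exact: funext.
apply: (h1 _ (fun j => w (rshift n (enum_rank (inl j : J'))))).
by move: Hw; rewrite upE Ex.
Qed.

(** * Tropical convex hulls of polyhedra *)

(** In [2 w <= x_i + u] the variable [u] is unrestricted: a finite [w] forces [x_i] to be finite and
    imposes nothing else. *)
Lemma rep_support (I : finType) (w i : I) : rep (fun x => x w <> None -> x i <> None).
Proof.
pose c : tcon (I + 'I_1) := ([:: (0, Some (inl i))], [:: (0, Some (inr ord0))], [:: (0, Some (inl w))]).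
apply: rep_ext (rep_exists (rep_con c) _) => x.
  split=> [[v]|H]; first by rewrite /tholds /=; case: (x w) (x i) => [s|] [t|].
  exists (fun _ => Some (2 * rv (x w) - rv (x i))); rewrite /tholds /=.
  case: (x w) H => [s|] //; case: (x i) => [t|] H; last by have := H (@Some_neq_None _).
  by apply/RleP; rewrite !RplusE /=; lra.
move=> rx _; exists (fun _ => Some (2 * rv (x w) - rv (x i))) => //.
have := rx w; have := rx i; rewrite /tholds /=; case: (x w) (x i) => [s|] [t|] // _ _.
by apply/RleP; rewrite !RplusE /=; lra.
Qed.

(** The tropical reading of a row produced by [max_below]: void at [s = -oo], and requiring finite
    values wherever a coefficient is nonzero. *)
Definition row_bound (I : finType) (r : {ffun I -> nat} * R) (x : I -> Trop) (s : Trop) :=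
  s <> None -> (forall i, r.1 i != 0%N -> x i <> None) /\
    (\sum_i r.1 i)%:R * rv s + r.2 <= \sum_i (r.1 i)%:R * rv (x i).

(** With [D] the sum of the coefficients, an auxiliary variable [v >= s + b / D] is bounded by the
    mean of a list in which each index is repeated as often as its coefficient says. *)
Lemma rep_row_bound (I : finType) (r : {ffun I -> nat} * R) (w : I) : (0 < \sum_i r.1 i)%N ->
  rep (fun x => row_bound r x (x w)).
Proof.
case: r => u b /= D0; pose D : R := (\sum_i u i)%:R.
have D1 : 0 < D by rewrite ltr0n.
pose l := flatten [seq nseq (u i) i | i <- enum I].
have ml i : (i \in l) = (u i != 0%N).
  apply/flatten_mapP/idP => [[j _]|ui]; first by rewrite mem_nseq lt0n => /andP[uj /eqP ->].
  by exists i; rewrite ?mem_enum // mem_nseq lt0n ui eqxx.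
have suml (f : I -> R) : \sum_(i <- l) f i = \sum_i (u i)%:R * f i.
  rewrite /l big_flatten big_map -[index_enum _]enumT; apply: eq_bigr => i _.
  by rewrite big_nseq mulr_natl; elim: (u i) => [|k IH] //=; rewrite mulrS IH.
have sl : (size l)%:R = D.
  have := suml (fun _ => 1); rewrite big_const_seq count_predT iter_addr_0 => ->.
  by rewrite /D natr_sum; apply: eq_bigr => i _; rewrite mulr1.
pose c : tcon (I + 'I_1) := ([:: (0, Some (inr ord0))], [:: (0, Some (inr ord0))], [:: (b / D, Some (inl w))]).
have key x s t : x w = Some s -> b / D + s <= t -> D * t <= \sum_(i <- l) rv (x i) ->
    D * s + b <= \sum_i (u i)%:R * rv (x i).
  by move=> Ew; rewrite -suml => h1 h2; have := divfK (lt0r_neq0 D1) b; nra.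
have mk (x : I -> Trop) : row_bound (u, b) x (x w) ->
   tholds (scat x (fun _ : 'I_1 => tplus (x w) (Some (b / D)))) c /\
   (tplus (x w) (Some (b / D)) <> None -> (forall i, i \in [seq inl i : I + 'I_1 | i <- l] ->
      scat x (fun _ : 'I_1 => tplus (x w) (Some (b / D))) i <> None) /\
     (size [seq inl i : I + 'I_1 | i <- l])%:R * rv (tplus (x w) (Some (b / D))) <=
     \sum_(i <- [seq inl i : I + 'I_1 | i <- l]) rv (scat x (fun _ : 'I_1 => tplus (x w) (Some (b / D))) i)).
  rewrite /row_bound /tholds /=; case: (x w) => [s|] //= H; split.
    by apply/RleP; rewrite !RplusE; lra.
  move=> _; have [h1 h2] := H (@Some_neq_None _); split.
    by move=> _ /mapP[i il ->] /=; apply: h1; rewrite -ml.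
  rewrite size_map sl big_map /= suml RplusE mulrDr.
  by have := divfK (lt0r_neq0 D1) b; rewrite -/D in h2; lra.
apply: rep_ext (rep_exists (rep_and (rep_con c)
    (rep_average [seq inl i : I + 'I_1 | i <- l] (inr ord0))) _) => x.
  split; last by move=> /mk H; exists (fun _ => tplus (x w) (Some (b / D))).
  move=> [v]; rewrite /row_bound /tholds /= size_map sl big_map /=.
  case Ew : (x w) => [s|] // [h1 h2] _.
  case Ev : (v ord0) h1 h2 => [t|] //= /RleP h1 /(_ (@Some_neq_None _))[h2 h3]; split.
    by move=> i ui; apply: (h2 (inl i)); apply: map_f; rewrite ml.
  by apply: (key x s t) => //; rewrite !RplusE in h1; lra.
move=> rx [v H]; exists (fun _ => tplus (x w) (Some (b / D))).
  by move=> _; have := rx w; case: (x w).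
apply: mk; move: H; rewrite /row_bound /tholds /= size_map sl big_map /=.
case Ew : (x w) => [s|] // [h1 h2] _.
case Ev : (v ord0) h1 h2 => [t|] //= /RleP h1 /(_ (@Some_neq_None _))[h2 h3]; split.
  by move=> i ui; apply: (h2 (inl i)); apply: map_f; rewrite ml.
by apply: (key x s t) => //; rewrite !RplusE in h1; lra.
Qed.

(** This is the tropical linear inequality [x k <= max x a], written as a 2x2 constraint with two
    equal diagonal forms. *)
Lemma rep_cover (I : finType) (k : I) (s : seq I) :
  rep (fun x => x k <> None -> exists2 a, a \in s & tle (x k) (x a)).
Proof.
pose L : tterms I := [seq (0, Some a) | a <- s].
apply: rep_ext (rep_con (L, L, [:: (0, Some k)])) => x.
have E (t : R) : tle (Some t) (teval x L) <-> exists2 a, a \in s & tle (Some t) (x a).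
  rewrite /L; elim: s {L} => [|a s IH] /=; first by split=> // -[].
  rewrite -/(teval x _) in IH *; split.
    case Ea : (x a) => [u|] /=; last by move/IH => [b bs h]; exists b => //; rewrite inE bs orbT.
    case Et : (teval x _) IH => [v|] IH /=; last first.
      by move=> h; exists a; rewrite ?mem_head // Ea /= -[u]Rplus_0_l.
    rewrite RmaxE => /RleP; rewrite le_max => /orP[/RleP h|/RleP h].
      by exists a; rewrite ?mem_head // Ea /= -[u]Rplus_0_l.
    by have [b bs h'] := IH.1 h; exists b => //; rewrite inE bs orbT.
  move=> [b]; rewrite inE => /orP[/eqP -> |bs h].
    case: (x a) => [u|] //= h; rewrite Rplus_0_l; case: (teval _ _) => [v|] //=.
    by apply: Rle_trans h _; exact: Rmax_l.
  have {h}h := IH.2 (ex_intro2 _ _ b bs h); move: h; case: (teval x _) => [v|] //= h.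
  by case: (x a) => [u|] //=; apply: Rle_trans h _; exact: Rmax_r.
rewrite /tholds /=; case: (x k) => [t|] /=; last by split.
split.
  move=> h _; apply/E; case: (teval x L) h => [v|] //= /RleP; rewrite !RplusE => h.
  by apply/RleP; lra.
move=> /(_ (@Some_neq_None _))/E; case: (teval x L) => [v|] //= /RleP h.
by apply/RleP; rewrite !RplusE; lra.
Qed.

(* A piece [(K, P)] is a polyhedron of points finite exactly on [K]; coordinate [0] is homogenizing. *)
Definition piece n := ({set 'I_n.+1} * seq (lrow 'I_n.+1))%type.

(** Zero coefficient sums give invariance under adding constants; a point [p] is what [max_below]
    asks for. *)
Definition piece_wf n (pc : piece n) := [/\ ord0 \in pc.1,
  forall r, r \in pc.2 -> \sum_i r.1 i = 0 /\ forall i, i \notin pc.1 -> r.1 i = 0 &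
  exists p, forall r, r \in pc.2 -> rsat r p].

Definition piece_in n (pc : piece n) (y : 'I_n.+1 -> Trop) :=
  exists2 p, (forall r, r \in pc.2 -> rsat r p) & forall i, y i = if i \in pc.1 then Some (p i) else None.

Lemma rsat_shift (I : finType) (r : lrow I) (p : I -> R) c : \sum_i r.1 i = 0 ->
  rsat r (fun i => p i - c) <-> rsat r p.
Proof.
move=> r0; rewrite /rsat; under eq_bigr do rewrite mulrBr.
by rewrite sumrB -mulr_suml -rmorph_sum /= r0 mul0r subr0.
Qed.

Lemma rsat_eq (I : finType) (r : lrow I) (K : {set I}) (p q : I -> R) : (forall i, i \notin K -> r.1 i = 0) ->
  (forall i, i \in K -> p i = q i) -> rsat r p <-> rsat r q.
Proof.
move=> rK pq; rewrite /rsat (eq_bigr (fun i => (r.1 i)%:~R * q i)) // => i _.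
by have [/pq ->|/rK ->] := boolP (i \in K); rewrite ?mul0r.
Qed.

Section Cone.
Variables (n : nat) (Sc : ('I_n -> Trop) -> Prop).
Hypothesis cSc : trop_convex Sc.

(** The tropical cone over [{0} x Sc], restricted to a finite homogenizing coordinate. *)
Definition cone (q : 'I_n.+1 -> Trop) := exists2 c : R, q ord0 = Some c &
  Sc (fun j => tplus (q (lift ord0 j)) (Some (- c))).

(** Normalizing the maximum at coordinate 0 yields the weights [c - max(c, c')] and
    [c' - max(c, c')], whose maximum is 0: tropical convexity becomes stability of the cone under
    maxima. *)
Lemma cone_tmax q q' : cone q -> cone q' -> cone (fun i => tmax (q i) (q' i)).
Proof.
move=> [c Ec Sq] [c' Ec' Sq']; exists (Num.max c c'); first by rewrite Ec Ec' /= RmaxE.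
have := cSc (lam := Some (c - Num.max c c')) (mu := Some (c' - Num.max c c')) Sq Sq'.
rewrite [tmax (Some _) _]/= RmaxE.
have -> : Num.max (c - Num.max c c') (c' - Num.max c c') = 0 by rewrite -addr_maxl subrr.
move=> /(_ erefl); congr Sc; apply: funext => j.
case: (q _) (q' _) => [a|] [b|] //=; rewrite ?RmaxE ?RplusE; congr Some; try ring.
by rewrite [RHS]addr_maxl; congr Num.max; ring.
Qed.

(** The list is nonempty because the cone contains no [-oo] point that could serve as an empty
    maximum. *)
Lemma cone_sup (x : 'I_n.+1 -> Trop) k0 (s : seq 'I_n.+1) :
  (forall k, k \in k0 :: s -> exists q, [/\ cone q, forall i, tle (q i) (x i) & tle (x k) (q k)]) ->
  exists q, [/\ cone q, forall i, tle (q i) (x i) & forall k, k \in k0 :: s -> tle (x k) (q k)].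
Proof.
elim: s k0 => [|a s IH] k0 H.
  have [q [h1 h2 h3]] := H k0 (mem_head _ _); exists q; split=> // k; by rewrite inE => /eqP ->.
have [q [h1 h2 h3]] := H k0 (mem_head _ _).
have [k ks|q' [h1' h2' h3']] := IH a; first by apply: H; rewrite inE ks orbT.
exists (fun i => tmax (q i) (q' i)); split; first exact: cone_tmax.
  by move=> i; apply/tle_tmax.
have ml (a1 b : Trop) : tle a1 (tmax a1 b) by have /tle_tmax[] := tle_refl (tmax a1 b).
have mr (a1 b : Trop) : tle b (tmax a1 b) by have /tle_tmax[] := tle_refl (tmax a1 b).
move=> k; rewrite inE => /orP[/eqP ->|ks]; first exact: tle_trans h3 (ml _ _).
exact: tle_trans (h3' k ks) (mr _ _).
Qed.

Variable Ps : seq (piece n).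
Hypothesis wf : forall pc, pc \in Ps -> piece_wf pc.
Hypothesis HPs : forall y, Sc y <-> exists2 pc, pc \in Ps & piece_in pc (xext y).

Lemma xext0 (y : 'I_n -> Trop) : xext y ord0 = Some 0.
Proof. by rewrite /xext unlift_none. Qed.

Lemma piece_cone pc p : pc \in Ps -> (forall r, r \in pc.2 -> rsat r p) ->
  cone (fun i => if i \in pc.1 then Some (p i) else None).
Proof.
move=> pcP Hp; have [z0 Hr _] := wf pcP; exists (p ord0); first by rewrite z0.
apply/HPs; exists pc => //; exists (fun i => p i - p ord0).
  by move=> r rP; apply/rsat_shift; [exact: (Hr r rP).1|exact: Hp].
move=> i; rewrite /xext; case: unliftP => [j ->|->]; last by rewrite z0 subrr.
by case: ifP.
Qed.

(** For each coordinate [k], every piece containing [k] receives a variable bounding from below what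
    its points under [x] can reach at [k], and [x k] has to be covered by one of these variables. *)
Lemma pieces_rep : rep Sc.
Proof.
pose A := 'I_(size Ps).
pose pc (a : A) := nth (set0, [::]) Ps a.
have pcP a : pc a \in Ps by apply: mem_nth.
have Lex (ak : A * 'I_n.+1) : exists L : seq ({ffun 'I_n.+1 -> nat} * R),
    (forall r, r \in L -> (0 < \sum_i r.1 i)%N /\ forall i, i \notin (pc ak.1).1 -> r.1 i = 0%N) /\
    forall x s, (exists p, [/\ forall r, r \in (pc ak.1).2 -> rsat r p,
       forall i, i \in (pc ak.1).1 -> p i <= x i & s <= p ak.2]) <->
      forall r, r \in L -> (\sum_i r.1 i)%:R * s + r.2 <= \sum_i (r.1 i)%:R * x i.
  have [z0 Hr Hp] := wf (pcP ak.1); apply: max_below => // r /Hr[] //.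
have [L HL] := choice Lex.
pose K a := (pc a).1.
(* For finite [s]: piece [a] has a point below [x] on its support with value at least [s] at [k], in
   the quantifier-free form supplied by [max_below]. *)
pose PK k a (x : 'I_n.+1 -> Trop) (s : Trop) :=
  (forall i, i \in enum (K a) -> s <> None -> x i <> None) /\
  (forall r, r \in L (a, k) -> row_bound r x s).
pose As k := [seq a <- enum A | k \in K a].
pose Z k (x : 'I_n.+1 + A -> Trop) :=
  (x (inl k) <> None -> exists2 a, a \in [seq inr a | a <- As k] & tle (x (inl k)) (x a)) /\
  (forall a, a \in As k -> PK k a (fun i => x (inl i)) (x (inr a))).
have repZ k : rep (Z k).
  apply: rep_and; first exact: rep_cover.
  apply: rep_all => a aA; apply: rep_and.
    by apply: rep_all => i _; exact: (@rep_support _ (inr a) (inl i)).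
  apply: rep_all => r rL; have [D0 _] := (HL (a, k)).1 r rL.
  pose r' : {ffun 'I_n.+1 + A -> nat} * R := ([ffun v => if v is inl i then r.1 i else 0%N], r.2).
  have Ds : (\sum_v r'.1 v)%N = (\sum_i r.1 i)%N.
    rewrite big_sumType /= [X in (_ + X)%N]big1 ?addn0 => [|b _]; last by rewrite ffunE.
    by apply: eq_bigr => i _; rewrite ffunE.
  apply: rep_ext (@rep_row_bound _ r' (inr a) _) => [x|]; last by rewrite Ds.
  rewrite /row_bound Ds.
  have -> : \sum_v (r'.1 v)%:R * rv (x v) = \sum_i (r.1 i)%:R * rv (x (inl i)).
    rewrite big_sumType /= [X in _ + X]big1 ?addr0 => [|b _]; last by rewrite ffunE mul0r.
    by apply: eq_bigr => i _; rewrite ffunE.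
  split=> H sn; have [h1 h2] := H sn; split=> //.
    by move=> i ri; apply: h1; rewrite ffunE.
  by move=> [i|b]; rewrite ffunE //; exact: h1.
pose X (x : 'I_n.+1 -> Trop) := forall k, k \in enum 'I_n.+1 -> exists v : A -> Trop, Z k (scat x v).
have repX : rep X.
  apply: rep_all => k _; apply: rep_exists (repZ k) _ => x rx [v [h1 h2]].
  have s0 a : exists s : R, PK k a x (Some s).
    have [_ _ [p0 Hp0]] := wf (pcP a).
    (* Lowered by [M], the point [p0] of the piece lies below the finite point [x]; its coordinate
       [k] is a finite admissible value. *)
    pose M := \big[Num.max/0]_(i : 'I_n.+1) (p0 i - rv (x i)).
    exists (p0 k - M); split=> [i _ _|r rL _]; first exact: rx.
    split=> [i _|]; first exact: rx.
    apply: ((HL (a, k)).2 (fun i => rv (x i)) (p0 k - M)).1 rL; exists (fun i => p0 i - M); split=> //.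
      move=> r' r'P; apply/rsat_shift; last exact: Hp0.
      by have [_ Hr _] := wf (pcP a); exact: (Hr r' r'P).1.
    move=> i _; have : p0 i - rv (x i) <= M by exact: le_bigmax.
    by lra.
  have [s Hs] := choice s0.
  (* Only the values [-oo] are replaced, so that the variable covering [x k] is kept. *)
  exists (fun a => if v a is Some t then Some t else Some (s a)); first by move=> a; case: (v a).
  split=> [xk|a aA] /=.
    have [b /mapP[a aA ->] hb] := h1 xk; exists (inr a); first exact: map_f.
    by move: hb => /=; case: (v a) => [t|] //; case: (x k) (rx k).
  case E : (v a) => [t|]; last exact: Hs.
  by have := h2 a aA; rewrite /= E.
pose up (k : 'I_n.+1) : 'I_n + 'I_1 := if unlift ord0 k is Some j then inl j else inr ord0.
pose z0 : 'I_n + 'I_1 := inr ord0.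
(* Two opposite constraints pin the homogenizing variable to 0 before it is projected out. *)
have rep0 := rep_and (rep_con ([:: (0, Some z0)], [:: (0, Some z0)], [:: (0, None)]))
  (rep_and (rep_con ([:: (0, None)], [:: (0, None)], [:: (0, Some z0)])) (rep_comp up repX)).
have E0 (a : Trop) (x : 'I_n -> Trop) : (tholds (scat x (fun _ : 'I_1 => a)) ([:: (0, Some z0)], [:: (0, Some z0)], [:: (0, None)]) /\
   tholds (scat x (fun _ : 'I_1 => a)) ([:: (0, None)], [:: (0, None)], [:: (0, Some z0)])) <-> a = Some 0.
  rewrite /tholds /=; case: a => [t|] /=; last by split=> [[]|].
  split=> [[/RleP + /RleP]|[->]]; last by split; apply/RleP; rewrite !RplusE; lra.
  by rewrite !RplusE => h1 h2; congr Some; lra.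
have Eup (x : 'I_n -> Trop) : (fun k => scat x (fun _ : 'I_1 => Some 0) (up k)) = xext x.
  by apply: funext => k; rewrite /up /xext; case: (unlift ord0 k).
have Ev (v : 'I_1 -> Trop) : v = (fun _ => v ord0) by apply: funext => i; rewrite (ord1 i).
have XE y : X (xext y) <-> Sc y.
  split.
    (* Each finite coordinate of [xext y] is attained by a point of the cone below [xext y]; the
       maximum of these points is [xext y] itself. *)
    move=> HX; have [q [h1 h2 h3]] : exists q, [/\ cone q, forall i, tle (q i) (xext y i) &
        forall k, k \in ord0 :: [seq k <- enum 'I_n.+1 | xext y k != None] -> tle (xext y k) (q k)].
      apply: cone_sup => k hk.
      have {hk} yk : xext y k <> None.
        by move: hk; rewrite inE => /orP[/eqP ->|]; [rewrite xext0|rewrite mem_filter => /andP[/eqP]].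
      have [|v [c1 c2]] := HX k; first by rewrite mem_enum.
      have [_ /mapP[a aA ->] /= hle] := c1 yk.
      have [/= pk1 /= pk2] := c2 a aA.
      case Es : (v a) hle pk1 pk2 => [s|] /= hle pk1 pk2; last by case: (xext y k) yk hle.
      have [p [p1 p2 p3]] : exists p, [/\ forall r, r \in (pc a).2 -> rsat r p,
         forall i, i \in (pc a).1 -> p i <= rv (xext y i) & s <= p k].
        apply/((HL (a, k)).2 (fun i => rv (xext y i)) s) => r rL.
        by have [] := pk2 r rL (@Some_neq_None s).
      exists (fun i => if i \in (pc a).1 then Some (p i) else None); split.
      - exact: (piece_cone (pcP a)).
      - move=> i; case: ifP => // iK; have := pk1 i; rewrite mem_enum => /(_ iK (@Some_neq_None s)).
        by have := p2 i iK; case: (xext y i) => [t|] //= /RleP.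
      - move: aA; rewrite mem_filter /K => /andP[-> _].
        by apply: tle_trans hle _; apply/RleP.
    have Eq : q = xext y.
      apply: funext => i; apply: tle_anti => //.
      case E : (xext y i) => [t|] //; rewrite -E; apply: h3.
      by rewrite inE mem_filter mem_enum E /= orbT.
    move: h1; rewrite Eq => -[c]; rewrite xext0 => -[<-]; congr Sc; apply: funext => j.
    rewrite /xext liftK; case: (y j) => [t|] //=; congr Some; rewrite RplusE; lra.
  move=> /HPs[pc0 pc0P [p Hp Ey]] k _.
  have ip : (index pc0 Ps < size Ps)%N by rewrite index_mem.
  pose a0 : A := Ordinal ip; have pa0 : pc a0 = pc0 by rewrite /pc nth_index.
  (* Only the piece containing [y] receives a value, that of [y] at [k]; the constraints of the
     others are void at [-oo]. *)
  exists (fun a => if a == a0 then (if k \in pc0.1 then Some (p k) else None) else None); split=> [/= yk|a aA] /=.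
    exists (inr a0); last by rewrite /= eqxx Ey; exact: tle_refl.
    apply: map_f; rewrite mem_filter mem_enum /K pa0 andbT.
    by move: yk; rewrite Ey; case: ifP.
  case: eqP => [Ea|_]; last by split.
  case: ifP => [kK|_]; last by split.
  have rE i : i \in pc0.1 -> rv (xext y i) = p i by rewrite Ey => ->.
  rewrite {a}Ea in aA *; split=> [i|r rL _].
    by rewrite mem_enum /K pa0 => iK _; rewrite Ey iK.
  have [_ offK] := (HL (a0, k)).1 r rL; rewrite /= pa0 in offK.
  split=> [i ri|].
    have [iK|iK] := boolP (i \in pc0.1); first by rewrite Ey iK.
    by rewrite offK ?eqxx in ri.
  apply: ((HL (a0, k)).2 (fun i => rv (xext y i)) (p k)).1 rL; exists p; rewrite /= pa0; split=> // i iK.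
  by rewrite rE.
apply: rep_ext (rep_exists rep0 _) => [y|x rx [v [H1 [H2 HX]]]].
  split.
    move=> [v]; rewrite (Ev v) => -[H1 [H2 HX]].
    have v0 := (E0 (v ord0) y).1 (conj H1 H2).
    by move: HX; rewrite v0 Eup XE.
  move=> Sy; exists (fun _ => Some 0); have [H1 H2] := (E0 (Some 0) y).2 erefl.
  by split=> //; split=> //; rewrite Eup; apply/XE.
exists v; last by split.
by rewrite (Ev v) in H1 H2 *; move=> i; rewrite ((E0 (v ord0) x).1 (conj H1 H2)).
Qed.
End Cone.

(** * Closed semilinear strata *)

Lemma Q2R_scale (q : Q) : Q2R q * (Pos.to_nat (Qden q))%:R = IZR (Qnum q).
Proof.
rewrite /Q2R -INRE INR_IZR_INZ positive_nat_Z.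
by rewrite -RmultE Rmult_assoc Rinv_l ?Rmult_1_r //; apply: not_0_IZR.
Qed.

Lemma IZR_int (z : Z) : exists m : int, IZR z = m%:~R.
Proof.
case: z => [|p|p]; first by exists 0.
  by exists (Posz (Pos.to_nat p)); rewrite -pmulrn -INRE INR_IZR_INZ positive_nat_Z.
exists (- Posz (Pos.to_nat p)); rewrite rmorphN /= -pmulrn -INRE INR_IZR_INZ positive_nat_Z.
by rewrite -RoppE -opp_IZR.
Qed.

Lemma clear_denominators d (a : 'I_d -> Q) : exists D : nat, exists z : 'I_d -> int,
  (0 < D)%N /\ forall j, D%:R * Q2R (a j) = (z j)%:~R.
Proof.
pose den j := Pos.to_nat (Qden (a j)).
have den0 j : (0 < den j)%N by apply/ssrnat.ltP; exact: Pos2Nat.is_pos.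
pose D := (\prod_j den j)%N.
have [z Hz] := choice (fun j => IZR_int (Qnum (a j))).
exists D, (fun j => (\prod_(i | i != j) den i)%N%:Z * z j); split; first by rewrite prodn_gt0.
move=> j; rewrite rmorphM /= -pmulrn -Hz -Q2R_scale -/(den j) /D (bigD1 j) //= natrM; ring.
Qed.

Section HomogeneousRow.
Variables (n : nat) (K : {set 'I_n}).

Definition hset : {set 'I_n.+1} := [set i | if unlift ord0 i is Some j then j \in K else true].

Definition dehomog (p : 'I_n.+1 -> R) : 'I_#|K| -> R := fun j => p (lift ord0 (enum_val j)) - p ord0.

(** Each coordinate becomes the difference between a coordinate of [p] and its homogenizing
    coordinate, which makes the coefficient sum 0. The factor [D] clears the denominators. *)
Lemma homogeneous_row (a : 'I_#|K| -> Q) b : exists r : lrow 'I_n.+1,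
  (\sum_i r.1 i = 0 /\ forall i, i \notin hset -> r.1 i = 0) /\
  forall p, rsat r p <-> b <= rdot a (dehomog p).
Proof.
have [D [z [D0 Hz]]] := clear_denominators a.
have {}D0 : (0 : R) < D%:R by rewrite ltr0n.
pose e (j : 'I_#|K|) : 'I_n.+1 := lift ord0 (enum_val j).
pose r : lrow 'I_n.+1 := ([ffun i => \sum_j ((e j == i)%:Z - (ord0 == i)%:Z) * z j], D%:R * b).
have delta (A : pzRingType) k (F : 'I_n.+1 -> A) : \sum_i (k == i)%:R * F i = F k.
  rewrite (bigD1 k) //= eqxx mul1r big1 ?addr0 // => j; rewrite eq_sym => /negPf ->; exact: mul0r.
exists r; split; first split.
- under eq_bigr do rewrite ffunE; rewrite exchange_big big1 //= => j _; rewrite -mulr_suml sumrB.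
  have dZ k : \sum_(i < n.+1) (k == i)%:Z = 1.
    by have := delta int k (fun _ => 1); under eq_bigr do rewrite mulr1 natz.
  by rewrite !dZ subrr mul0r.
- move=> i; rewrite inE ffunE => iK; rewrite big1 // => j _.
  have [E|_] := eqVneq (e j) i; first by move: iK; rewrite -E liftK enum_valP.
  have [E|_] := eqVneq ord0 i; first by move: iK; rewrite -E unlift_none.
  by rewrite subrr mul0r.
move=> p; rewrite /rsat.
have -> : \sum_i (r.1 i)%:~R * p i = D%:R * rdot a (dehomog p).
  rewrite rdotE mulr_sumr.
  under eq_bigr do rewrite ffunE rmorph_sum /= mulr_suml.
  rewrite exchange_big; apply: eq_bigr => j _ /=; rewrite mulrA Hz /dehomog -/(e j).
  transitivity ((z j)%:~R * (\sum_i (e j == i)%:R * p i - \sum_i (ord0 == i)%:R * p i)); last by rewrite !delta.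
  rewrite -sumrB mulr_sumr; apply: eq_bigr => i _.
  by rewrite rmorphM rmorphB /= -!pmulrn; ring.
by rewrite ler_pM2l.
Qed.

Definition weak_sat d (B : basic_sl d) (x : 'I_d -> R) :=
  (forall r, List.In r (fst B) -> r.2 <= rdot (fst r) x) /\ (forall r, List.In r (snd B) -> rdot (fst r) x = r.2).

Lemma homogeneous_rows (B : basic_sl #|K|) : exists P : seq (lrow 'I_n.+1),
  (forall r, r \in P -> \sum_i r.1 i = 0 /\ forall i, i \notin hset -> r.1 i = 0) /\
  forall p, (forall r, r \in P -> rsat r p) <-> weak_sat B (dehomog p).
Proof.
suff H (l : list (('I_#|K| -> Q) * R)) : exists P : seq (lrow 'I_n.+1),
    (forall r, r \in P -> \sum_i r.1 i = 0 /\ forall i, i \notin hset -> r.1 i = 0) /\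
    forall p, (forall r, r \in P -> rsat r p) <-> forall r, List.In r l -> r.2 <= rdot r.1 (dehomog p).
  pose neg (r : ('I_#|K| -> Q) * R) : ('I_#|K| -> Q) * R := (fun j => Qopp (r.1 j), - r.2).
  have rneg r x : rdot (neg r).1 x = - rdot r.1 x.
    by rewrite !rdotE -sumrN; apply: eq_bigr => j _; rewrite /= Q2R_opp RoppE mulNr.
  have [P [h1 h2]] := H (B.1 ++ B.2 ++ List.map neg B.2)%list; exists P; split=> // p; rewrite h2; split.
    move=> h; split=> r hr; first by apply: h; apply/List.in_or_app; left.
    apply/eqP; rewrite eq_le; apply/andP; split.
      have := h (neg r); rewrite rneg lerN2; apply.
      by apply/List.in_or_app; right; apply/List.in_or_app; right; exact: List.in_map.
    by apply: h; apply/List.in_or_app; right; apply/List.in_or_app; left.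
  move=> [w1 w2] r hr; case: (List.in_app_or _ _ _ hr) => {}hr; first exact: w1.
  case: (List.in_app_or _ _ _ hr) => {}hr; first by rewrite w2.
  by have [r' [<- hr']] := (List.in_map_iff _ _ _).1 hr; rewrite rneg lerN2 w2.
elim: l => [|[a b] l [P [h1 h2]]]; first by exists [::]; split=> // p; split.
have [r [hr1 hr2]] := homogeneous_row a b.
exists (r :: P); split=> [r'|p]; first by rewrite inE => /orP[/eqP ->|/h1].
split=> [h r' /= [<-|r'l]|h r'].
- by apply/hr2/h; rewrite mem_head.
- by apply: (h2 p).1 r'l => r'' r''P; apply: h; rewrite inE r''P orbT.
rewrite inE => /orP[/eqP ->|r'P]; first by apply/hr2; apply: (h (a, b)); left.
by apply: (h2 p).2 r'P => r'' r''l; apply: h; right.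
Qed.
End HomogeneousRow.

(* A point of the closure of a nonempty basic set is a limit along a segment. *)
Lemma closed_weak_sat d (S : ('I_d -> R) -> Prop) B x0 x : rclosed S ->
  (forall y, in_basic_sl B y -> S y) -> in_basic_sl B x0 -> weak_sat B x -> S x.
Proof.
move=> cS BS [b1 b2] [w1 w2]; apply: contrapT => /cS[e [/RltP e0 H]]; rewrite R0E in e0.
pose M := \big[Num.max/1]_i `|x0 i - x i|.
have M1 : 1 <= M by exact: bigmax_ge_id.
have M0 : 0 < M by lra.
pose t := Num.min 1 (e / (2 * M)).
have t0 : 0 < t by rewrite lt_min ltr01 divr_gt0 // mulr_gt0.
have t1 : t <= 1 by rewrite ge_min lexx.
pose y i := x i + t * (x0 i - x i).
have dy a : rdot a y = (1 - t) * rdot a x + t * rdot a x0.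
  by rewrite !rdotE !mulr_sumr -big_split; apply: eq_bigr => i _ /=; rewrite /y; ring.
apply: (H y) => [i|].
  apply/RltP; rewrite RabsE /y -RminusE RminusE addrC addKr normrM (gtr0_norm t0).
  have h1 : `|x0 i - x i| <= M by exact: le_bigmax.
  have h2 : t * `|x0 i - x i| <= t * M by rewrite ler_pM2l.
  have h3 : t * M <= e / (2 * M) * M by rewrite ler_pM2r // ge_min lexx orbT.
  have h4 : e / (2 * M) * M = e / 2 by field; rewrite gt_eqF.
  by apply: (le_lt_trans h2); apply: (le_lt_trans h3); rewrite h4; lra.
apply: BS; split=> r hr.
  have /RltP h1 := b1 r hr; have h2 := w1 r hr; apply/RltP; rewrite dy.
  have h3 : (1 - t) * r.2 <= (1 - t) * rdot r.1 x by rewrite ler_wpM2l // subr_ge0.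
  have h4 : t * r.2 < t * rdot r.1 x0 by rewrite ltr_pM2l.
  by lra.
by rewrite dy w2 // b2 //; ring.
Qed.

(** Closedness allows the strict inequalities of each nonempty basic set to be weakened without
    leaving the stratum. For the empty support, where no stratum is given, the only candidate is the
    point with all coordinates [-oo]. *)
Lemma stratum_pieces n (Sc : ('I_n -> Trop) -> Prop) (K : {set 'I_n}) :
  (K != set0 -> semilinear (stratum Sc K) /\ rclosed (stratum Sc K)) ->
  exists Ps : seq (piece n), (forall pc, pc \in Ps -> piece_wf pc /\ pc.1 = hset K) /\
    forall y : 'I_n -> Trop, (forall i, i \in K <-> y i <> None) ->
      (Sc y <-> exists2 pc, pc \in Ps & piece_in pc (xext y)).
Proof.
have h0 : ord0 \in hset K by rewrite inE unlift_none.
have [->|K0] := eqVneq K set0; last first.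
  move=> /(_ isT)[[Bs HBs] cS].
  have [Ps [P1 P2]] : exists Ps : seq (piece n), (forall pc, pc \in Ps -> piece_wf pc /\ pc.1 = hset K) /\
      forall p, (exists2 pc, pc \in Ps & forall r, r \in pc.2 -> rsat r p) <->
        exists B, [/\ List.In B Bs, exists x0, in_basic_sl B x0 & weak_sat B (dehomog p)].
    elim: (Bs) => [|B l [Ps [h1 h2]]]; first by exists [::]; split=> // p; split=> [[]//|[B []]].
    (* An empty basic set has to be dropped: its weakened inequalities may well have solutions. *)
    have [[x0 Hx0]|nB] := pselect (exists x0, in_basic_sl B x0); last first.
      exists Ps; split=> // p; rewrite h2; split=> -[B' [hB' hx hw]]; exists B'; split=> //; first by right.
      by case: hB' hx hw => [<-|].
    have [P [hP1 hP2]] := homogeneous_rows B.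
    exists ((hset K, P) :: Ps); split=> [pc|p].
      rewrite inE => /orP[/eqP ->|/h1 //]; split=> //; split=> //.
      exists (fun i => if unlift ord0 i is Some j then
         (if insub j is Some u then x0 (enum_rank_in (valP (u : {j | j \in K})) j) else 0) else 0).
      apply/hP2; have -> : dehomog (fun i : 'I_n.+1 => if unlift ord0 i is Some j then
         (if insub j is Some u then x0 (enum_rank_in (valP (u : {j | j \in K})) j) else 0) else 0) = x0.
        apply: funext => j; rewrite /dehomog liftK unlift_none subr0.
        by case: insubP => [u _ Eu|]; rewrite ?enum_valP // enum_valK_in.
      case: Hx0 => b1 b2; split=> r hr; last exact: b2.
      by have /RltP := b1 r hr; exact: ltW.
    split=> [[pc]|[B' [[<-|hB'] hx hw]]].
    - rewrite inE => /orP[/eqP -> /= /hP2 h|pcP h].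
        by exists B; split=> //; [left|exists x0].
      have [B' [b1 b2 b3]] := (h2 p).1 (ex_intro2 _ _ pc pcP h).
      by exists B'; split=> //; right.
    - by exists (hset K, P); rewrite ?mem_head //; apply/hP2.
    - have [pc pcP h] := (h2 p).2 (ex_intro _ B' (And3 hB' hx hw)).
      by exists pc => //; rewrite inE pcP orbT.
  exists Ps; split=> // y Ky.
  pose z (j : 'I_#|K|) := rv (y (enum_val j)).
  have yz j : y (enum_val j) = Some (z j).
    have := (Ky (enum_val j)).1 (enum_valP j); by rewrite /z; case: (y _).
  have -> : Sc y <-> stratum Sc K z.
    split=> [Sy|[y' [Sy' [Ky' yz']]]]; first by exists y.
    have -> // : y = y'.
    apply: funext => i; have [iK|iK] := boolP (i \in K).
      by rewrite -(enum_rankK_in iK iK) yz yz'.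
    case E : (y i) => [t|]; first by move/negP: iK; case; apply/Ky; rewrite E.
    by case E' : (y' i) => [t|] //; move/negP: iK; case; apply/Ky'; rewrite E'.
  have -> : stratum Sc K z <-> exists B, [/\ List.In B Bs, exists x0, in_basic_sl B x0 & weak_sat B z].
    split.
      move/HBs => [B [hB [b1 b2]]]; exists B; split=> //; first by exists z.
      by split=> // r hr; have /RltP := b1 r hr; exact: ltW.
    move=> [B [hB [x0 hx0] hw]]; apply: closed_weak_sat cS _ hx0 hw => w hw'.
    by apply/HBs; exists B.
  pose p (i : 'I_n.+1) := rv (xext y i).
  have Ep : dehomog p = z.
    by apply: funext => j; rewrite /dehomog /p /xext liftK unlift_none /= subr0.
  have yE i : xext y i = if i \in hset K then Some (p i) else None.
    rewrite inE /p /xext; case: unliftP => [j _|_] //.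
    case E : (y j) => [t|]; first by have -> // : j \in K; apply/Ky; rewrite E.
    by case: ifP => // /Ky; rewrite E.
  rewrite -Ep -P2; split=> -[pc pcP H]; exists pc => //.
    by exists p => // i; rewrite (P1 pc pcP).2.
  case: H => q Hq Eq r rP; have [[_ Hr _] EK] := P1 pc pcP.
  suff pq i : i \in pc.1 -> p i = q i by apply/(rsat_eq (Hr r rP).2 pq); exact: Hq.
  move=> iK; have := Eq i; by rewrite iK yE -EK iK => -[].
move=> _.
have E0 (y : 'I_n -> Trop) : (forall i, i \in set0 <-> y i <> None) -> y = (fun _ => None).
  by move=> Hy; apply: funext => i; apply: contrapT => /Hy; rewrite inE.
have [S0|nS0] := pselect (Sc (fun _ => None)); last first.
  exists [::]; split=> // y /E0 ->; by split=> // -[].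
exists [:: (hset set0, [::])]; split=> [pc|y /E0 ->].
  rewrite inE => /eqP ->; split=> //; split=> //; first by rewrite inE unlift_none.
  by exists (fun _ => 0).
split=> // _; exists (hset set0, [::]); rewrite ?mem_head //.
exists (fun _ => 0) => // i; rewrite inE /xext; case: unliftP => [j _|_] //; by rewrite inE.
Qed.

Lemma closed_strata_rep n (Sc : ('I_n -> Trop) -> Prop) : trop_convex Sc ->
  (forall K : {set 'I_n}, K != set0 -> semilinear (stratum Sc K) /\ rclosed (stratum Sc K)) -> rep Sc.
Proof.
move=> cSc H.
have [f Hf] := choice (fun K => stratum_pieces (H K)).
pose Ps := flatten [seq f K | K <- enum {: {set 'I_n}}].
apply: (@pieces_rep _ _ cSc Ps).
  by move=> pc /flatten_mapP[K _ /(Hf K).1[]].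
move=> y; pose K := [set i | y i != None].
have Ky i : i \in K <-> y i <> None by rewrite inE; split=> /eqP.
rewrite ((Hf K).2 y Ky); split=> -[pc pcP hy]; exists pc => //.
  by apply/flatten_mapP; exists K; rewrite ?mem_enum.
move: pcP => /flatten_mapP[K' _ pcP]; have [_ EK'] := (Hf K').1 pc pcP.
have <- // : K' = K.
case: hy => p _ Ey; apply/setP => i.
have := Ey (lift ord0 i); rewrite EK' !inE /xext liftK => ->; by case: ifP.
Qed.

(** * Reindexing, and strata as sets of finite tropical points *)

Lemma semilinear_reindex d d' (S : ('I_d -> R) -> Prop) (f : 'I_d' -> 'I_d) (g : 'I_d -> 'I_d') :
  cancel f g -> cancel g f -> semilinear S -> semilinear (fun z : 'I_d' -> R => S (fun j => z (g j))).
Proof.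
move=> fK gK [Bs HB].
pose h (r : ('I_d -> Q) * R) : ('I_d' -> Q) * R := (fun i => r.1 (f i), r.2).
have hE r z : rdot (h r).1 z = rdot r.1 (fun j => z (g j)).
  rewrite !rdotE (reindex g) /=; last by exists f => ? _; rewrite ?gK ?fK.
  by apply: eq_bigr => j _; rewrite gK.
exists (List.map (fun B : basic_sl d => (List.map h B.1, List.map h B.2)) Bs) => z; rewrite HB; split.
  move=> [B [hB [b1 b2]]]; exists (List.map h B.1, List.map h B.2); split.
    exact: (List.in_map (fun B : basic_sl d => (List.map h B.1, List.map h B.2))).
  by split=> r /= /List.in_map_iff[r' [<- hr]]; rewrite hE; [exact: b1|exact: b2].
move=> [_ [/List.in_map_iff[B [<- hB]] [b1 b2]]]; exists B; split=> //.
by split=> r hr; rewrite -hE; [apply: (b1 (h r))|apply: (b2 (h r))]; exact: List.in_map.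
Qed.

Lemma rclosed_reindex d d' (S : ('I_d -> R) -> Prop) (g : 'I_d -> 'I_d') :
  rclosed S -> rclosed (fun z : 'I_d' -> R => S (fun j => z (g j))).
Proof.
move=> cS x /cS[e [e0 H]]; exists e; split=> // y Hy; apply: H => j; exact: Hy.
Qed.

Section FullStratum.
Variable k : nat.
Definition full_val (i : 'I_#|[set: 'I_k]|) : 'I_k := enum_val i.
Definition full_rank (j : 'I_k) : 'I_#|[set: 'I_k]| := enum_rank_in (in_setT j) j.

Lemma full_valK : cancel full_val full_rank.
Proof. by move=> i; exact: enum_valK_in. Qed.
Lemma full_rankK : cancel full_rank full_val.
Proof. by move=> j; rewrite /full_val enum_rankK_in. Qed.

Lemma full_stratum (Z : ('I_k -> Trop) -> Prop) z : stratum Z [set: 'I_k] z <->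
  Z (fun j => Some (z (full_rank j))).
Proof.
split=> [[y [Zy [_ Ey]]]|HZ].
  have <- // : y = (fun j => Some (z (full_rank j))).
  by apply: funext => j; rewrite -Ey -/(full_val _) full_rankK.
exists (fun j => Some (z (full_rank j))); split=> //; split=> [i|i]; first by rewrite inE.
by rewrite -[in RHS](full_valK i).
Qed.
End FullStratum.

Section RealStratum.
Variables (n : nat) (Sc : ('I_n -> Trop) -> Prop) (K : {set 'I_n}).

(** The stratum inside its own tropical space, without points at [-oo]. Its only possibly nonempty
    stratum is the full one, so that the results on tropically convex sets with closed semilinear
    strata apply to it. *)
Definition real_stratum (y : 'I_#|K| -> Trop) := exists2 z, stratum Sc K z & y = (fun j => Some (z j)).

Lemma real_stratumE z : real_stratum (fun j => Some (z j)) <-> stratum Sc K z.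
Proof.
split=> [[z' Sz' E]|]; last by exists z.
have -> // : z = z'.
by apply: funext => j; have := congr1 (fun f => f j) E => -[].
Qed.

(** As one of the two weights is 0, a combination of two points of support [K] has support exactly
    [K]. *)
Lemma real_stratum_trop_convex : trop_convex Sc -> trop_convex real_stratum.
Proof.
move=> cSc _ _ lam mu [z [y [Sy [Ky Ey]]] ->] [z' [y' [Sy' [Ky' Ey']]] ->] lm.
pose q i := tmax (tplus lam (y i)) (tplus mu (y' i)).
have qE j : tmax (tplus lam (Some (z j))) (tplus mu (Some (z' j))) = Some (rv (q (enum_val j))).
  by rewrite /q Ey Ey'; case: lam mu lm {q} => [l|] [m|].
exists (fun j => rv (q (enum_val j))); last by apply: funext => j; exact: qE.
exists q; split; first exact: cSc.
split=> [i|j]; last by rewrite -qE /q Ey Ey'.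
split=> [/[dup] /Ky yi /Ky' yi'|].
  by rewrite /q; case: lam mu (y i) (y' i) lm yi yi' {q qE} => [l|] [m|] [a|] [b|].
apply: contra_notT => iK; rewrite /q.
have -> : y i = None by case E : (y i) => [t|] //; move/negP: iK; case; apply/Ky; rewrite E.
have -> : y' i = None by case E : (y' i) => [t|] //; move/negP: iK; case; apply/Ky'; rewrite E.
by case: lam mu {lm q qE} => [l|] [m|].
Qed.

Lemma real_stratum_strata (K' : {set 'I_#|K|}) : semilinear (stratum Sc K) /\ rclosed (stratum Sc K) ->
  semilinear (stratum real_stratum K') /\ rclosed (stratum real_stratum K').
Proof.
move=> [slS cS]; have [->|KT] := eqVneq K' setT.
  have E z : stratum real_stratum setT z <-> stratum Sc K (fun j => z (full_rank j)).
    by rewrite full_stratum real_stratumE.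
  split.
    apply: semilinear_ext (semilinear_reindex (@full_valK _) (@full_rankK _) slS) => z.
    by rewrite E.
  move=> x; rewrite E => /(rclosed_reindex (g := @full_rank _) cS)[e [e0 H]]; exists e; split=> // y /H.
  by rewrite E.
have E z : ~ stratum real_stratum K' z.
  move=> [y [[z' _ Ey] [Ky _]]]; move/eqP: KT; apply; apply/setP => i; rewrite inE.
  by apply/Ky; rewrite Ey.
split; first by apply: semilinear_ext (semilinear_const _ False) => z; split=> // /E.
by move=> x _; exists 1; split=> [|y _]; [apply/RltP; rewrite R0E ltr01|exact: E].
Qed.
End RealStratum.

Local Close Scope ring_scope.
Bind Scope R_scope with R.
Local Open Scope R_scope.

Theorem mainTheorem2 (n : nat) (Sc : ('I_n -> Trop) -> Prop) :
  let cond_i :=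
    exists S : ('I_n -> Kser) -> Prop,
      semialgebraic S /\ kconvex S /\ val_image S Sc in
  let cond_ii :=
    trop_convex Sc /\
    forall K : {set 'I_n}, K != set0 ->
      semilinear (stratum Sc K) /\ rclosed (stratum Sc K) in
  let cond_iii :=
    trop_convex Sc /\
    forall K : {set 'I_n}, K != set0 ->
      exists (n' m : nat) (Qs : 'I_(#|K| + n').+1 -> smatrix m),
        metzler_family Qs /\
        (forall w, metzler_spec Qs w -> forall k, w k <> None) /\
        forall z : 'I_#|K| -> R,
          stratum Sc K z <->
          exists w, metzler_spec Qs w /\ forall j, w (lshift n' j) = Some (z j) in
  let cond_iv :=
    exists (n' m : nat) (Qs : 'I_(n + n').+1 -> smatrix m),
      metzler_family Qs /\
      forall y : 'I_n -> Trop,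
        Sc y <-> exists w, metzler_spec Qs w /\ forall i, w (lshift n' i) = y i in
  (cond_i <-> cond_ii) /\ (cond_i <-> cond_iii) /\ (cond_i <-> cond_iv).
Proof.
move=> cond_i cond_ii cond_iii cond_iv.
have i_ii : cond_i -> cond_ii.
  move=> [S [saS [cS HS]]]; split; first exact: val_image_trop_convex saS cS HS.
  by move=> K _; split; [exact: stratum_semilinear saS HS|exact: stratum_closed saS HS].
have ii_iv : cond_ii -> cond_iv by move=> [cSc H]; apply: rep_metzler; exact: closed_strata_rep.
have iv_i : cond_iv -> cond_i by move=> [n' [m [Qs [_ H]]]]; exact: projection_spec_lift H.
have ii_iii : cond_ii -> cond_iii.
  move=> [cSc H]; split=> // K /H HK.
  have repK : rep (@real_stratum n Sc K).
    apply: closed_strata_rep; first exact: real_stratum_trop_convex.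
    by move=> K' _; exact: real_stratum_strata.
  have [n' [m [Qs [mQ [rQ HQ]]]]] := rep_real_metzler repK.
  by exists n', m, Qs; do 2!split=> //; move=> z; rewrite -HQ real_stratumE.
(* The projection [Z] of the spectrahedron is the valuation of a semialgebraic set; its stratum of
   full support is the given stratum and is therefore closed and semilinear. *)
have iii_ii : cond_iii -> cond_ii.
  move=> [cSc H]; split=> // K /H[n' [m [Qs [_ [_ HQ]]]]].
  pose Z (y : 'I_#|K| -> Trop) := exists w, metzler_spec Qs w /\ forall i, w (lshift n' i) = y i.
  have [S [saS [_ HS]]] := @projection_spec_lift _ _ _ Qs Z (fun y => iff_refl _).
  have E z : stratum Sc K z <-> stratum Z setT (fun i => z (full_val i)).
    rewrite HQ full_stratum (_ : (fun j => Some (z (full_val (full_rank j)))) = fun j => Some (z j)) //.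
    by apply: funext => j; rewrite full_rankK.
  split.
    have := stratum_semilinear setT saS HS.
    move/(semilinear_reindex (@full_rankK _) (@full_valK _)).
    by apply: semilinear_ext => z; rewrite E.
  move=> x; rewrite E => /(rclosed_reindex (g := @full_val _) (stratum_closed saS HS))[e [e0 He]].
  by exists e; split=> // y /He; rewrite E.
by split; [|split]; split; auto.
Qed.
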